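(* Let $p>1$, $D>0$ and $I_D:=\left(-\frac D2,\frac D2\right)$. Then the following hold. (1) For every $a\in\mathbb R$, with the potential $V(x)=ax$, \[ \lambda_{2,p}(I_D,ax)-\lambda_{1,p}(I_D,ax)\ \geq\ (p-1)(2^p-1)\left(\frac{\pi_p}{D}\right)^p , \] and equality holds if and only if $a=0$. (2) For every convex potential $V\in C(\overline{I_D})$, \[ \lambda_{2,p}(I_D,V)-\lambda_{1,p}(I_D,V)\ \geq\ (p-1)(2^p-1)\left(\frac{\pi_p}{D}\right)^p , \] and equality holds if and only if $V$ is constant.
   Context: $\pi_p:=2\int_0^1\frac{ds}{(1-s^p)^{1/p}}=\frac{2\pi}{p\sin(\pi/p)}$. Variational eigenvalues: for a bounded convex domain $\Omega\subset\mathbb R^N$ ($N\ge1$), $1<p<\infty$ and $V\in C(\overline\Omega)$, set \[ \mathcal K:=\{u\in W_0^{1,p}(\Omega):\|u\|_{L^p(\Omega)}=1\},\qquad \mathcal E_V(u):=\int_\Omega(|\nabla u|^p+V|u|^p)\,dx, \] \[ \lambda_{k,p}(\Omega,V):=\inf_{\substack{A\subset\mathcal K\text{ compact, symmetric}\\ \gamma(A)\ge k}}\ \sup_{u\in A}\mathcal E_V(u),\qquad k\ge1, \] where symmetric means $A=-A$ and $\gamma(A)$ is the Krasnosel'skii genus (the least $n$ such that there is a continuous odd map $A\to\mathbb R^n\setminus\{0\}$, $+\infty$ if no such $n$ exists). These are eigenvalues of the Dirichlet problem $-\Delta_pu+V|u|^{p-2}u=\lambda|u|^{p-2}u$ in $\Omega$,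 $u=0$ on $\partial\Omega$, with $\Delta_pu=\operatorname{div}(|\nabla u|^{p-2}\nabla u)$. Here $N=1$ and $\Omega=I_D$. *)

(* Defs.v *)
From HB Require Import structures.
From mathcomp Require Import all_boot all_order all_algebra.
From mathcomp Require Import all_classical all_reals all_analysis.
From mathcomp Require Import measurable_realfun ess_sup_inf.

Set Implicit Arguments.
Unset Strict Implicit.
Unset Printing Implicit Defensive.

Import Order.TTheory GRing.Theory Num.Theory.
Import numFieldNormedType.Exports.

Local Open Scope classical_set_scope.
Local Open Scope ring_scope.

(* [LspaceType mu p1] is the quotient of L^p functions by a.e. equality; it is
   made here into a normed module, with the operations computed on
   representatives. *)
Section Lspace_normed.
Context d (T : measurableType d) (R : realType).
Variables (mu : {measure set T -> \bar R}) (p : \bar R) (p1 : (1 <= p)%E).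

Local Notation Lp := (LspaceType mu p1).

Lemma ae_eq_Lnorm (f g : T -> R) :
  measurable_fun setT f -> measurable_fun setT g -> f = g %[ae mu] ->
  'N[mu]_p[EFin \o f]%E = 'N[mu]_p[EFin \o g]%E.
Proof.
move=> mf mg fg; case: p p1 => [r r1| |//].
- rewrite unlock /Lnorm; congr (_ `^ _)%E.
  apply: ae_eq_integral => //.
  + apply/measurable_EFinP.
    apply: (@measurableT_comp _ _ _ _ _ _ (@powR R ^~ r)) => //.
    exact: measurableT_comp.
  + apply/measurable_EFinP.
    apply: (@measurableT_comp _ _ _ _ _ _ (@powR R ^~ r)) => //.
    exact: measurableT_comp.
  + by apply: filterS fg => x /= /[apply] ->.
- move=> _; rewrite unlock /Lnorm; case: ifPn => // _.
  by apply: eq_ess_sup; apply: filterS fg => x /= /(_ I) ->.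
Qed.

Lemma Lspace_Lfun (f : Lp) : (f : T -> R) \in Lfun mu p.
Proof.
apply/andP; split; rewrite inE /=; last exact: Lebesgue_finite.
by move=> mT Y mY; apply: (@measurable_funPT _ _ T (measurableTypeR R)
  (repr (f : {mfun_ mu, T >-> measurableTypeR R}))).
Qed.

Definition Lspace_repr (f : Lp) : LfunType mu p1 := Lfun_Sub p1 (Lspace_Lfun f).

Section class.
Variable f : LfunType mu p1.

Let measurable_f : @measurable_fun _ _ T (measurableTypeR R) setT f.
Proof. by move=> mT Y mY; exact: (@measurable_funPT _ _ _ _ f). Qed.

(* [LspaceType] is built over [measurableTypeR R], [LfunType] over [R]: the
   measurable sets are convertible, but the displays differ. *)
Definition Lfun_mfun : {mfun T >-> measurableTypeR R} :=
  HB.pack (f : T -> R)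
    (@isMeasurableFun.Build _ _ T (measurableTypeR R) f measurable_f).

Definition Lspace_class_mfun : {mfun_ mu, T >-> measurableTypeR R} :=
  (\pi_({mfun_ mu, T >-> measurableTypeR R}) Lfun_mfun)%qT.

Let class_mfunE : (Lspace_class_mfun : T -> R) = f %[ae mu].
Proof.
by have /eqmodP/asboolP := reprK Lspace_class_mfun.
Qed.

Let class_fin : finite_norm mu p (Lspace_class_mfun : T -> R).
Proof.
rewrite /finite_norm (@ae_eq_Lnorm _ f)//; first exact: Lfunction_finite.
by move=> mT Y mY; apply: (@measurable_funPT _ _ T (measurableTypeR R)
  (repr Lspace_class_mfun)).
Qed.

Definition Lspace_class : Lp :=
  HB.pack Lspace_class_mfun
    (@isFinLebesgue.Build _ T R mu p p1 Lspace_class_mfun class_fin).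

Lemma Lspace_classE : (Lspace_class : T -> R) = f %[ae mu].
Proof. exact: class_mfunE. Qed.

End class.

Lemma Lspace_eqP (f g : Lp) :
  f = g <-> (f : T -> R) = (g : T -> R) %[ae mu].
Proof.
split=> [->|]; first exact: ae_eq_refl.
case: f => f [[fin_f]]; case: g => g [[fin_g]] fg.
have {fg} : f = g by rewrite -[f]reprK -[g]reprK; apply/eqmodP/asboolP.
move=> fg; rewrite {}fg in fin_f *.
by rewrite (Prop_irrelevance fin_f fin_g).
Qed.

HB.instance Definition _ := gen_eqMixin Lp.
HB.instance Definition _ := gen_choiceMixin Lp.

Definition Lspace_add (f g : Lp) :=
  Lspace_class (Lspace_repr f + Lspace_repr g).
Definition Lspace_opp (f : Lp) := Lspace_class (- Lspace_repr f).
Definition Lspace_scale (a : R) (f : Lp) := Lspace_class (a *: Lspace_repr f).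
Definition Lspace_zero : Lp := Lspace_class 0.

Let addE f g : (Lspace_add f g : T -> R) = (f : T -> R) \+ g %[ae mu].
Proof. exact: Lspace_classE. Qed.
Let oppE f : (Lspace_opp f : T -> R) = \- (f : T -> R) %[ae mu].
Proof. exact: Lspace_classE. Qed.
Let scaleE a f : (Lspace_scale a f : T -> R) = a \*: (f : T -> R) %[ae mu].
Proof. exact: Lspace_classE. Qed.
Let zeroE : (Lspace_zero : T -> R) = cst 0 %[ae mu].
Proof. exact: Lspace_classE. Qed.

Let addA : associative Lspace_add.
Proof.
move=> f g h; apply/Lspace_eqP.
apply: filterS2 (filterI (addE g h) (addE f g))
  (filterI (addE (Lspace_add f g) h) (addE f (Lspace_add g h))).
move=> x [/(_ I) /= a /(_ I) /= b] [/(_ I) /= c /(_ I) /= e] _.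
by rewrite c e a b addrA.
Qed.

Let addC : commutative Lspace_add.
Proof.
move=> f g; apply/Lspace_eqP; have := addE f g; have := addE g f.
by apply: filterS2 => x /(_ I) /= a /(_ I) /= b _; rewrite a b addrC.
Qed.

Let add0 : left_id Lspace_zero Lspace_add.
Proof.
move=> f; apply/Lspace_eqP; have := addE Lspace_zero f; have := zeroE.
by apply: filterS2 => x /(_ I) /= a /(_ I) /= b _; rewrite b a add0r.
Qed.

Let addN : left_inverse Lspace_zero Lspace_opp Lspace_add.
Proof.
move=> f; apply/Lspace_eqP.
have := addE (Lspace_opp f) f; have := oppE f; have := zeroE.
apply: filterS3 => x /(_ I) /= a /(_ I) /= b /(_ I) /= c _.
by rewrite c b a addNr.
Qed.

HB.instance Definition _ := GRing.isZmodule.Build Lp addA addC add0 addN.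

Let scaleA a b f : Lspace_scale a (Lspace_scale b f) = Lspace_scale (a * b) f.
Proof.
apply/Lspace_eqP; have := scaleE a (Lspace_scale b f).
have := scaleE b f; have := scaleE (a * b) f.
apply: filterS3 => x /(_ I) /= e /(_ I) /= g /(_ I) /= h _.
by rewrite h g e /= scalerA.
Qed.

Let scale1 : left_id 1 Lspace_scale.
Proof.
move=> f; apply/Lspace_eqP; have := scaleE 1 f.
by apply: filterS => x /(_ I) /= e _; rewrite e scale1r.
Qed.

Let scaleDr : right_distributive Lspace_scale +%R.
Proof.
move=> a f g; apply/Lspace_eqP.
apply: filterS3 (filterI (scaleE a g) (scaleE a f))
  (filterI (addE (Lspace_scale a f) (Lspace_scale a g)) (addE f g))
  (scaleE a (f + g)).
move=> x [/(_ I) /= b /(_ I) /= c] [/(_ I) /= e /(_ I) /= h] /(_ I) /= i _.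
by rewrite i h e b c scalerDr.
Qed.

Let scaleDl f : {morph Lspace_scale^~ f : a b / a + b}.
Proof.
move=> a b; apply/Lspace_eqP.
apply: filterS2 (filterI (scaleE b f) (scaleE a f))
  (filterI (addE (Lspace_scale a f) (Lspace_scale b f)) (scaleE (a + b) f)).
move=> x [/(_ I) /= c /(_ I) /= e] [/(_ I) /= h /(_ I) /= i] _.
by rewrite i h e c scalerDl.
Qed.

HB.instance Definition _ :=
  GRing.Zmodule_isLmodule.Build R Lp scaleA scale1 scaleDr scaleDl.

Lemma LspaceDE (f g : Lp) : (f + g : T -> R) = (f : T -> R) \+ g %[ae mu].
Proof. exact: addE. Qed.
Lemma LspaceNE (f : Lp) : (- f : T -> R) = \- (f : T -> R) %[ae mu].
Proof. exact: oppE. Qed.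
Lemma LspaceZE a (f : Lp) : (a *: f : T -> R) = a \*: (f : T -> R) %[ae mu].
Proof. exact: scaleE. Qed.
Lemma Lspace0E : ((0 : Lp) : T -> R) = cst 0 %[ae mu].
Proof. exact: zeroE. Qed.

Definition Lspace_norm (f : Lp) : R := fine ('N[mu]_p[EFin \o (f : T -> R)])%E.

Let mLp (f : Lp) : measurable_fun setT (f : T -> R).
Proof. exact: (@measurable_funPT _ _ _ _ (Lspace_repr f)). Qed.

Let norm_class (f : LfunType mu p1) :
  Lspace_norm (Lspace_class f) = fine ('N[mu]_p[EFin \o f])%E.
Proof.
by rewrite /Lspace_norm (@ae_eq_Lnorm _ f)//; exact: Lspace_classE.
Qed.

Let normD (f g : Lp) : Lspace_norm (f + g) <= Lspace_norm f + Lspace_norm g.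
Proof.
by rewrite norm_class; exact: (ler_LnormD (Lspace_repr f) (Lspace_repr g)).
Qed.

Let normZ (a : R) (f : Lp) : Lspace_norm (a *: f) = `|a| * Lspace_norm f.
Proof.
rewrite norm_class (LnormZ (Lspace_repr f) a) fineM//.
by rewrite ge0_fin_numE ?Lnorm_ge0//; exact: Lebesgue_finite.
Qed.

Let norm0_eq0 (f : Lp) : Lspace_norm f = 0 -> f = 0.
Proof.
move=> f0; apply/Lspace_eqP.
have := @fine_Lnormr_eq0 _ _ _ mu p p1 (Lspace_repr f) f0; have := Lspace0E.
by apply: filterS2 => x /(_ I) a /(_ I) b _; rewrite a; exact: b.
Qed.

HB.instance Definition _ :=
  Lmodule_isNormed.Build R Lp normD normZ norm0_eq0.

Lemma Lspace_normE (f : Lp) :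
  `|f| = fine ('N[mu]_p[EFin \o (f : T -> R)])%E.
Proof. by []. Qed.

End Lspace_normed.

Section pi_p.
Context {R : realType}.

Definition pi_p (p : R) : R :=
  2 * \int[lebesgue_measure]_(s in `]0, 1[) ((1 - s `^ p) `^ p^-1)^-1.

Definition gap_bound (p D : R) : R :=
  (p - 1) * (2 `^ p - 1) * (pi_p p / D) `^ p.

End pi_p.

Section genus.
Context {R : realType} {X : normedModType R}.

Definition odd_map_to (A : set X) (n : nat) : Prop :=
  exists h : X -> 'rV[R]_n, [/\ {within A, continuous h},
    forall x, A x -> h (- x) = - h x & forall x, A x -> h x != 0].

(* The infimum is a minimum when some n is admissible, and +oo otherwise. *)
Definition genus (A : set X) : \bar R :=
  ereal_inf [set (n%:R)%:E | n in odd_map_to A].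

End genus.

Section sobolev.
Context {R : realType}.

Definition itvD (D : R) : set R := `](- (D / 2)), (D / 2)[.

Definition citvD (D : R) : set R := `[(- (D / 2)), (D / 2)].

Definition lebesgue_itvD (D : R) : {measure set (measurableTypeR R) -> \bar R} :=
  mrestr lebesgue_measure
    (measurable_itv `](- (D / 2)), (D / 2)[ : measurable (itvD D)).

Definition test_function (D : R) (phi : R -> R) : Prop :=
  (forall n x, derivable (derive1n n phi) x 1) /\
  exists K : set R, [/\ compact K, K `<=` itvD D & forall x, ~ K x -> phi x = 0].

Definition weak_derivative (D : R) (u g : R -> R) : Prop :=
  forall phi, test_function D phi ->
    \int[lebesgue_measure]_(x in itvD D) (u x * (phi^`())%classic x) =
    - \int[lebesgue_measure]_(x in itvD D) (g x * phi x).

Variables (p : R) (p1 : 1 < p) (D : R).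

Lemma EFin_le1 : (1 <= p%:E)%E. Proof. by rewrite lee_fin ltW. Qed.

Local Notation Lp := (LspaceType (lebesgue_itvD D) EFin_le1).

(* A Sobolev function u is represented by the pair (u, u'); u' is determined by u
   up to a.e. equality, so w |-> w.1 is injective on [W1p]. The topology of
   W^{1,p} is then the one induced by the product L^p x L^p. *)
Definition W1p : set (Lp * Lp) :=
  [set w : Lp * Lp | weak_derivative D w.1 w.2].

Definition test_pair : set (Lp * Lp) :=
  [set w : Lp * Lp | exists2 phi, test_function D phi &
     ((w.1 : R -> R) = phi %[ae lebesgue_itvD D]) /\
     ((w.2 : R -> R) = (phi^`())%classic %[ae lebesgue_itvD D])].

(* The closure of C_c^oo in W^{1,p} *)
Definition W1p0 : set (Lp * Lp) := W1p `&` closure test_pair.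

Definition unit_sphere : set (Lp * Lp) :=
  W1p0 `&` [set w : Lp * Lp | `|w.1| = 1].

Definition energy (V : R -> R) (w : Lp * Lp) : \bar R :=
  (\int[lebesgue_measure]_(x in itvD D)
     (`|(w.2 : R -> R) x| `^ p + V x * `|(w.1 : R -> R) x| `^ p)%R%:E)%E.

Definition admissible (k : nat) : set (set (Lp * Lp)) :=
  [set A | [/\ A `<=` unit_sphere, compact A, A = -%R @` A
             & (k%:R%:E <= genus A)%E]].

Definition lambda (k : nat) (V : R -> R) : \bar R :=
  ereal_inf [set ereal_sup (energy V @` A) | A in admissible k].

End sobolev.

(* Main.v *)
Require Import Defs.
From HB Require Import structures.
From mathcomp Require Import all_boot all_order all_algebra.
From mathcomp Require Import all_classical all_reals all_analysis.
From mathcomp Require Import measurable_realfun ess_sup_inf.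
From mathcomp Require Import ring lra.

(* The Riccati substitution [w = |u'/u|^(p-2) u'/u] turns the eigenvalue equation into
   [w' + (p-1) |w|^(p/(p-1)) = V - lam], whose left-hand side is convex in [w]; the first
   eigenvalue is the largest [lam] admitting a subsolution that may start at [+oo]. By
   shooting there are [lam1] with such a solution on the whole interval, and [mu] with
   solutions on both sides of some node [c]; these are the first two variational
   eigenvalues (Young's inequality for the lower bounds, truncated eigenfunctions as
   competitors for the upper bounds).

   For convex [V] compare with a linear potential [L = beta x]. Averaging the ground state
   of [L] with that of the zero potential and rescaling to the two halves ]-D/2, c[ and
   ]c, D/2[, of lengths [l1], [l2], gives subsolutions [Z] for [L]; [beta] is chosen so
   that both have the same level [z], and then
     [z - lam1 L = kap ((D/l1)^(p-1) + (D/l2)^(p-1) - 1)], [kap = (p-1) (pi_p/D)^p],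
   which is at least the claimed gap, with equality only for [l1 = l2], that is
   [beta = 0]. As [V - L] is convex, the ground states of [V] and [L] are ordered on one
   side of [c]; there adding the increment [Z - w_L] to the ground state of [V] gives a
   subsolution for [V] at the level [lam1 V + z - lam1 L], whence
   [mu - lam1 V >= z - lam1 L], and equality forces [V - L] to be constant. *)

Set Implicit Arguments.
Unset Strict Implicit.
Unset Printing Implicit Defensive.

Import Order.TTheory GRing.Theory Num.Theory.
Import numFieldNormedType.Exports.

Local Open Scope classical_set_scope.
Local Open Scope ring_scope.

(** For p <> 2 eigenfunctions cannot be superposed, so the comparison is carried by subsolutions of
    the Riccati equation, which can be averaged and rescaled. The price is that comparisons have to
    start at ends where [w] is infinite. The remedy is to measure [w] by a generalized arctangent
    [angle]: it is bounded, and in it the equation has a Lipschitz right-hand side for every p > 1,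
    so that Gronwall applies up to the Dirichlet ends. A subsolution at the level of the ground
    state is squeezed against it from both ends and must coincide with it; this rigidity gives the
    maximality of the level and, later, the cases of equality.

    The node [c] of the second eigenfunction of [V] may lie off the centre, and then a constant
    comparison potential is not enough: the slope [beta] compensates the different lengths of the
    two nodal intervals.

    No minimiser is ever constructed. A set of genus at least 2 contains a function vanishing at
    [c], which decouples the two halves in the lower bound; the upper bound uses explicit sets. *)

Section calculus.
Context {R : realType}.
Implicit Types (f g df : R -> R) (x y s t a b : R).
Local Notation mu := (@lebesgue_measure R).

Lemma is_derive_continuous f x d : is_derive x 1 f d -> {for x, continuous f}.
Proof.
by move=> [df _]; apply/differentiable_continuous/derivable1_diffP.
Qed.

Lemma is_derive_within f df s t :
  (forall x, s <= x <= t -> is_derive x 1 f (df x)) ->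
  {within `[s, t], continuous f}.
Proof.
move=> dF; apply: continuous_in_subspaceT => x; rewrite inE/= in_itv/= => xst.
exact/is_derive_continuous/dF.
Qed.

Lemma is_derive_MVT f df s t : s <= t ->
  (forall x, s <= x <= t -> is_derive x 1 f (df x)) ->
  exists2 c, s <= c <= t & f t - f s = df c * (t - s).
Proof.
move=> st dF; have [||c cst e] := @MVT_segment R f df s t st.
- by move=> x /[!in_itv]/= /andP[sx xt]; apply: dF; rewrite !ltW.
- exact: is_derive_within dF.
- by exists c => //; move: cst; rewrite in_itv.
Qed.

Lemma is_derive_ndecr f df s t : s <= t ->
  (forall x, s <= x <= t -> is_derive x 1 f (df x)) ->
  (forall x, s <= x <= t -> 0 <= df x) -> f s <= f t.
Proof.
move=> st dF df0; have [c cst e] := is_derive_MVT st dF.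
by rewrite -subr_ge0 e mulr_ge0 ?df0// subr_ge0.
Qed.

Lemma is_derive_incr f df s t : s < t ->
  (forall x, s <= x <= t -> is_derive x 1 f (df x)) ->
  (forall x, s <= x <= t -> 0 < df x) -> f s < f t.
Proof.
move=> st dF df0; have [c cst e] := is_derive_MVT (ltW st) dF.
by rewrite -subr_gt0 e mulr_gt0 ?df0// subr_gt0.
Qed.

Lemma is_derive_cst_eq f s t : s <= t ->
  (forall x, s <= x <= t -> is_derive x 1 f 0) -> f s = f t.
Proof.
move=> st dF; have [c cst e] := @is_derive_MVT f (fun=> 0) s t st dF.
by apply/esym/eqP; rewrite -subr_eq0 e mul0r.
Qed.

Lemma is_derive_ext f g x d : (\forall y \near x, f y = g y) ->
  is_derive x 1 f d -> is_derive x 1 g d.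
Proof.
by move=> fg; apply: near_eq_is_derive; rewrite ?oner_eq0.
Qed.

Lemma near_itvoo x a b : a < x -> x < b -> \forall y \near x, a < y < b.
Proof.
move=> ax xb; have : `]a, b[%classic x by rewrite /= in_itv/= ax.
by move/(near_in_itvoo); apply: filterS => y /[!in_itv].
Qed.

Lemma is_derive_local f g x d a b : a < x -> x < b ->
  (forall y, a < y < b -> f y = g y) ->
  is_derive x 1 f d -> is_derive x 1 g d.
Proof.
move=> ax xb fg; apply: is_derive_ext.
by apply: filterS (near_itvoo ax xb) => y; exact: fg.
Qed.

Lemma is_derive_add f g x (a b : R) : is_derive x 1 f a -> is_derive x 1 g b ->
  is_derive x 1 (fun y => f y + g y) (a + b).
Proof. exact: is_deriveD. Qed.

Lemma is_derive_opp f x (a : R) : is_derive x 1 f a ->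
  is_derive x 1 (fun y => - f y) (- a).
Proof. exact: is_deriveN. Qed.

Lemma is_derive_sub f g x (a b : R) : is_derive x 1 f a -> is_derive x 1 g b ->
  is_derive x 1 (fun y => f y - g y) (a - b).
Proof. by move=> fa gb; exact: is_derive_add fa (is_derive_opp gb). Qed.

Lemma is_derive_mul f g x (a b : R) : is_derive x 1 f a -> is_derive x 1 g b ->
  is_derive x 1 (fun y => f y * g y) (a * g x + f x * b).
Proof.
move=> fa gb; have := is_deriveM fa gb; rewrite addrC => /is_derive_eq; apply.
by rewrite [in RHS]mulrC.
Qed.

Lemma is_derive_scale f x (k a : R) : is_derive x 1 f a ->
  is_derive x 1 (fun y => k * f y) (k * a).
Proof. exact: is_deriveZ. Qed.

Lemma is_derive_comp f g x (a b : R) : is_derive x 1 g b ->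
  is_derive (g x) 1 f a -> is_derive x 1 (fun y => f (g y)) (a * b).
Proof. by move=> gb fa; exact: (is_derive1_comp fa gb). Qed.

Lemma is_derive_const (k x : R) : is_derive x 1 (fun _ : R => k) 0.
Proof. exact: is_derive_cst. Qed.

Lemma is_derive_inv f x (a : R) : is_derive x 1 f a -> f x != 0 ->
  is_derive x 1 (fun y => (f y)^-1) (- a / (f x) ^+ 2).
Proof.
move=> fa fx; have := is_deriveV fx fa; rewrite -[_ *: _]/(_ * _) mulNr -mulrN.
by rewrite mulrC.
Qed.

Lemma is_derive_affine x (c m : R) : is_derive x 1 (fun y => c * y + m) c.
Proof.
by apply: is_derive_eq; rewrite addr0 -[c%:A]/(c * 1) mulr1.
Qed.

Lemma is_derive_affine_comp f x (c m d : R) : is_derive (c * x + m) 1 f d ->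
  is_derive x 1 (fun y => f (c * y + m)) (c * d).
Proof.
move=> fd; have := @is_derive_comp f (fun y => c * y + m) _ _ _ (is_derive_affine x c m) fd.
by rewrite (mulrC d).
Qed.

End calculus.

(** * Signed powers *)

(** The odd power function; [q * spow (q - 1)] is the derivative of the q-th power of the absolute
    value, also at 0 when q > 1. *)
HB.lock Definition spow {R : realType} (q x : R) : R := Num.sg x * `|x| `^ q.

Section signed_powers.
Context {R : realType}.
Implicit Types (q x y : R).

Lemma spow_gt0E q x : 0 < x -> spow q x = x `^ q.
Proof. by move=> x0; rewrite spow.unlock gtr0_sg// mul1r gtr0_norm. Qed.

Lemma spow_lt0E q x : x < 0 -> spow q x = - (- x) `^ q.
Proof. by move=> x0; rewrite spow.unlock ltr0_sg// mulN1r ltr0_norm. Qed.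

Lemma spow0 q : spow q 0 = 0.
Proof. by rewrite spow.unlock sgr0 mul0r. Qed.

Lemma spowN q x : spow q (- x) = - spow q x.
Proof. by rewrite spow.unlock sgrN normrN mulNr. Qed.

Lemma spow_gt0 q x : 0 < x -> 0 < spow q x.
Proof. by move=> x0; rewrite spow_gt0E// powR_gt0. Qed.

Lemma spow_lt0 q x : x < 0 -> spow q x < 0.
Proof. by move=> x0; rewrite spow_lt0E// oppr_lt0 powR_gt0// oppr_gt0. Qed.

Lemma spow_lt q x y : 0 < q -> x < y -> spow q x < spow q y.
Proof.
move=> q0 xy; have [x0|x0|x0] := ltgtP x 0; last first.
- by rewrite x0 spow0 spow_gt0// -x0.
- have y0 := lt_trans x0 xy; rewrite !spow_gt0E//.
  by apply: gt0_ltr_powR => //; rewrite nnegrE ltW.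
- have [y0|y0] := ltP y 0.
    rewrite !spow_lt0E// ltrN2; apply: gt0_ltr_powR => //.
    + by rewrite nnegrE; lra.
    + by rewrite nnegrE; lra.
    + by rewrite ltrN2.
  apply: lt_le_trans (spow_lt0 q x0) _.
  by rewrite spow.unlock mulr_ge0 ?sgr_ge0// powR_ge0.
Qed.

Lemma abspow_le q x y : 0 <= q -> `|x| <= `|y| -> `|x| `^ q <= `|y| `^ q.
Proof. by move=> q0 xy; apply: ge0_ler_powR; rewrite ?nnegrE. Qed.

Lemma abspow0 q : q != 0 -> `|0 : R| `^ q = 0.
Proof. by move=> q0; rewrite normr0 powR0. Qed.

Lemma spow_continuous0 q : 0 < q -> {for 0, continuous (spow q)}.
Proof.
move=> q0; rewrite /prop_for /continuous_at spow0; apply/cvgrPdist_lt => e e0.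
rewrite near_simpl; exists (e `^ q^-1); first by rewrite /= powR_gt0.
move=> z /=; rewrite !sub0r !normrN => ze.
have [->|z0] := eqVneq z 0; first by rewrite spow0 normr0.
rewrite spow.unlock normrM normr_sg z0 mul1r ger0_norm ?powR_ge0//.
have -> : e = (e `^ q^-1) `^ q by rewrite -powRrM mulVf ?powRr1 ?ltW//; lra.
by apply: gt0_ltr_powR; rewrite ?nnegrE ?powR_ge0.
Qed.

Lemma abspow_is_derive q x : 1 < q ->
  is_derive x 1 (fun y => `|y| `^ q) (q * spow (q - 1) x).
Proof.
move=> q1; have [x0|x0|->] := ltgtP x 0.
- have e : q * spow (q - 1) x = q * (- x) `^ (q - 1) * - 1.
    by rewrite spow_lt0E// mulrN mulrN1.
  rewrite e; apply: (@is_derive_local _ (fun y => (- y) `^ q) _ _ _ (x - 1) 0) => //.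
  + by lra.
  + by move=> y /andP[_ y0]; rewrite ltr0_norm.
  + apply: (@is_derive_comp _ (@powR R ^~ q) -%R).
    by apply: is_derive1_powR; lra.
- rewrite spow_gt0E//; apply: (@is_derive_local _ (@powR R ^~ q) _ _ _ 0 (x + 1)) => //.
  + by lra.
  + by move=> y /andP[y0 _]; rewrite gtr0_norm.
  + exact: is_derive1_powR.
(* At 0 the slope function of [|y|^q] is [spow (q - 1)] itself, which is continuous there because q
   > 1. *)
- rewrite spow0 mulr0; apply/is_derive1_caratheodory.
  exists (spow (q - 1)); split; last exact: spow0.
  + move=> z; rewrite abspow0 ?subr0; last by lra.
    have [->|z0] := eqVneq z 0; first by rewrite mulr0 abspow0//; lra.
    by rewrite spow.unlock mulrAC -normrEsg mulr_powRB1//; lra.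
  + by apply: spow_continuous0; lra.
Qed.

Lemma spow_continuous q : 0 < q -> continuous (spow q).
Proof.
move=> q0 x; have [x0|x0|->] := ltgtP x 0.
- apply: (@is_derive_continuous _ _ _ (- (q * (- x) `^ (q - 1) * - 1))).
  apply: (@is_derive_local _ (fun y => - (- y) `^ q) _ _ _ (x - 1) 0) => //.
  + by lra.
  + by move=> y /andP[_ y0]; rewrite spow_lt0E.
  + apply: is_derive_opp; apply: (@is_derive_comp _ (@powR R ^~ q) -%R).
    by apply: is_derive1_powR; lra.
- apply: (@is_derive_continuous _ _ _ (q * x `^ (q - 1))).
  apply: (@is_derive_local _ (@powR R ^~ q) _ _ _ 0 (x + 1)) => //.
  + by lra.
  + by move=> y /andP[y0 _]; rewrite spow_gt0E.
  + exact: is_derive1_powR.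
- exact: spow_continuous0.
Qed.

Lemma normr_spow q x : 0 < q -> `|spow q x| = `|x| `^ q.
Proof.
move=> q0; have [->|x0] := eqVneq x 0; first by rewrite spow0 normr0 powR0 ?gt_eqF.
by rewrite spow.unlock normrM normr_sg x0 mul1r ger0_norm ?powR_ge0.
Qed.

Lemma abspow_continuous q : 0 < q -> continuous (fun y : R => `|y| `^ q).
Proof.
move=> q0 x; have -> : (fun y : R => `|y| `^ q) = (fun y => `|spow q y|).
  by apply/funext => y; rewrite normr_spow.
by apply: continuous_comp; [exact: spow_continuous|exact: norm_continuous].
Qed.

Lemma abspow_comp_continuous {X : topologicalType} (f : X -> R) q (x : X) : 0 < q ->
  {for x, continuous f} -> {for x, continuous (fun y : X => `|f y| `^ q)}.
Proof.
move=> q0 cf; apply: (@continuous_comp _ _ _ f (fun y => `|y| `^ q)) => //.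
exact: abspow_continuous.
Qed.

End signed_powers.

(** * Convexity inequalities for powers *)

Section convexity_of_powers.
Context {R : realType}.
Implicit Types (q x y a b m : R).

Lemma spow_le q x y : 0 < q -> x <= y -> spow q x <= spow q y.
Proof.
by move=> q0; rewrite le_eqVlt => /predU1P[->//|xy]; rewrite ltW// spow_lt.
Qed.

(** The pair (a, b) majorizes (m, a + b - m). In other terms, the increment of the convex function
    [|t|^q] over a step of fixed length m - b is nondecreasing in [t]; it is compared at t = m and t
    = a. *)
Lemma abspow_majorize q a b m : 1 < q -> b <= m -> m <= a ->
  `|m| `^ q + `|a + b - m| `^ q <= `|a| `^ q + `|b| `^ q.
Proof.
move=> q1 bm ma.
have [|x xma] := @is_derive_MVT _ (fun t => `|t| `^ q - `|1 * t + (b - m)| `^ q)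
    (fun t => q * spow (q - 1) t - 1 * (q * spow (q - 1) (1 * t + (b - m)))) _ _ ma.
  move=> x _; apply: is_derive_sub; first exact: abspow_is_derive.
  by apply: (@is_derive_affine_comp _ (fun t => `|t| `^ q)); exact: abspow_is_derive.
rewrite !mul1r addrA (_ : m + (b - m) = b); last by ring.
rewrite -mulrBr => e; rewrite -subr_ge0.
have : 0 <= q * (spow (q - 1) x - spow (q - 1) (x + (b - m))) * (a - m).
  apply: mulr_ge0; last by lra.
  apply: mulr_ge0; first by lra.
  by rewrite subr_ge0; apply: spow_le; lra.
by rewrite -e; lra.
Qed.

Lemma abspow_majorize_lt q a b m : 1 < q -> b < m -> m < a ->
  `|m| `^ q + `|a + b - m| `^ q < `|a| `^ q + `|b| `^ q.
Proof.
move=> q1 bm ma.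
have [|x xma] := @is_derive_MVT _ (fun t => `|t| `^ q - `|1 * t + (b - m)| `^ q)
    (fun t => q * spow (q - 1) t - 1 * (q * spow (q - 1) (1 * t + (b - m)))) _ _ (ltW ma).
  move=> x _; apply: is_derive_sub; first exact: abspow_is_derive.
  by apply: (@is_derive_affine_comp _ (fun t => `|t| `^ q)); exact: abspow_is_derive.
rewrite !mul1r addrA (_ : m + (b - m) = b); last by ring.
rewrite -mulrBr => e; rewrite -subr_gt0.
have : 0 < q * (spow (q - 1) x - spow (q - 1) (x + (b - m))) * (a - m).
  apply: mulr_gt0; last by lra.
  apply: mulr_gt0; first by lra.
  by rewrite subr_gt0; apply: spow_lt; lra.
by rewrite -e; lra.
Qed.

Lemma abspow_tangent q x y : 1 < q ->
  `|x| `^ q + q * spow (q - 1) x * (y - x) <= `|y| `^ q.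
Proof.
move=> q1; have q0 : 0 < q - 1 by lra.
have [xy|/ltW yx] := leP x y.
- have [|c cxy e] := @is_derive_MVT _ (fun t => `|t| `^ q)
      (fun t => q * spow (q - 1) t) _ _ xy.
    by move=> z _; exact: abspow_is_derive.
  rewrite -lerBrDl e -!mulrA ler_pM2l; last by lra.
  by apply: ler_wpM2r; [rewrite subr_ge0|apply: spow_le => //; case/andP: cxy].
- have [|c cxy e] := @is_derive_MVT _ (fun t => `|t| `^ q)
      (fun t => q * spow (q - 1) t) _ _ yx.
    by move=> z _; exact: abspow_is_derive.
  suff : `|x| `^ q - `|y| `^ q <= q * spow (q - 1) x * (x - y) by lra.
  rewrite e -!mulrA ler_pM2l; last by lra.
  by apply: ler_wpM2r; [rewrite subr_ge0|apply: spow_le => //; case/andP: cxy].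
Qed.

Lemma abspow_convex q s x y : 1 < q -> 0 <= s <= 1 ->
  `|s * x + (1 - s) * y| `^ q <= s * `|x| `^ q + (1 - s) * `|y| `^ q.
Proof.
move=> q1 /andP[s0 s1]; set z := s * x + _.
have := ler_wpM2l s0 (abspow_tangent z x q1).
have t0 : 0 <= 1 - s by lra.
have := ler_wpM2l t0 (abspow_tangent z y q1).
set c := q * _; move=> h1 h2.
have e : s * (c * (x - z)) + (1 - s) * (c * (y - z)) = 0 by rewrite /z; ring.
by move: h1 h2; rewrite !mulrDr; lra.
Qed.

(** Young's inequality for [|v|] and [|w| |u|^(p-1)], multiplied by p, with (p - 1) q = p and p / q
    = p - 1. The left side is the term of the derivative of [w |u|^p] that contains v = u'. *)
Lemma abspow_young p q u v w : 1 < p -> q = p / (p - 1) ->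
  p * w * spow (p - 1) u * v <= `|v| `^ p + (p - 1) * `|w| `^ q * `|u| `^ p.
Proof.
move=> p1 qE; have q0 : 0 < q by rewrite qE divr_gt0//; lra.
have pq : p^-1 + q^-1 = 1 by rewrite qE; field; lra.
have p0 : 0 < p by lra.
have u0 : 0 <= `|w| * `|u| `^ (p - 1) by rewrite mulr_ge0// powR_ge0.
have := conjugate_powR (normr_ge0 v) u0 p0 q0 pq.
rewrite powRM ?powR_ge0// -[(`|u| `^ _) `^ _]powRrM.
rewrite (_ : (p - 1) * q = p); last by rewrite qE mulrC divfK//; lra.
move=> /(ler_wpM2l (ltW p0)) h.
apply: le_trans (_ : p * (`|v| * (`|w| * `|u| `^ (p - 1))) <= _).
  rewrite -!mulrA ler_pM2l//; apply: le_trans (ler_norm _) _.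
  rewrite !normrM normr_spow; last by lra.
  by rewrite le_eqVlt; apply/orP; left; apply/eqP; ring.
apply: le_trans h _; rewrite mulrDr [p * (_ / p)]mulrC divfK ?lerD2l; last by lra.
rewrite (_ : p * _ = (p / q) * (`|w| `^ q * `|u| `^ p)); last by ring.
by rewrite (_ : p / q = p - 1) -?mulrA// qE; field; lra.
Qed.

End convexity_of_powers.

(** * Primitives of continuous functions *)

Section primitives.
Context {R : realType}.
Implicit Types (f h : R -> R) (x a b c : R).
Local Notation mu := (@lebesgue_measure R).

Lemma primitive_right h (A : R) : continuous h ->
  exists H, forall x, A < x -> is_derive x 1 H (h x).
Proof.
move=> ch; exists (fun x => \int[mu]_(t in `[A, x]) h t)%R => x Ax.
have ic : mu.-integrable `[A, x + 1] (EFin \o h).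
  apply: continuous_compact_integrable; first exact: segment_compact.
  by apply: continuous_subspaceT.
have [|D E] := continuous_FTC1_closed _ ic Ax (ch x); first by rewrite ltrDl.
exact: (DeriveDef D (etrans (esym (derive1E _ _)) E)).
Qed.

(** Integrals from different left ends [A], normalized to vanish at 0, agree where both are defined.
    The left end [N x], which lies to the left of both [x] and 0, can therefore vary with the point,
    and the pieces glue. *)
Lemma primitive_exists h : continuous h ->
  exists H, forall x, is_derive x 1 H (h x).
Proof.
move=> ch; have /choice[K KP] := fun A : R => primitive_right A ch.
pose N (x : R) : R := - (`|x| + 1).
have Nx x : N x < x by rewrite /N; have := ler_norm (- x); rewrite normrN; lra.
have N0 x : N x < 0 by rewrite /N; have := normr_ge0 x; lra.
pose H x := K (N x) x - K (N x) 0; exists H => x.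
have Heq A B y : A <= B -> B < y -> B < 0 -> K A y - K A 0 = K B y - K B 0.
  move=> AB By B0; pose D z := K A z - K B z.
  have dD z : B < z -> is_derive z 1 D 0.
    by move=> Bz; rewrite -(subrr (h z)); apply: is_derive_sub; apply: KP; lra.
  suff : D y = D 0 by rewrite /D; lra.
  have [y0|/ltW y0] := leP y 0.
    by apply: is_derive_cst_eq => // z /andP[yz _]; apply: dD; lra.
  by apply/esym/is_derive_cst_eq => // z /andP[yz _]; apply: dD; lra.
pose M : R := N x - 1; have MN : M < N x by rewrite /M; lra.
apply: (@is_derive_local _ (fun y => K M y - K M 0) _ _ _ (x - 1) (x + 1)).
- by lra.
- by lra.
- move=> y /andP[y1 y2]; rewrite /H; apply: Heq; [|exact: Nx|exact: N0].
  have yx : `|y - x| <= 1 by rewrite ler_norml; lra.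
  have : `|y| <= `|x| + `|y - x| by rewrite -{1}(subrK x y) addrC ler_normD.
  by rewrite /M /N; lra.
- rewrite -[X in is_derive _ _ _ X]subr0; apply: is_derive_sub.
  by apply: KP; have := Nx x; lra.
Qed.

(** Composing with this retraction extends a function continuous on [[a, b]] to a bounded continuous
    function on the line, so that the ODE theory can work with global coefficients. *)
Definition clamp a b x : R := Num.max a (Num.min b x).

Lemma clamp_id a b x : a <= x <= b -> clamp a b x = x.
Proof. by move=> /andP[ax xb]; rewrite /clamp (min_r xb) (max_r ax). Qed.

Lemma clamp_itv a b x : a <= b -> a <= clamp a b x <= b.
Proof.
by move=> ab; rewrite /clamp le_max lexx/= ge_max ab/= ge_min lexx.
Qed.

Lemma clamp_continuous a b : continuous (clamp a b).
Proof.
move=> x; apply: continuous_max; first exact: cst_continuous.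
by apply: continuous_min; [exact: cst_continuous|exact: cvg_id].
Qed.

(** Here [h] may blow up at both ends, as u'/u does at Dirichlet ends. It is clamped to compact
    subintervals, and the primitives normalized at [c] agree on overlaps. *)
Lemma primitive_oo h a b c : a < c < b ->
  (forall x, a < x < b -> {for x, continuous h}) ->
  exists2 H, H c = 0 & forall x, a < x < b -> is_derive x 1 H (h x).
Proof.
move=> /andP[ac cb] ch.
have /choice[K KP] : forall st : R * R, exists H : R -> R, a < st.1 /\ st.2 < b ->
    forall x, st.1 <= x <= st.2 -> is_derive x 1 H (h x).
  case=> s t /=; have [[sa [st tb]]|nst] := pselect (a < s /\ s <= t /\ t < b); last first.
    exists (fun=> 0) => -[sa tb] x /andP[sx xt]; exfalso; apply: nst; split => //.
    by split => //; exact: le_trans xt.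
  have [|H HP] := @primitive_exists (h \o clamp s t).
    move=> x; apply: continuous_comp; first exact: clamp_continuous.
    by apply: ch; have /andP[? ?] := clamp_itv x st; lra.
  by exists H => _ x xst; have := HP x; rewrite /= clamp_id.
(* The smallest segment containing [c] and [x] is used at each point; near a given point all of them
   lie in one segment [s, t]. *)
pose H x := K (Num.min c x, Num.max c x) x - K (Num.min c x, Num.max c x) c.
exists H; first by rewrite /H subrr.
move=> x /andP[ax xb].
have [s [s_a sx sc]] : exists s, [/\ a < s, s < x & s < c].
  by exists ((a + Num.min c x) / 2); case: (leP c x) => ?; split; lra.
have [t [tb xt tc]] : exists t, [/\ t < b, x < t & c < t].
  by exists ((b + Num.max c x) / 2); case: (leP c x) => ?; split; lra.
rewrite -[h x]subr0; apply: (@is_derive_local _ (fun y => K (s, t) y - K (s, t) c) _ _ _ s t) => //.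
  move=> y /andP[sy yt]; rewrite /H.
  set s1 := Num.min c y; set t1 := Num.max c y.
  have dD z : s1 <= z <= t1 -> is_derive z 1 (fun y => K (s, t) y - K (s1, t1) y) 0.
    rewrite /s1 /t1 => zst; rewrite -(subrr (h z)); apply: is_derive_sub.
      by apply: KP => /=; [lra|move: zst; case: (leP c y); lra].
    by apply: KP => //=; move: zst; case: (leP c y); lra.
  pose D y := K (s, t) y - K (s1, t1) y.
  suff : D y = D c by rewrite /D; lra.
  have [cy|/ltW yc] := leP c y.
  - by apply/esym/(@is_derive_cst_eq _ D) => // z zcy; apply: dD; rewrite /s1 /t1 (min_l cy) (max_r cy).
  - by apply: (@is_derive_cst_eq _ D) => // z zcy; apply: dD; rewrite /s1 /t1 (min_r yc) (max_l yc).
by apply: is_derive_sub; apply: KP => /=; lra.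
Qed.

End primitives.

Lemma powR_lt1 {R : realType} (r s : R) : 0 < r -> 0 <= s < 1 -> s `^ r < 1.
Proof.
move=> r0 /andP[s0 s1]; have /= := @gt0_ltr_powR _ _ r0 s 1.
by rewrite powR1 !nnegrE; apply.
Qed.

Lemma powR_le1 {R : realType} (r s : R) : 0 < r -> 0 <= s <= 1 -> s `^ r <= 1.
Proof.
move=> r0 /andP[s0 s1]; have /= := @ge0_ler_powR _ _ (ltW r0) s 1.
by rewrite powR1 !nnegrE; apply.
Qed.

Lemma powR_gt1 {R : realType} (r s : R) : 0 < r -> 1 < s -> 1 < s `^ r.
Proof.
move=> r0 s1; have /= := @gt0_ltr_powR _ _ r0 1 s.
by rewrite powR1 !nnegrE; apply => //; lra.
Qed.

Section FTC.
Context {R : realType}.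
Local Notation mu := (@lebesgue_measure R).

Lemma is_derive_LR (F f : R -> R) (s t : R) :
  (forall x, s <= x <= t -> is_derive x 1 F (f x)) ->
  s < t -> derivable_oo_LRcontinuous F s t.
Proof.
move=> dF st; have cF x : s <= x <= t -> {for x, continuous F}.
  by move=> xst; exact: is_derive_continuous (dF x xst).
split.
- by move=> x; rewrite in_itv/= => /andP[sx xt]; have [] := dF x _; rewrite ?ltW.
- by apply: cvg_at_right_filter; apply: cF; rewrite lexx ltW.
- by apply: cvg_at_left_filter; apply: cF; rewrite lexx ltW.
Qed.

Lemma is_derive_FTC2 (F f : R -> R) (s t : R) : s <= t ->
  (forall x, s <= x <= t -> is_derive x 1 F (f x)) ->
  {within `[s, t], continuous f} ->
  (\int[mu]_(x in `[s, t]) (f x)%:E = (F t - F s)%:E)%E.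
Proof.
rewrite le_eqVlt => /predU1P[<-|st] dF cf.
  by rewrite set_itv1 integral_set1 subrr.
rewrite EFinB; apply: continuous_FTC2 => //; first exact: is_derive_LR dF st.
move=> x; rewrite in_itv/= => /andP[sx xt]; have [] := dF x _; rewrite ?ltW//.
by rewrite derive1E.
Qed.

End FTC.

(** * The generalized angle *)

Section angle.
Context {R : realType}.
Variable p : R.
Hypothesis p1 : 1 < p.
Implicit Types (x y w s t : R).
Local Notation mu := (@lebesgue_measure R).

Local Ltac plra := let H := fresh in pose proof p1 as H; lra.

Definition conjugate : R := p / (p - 1).
Local Notation q := conjugate.

Lemma conjugate_gt1 : 1 < q.
Proof. by rewrite /conjugate ltr_pdivlMr; plra. Qed.

Let q1 := conjugate_gt1.

Lemma conjugate_subr1 : q - 1 = (p - 1)^-1.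
Proof. by rewrite /conjugate; field; plra. Qed.

Definition angle_speed (w : R) : R := (1 + `|w| `^ q)^-1.

Lemma angle_speed_gt0 w : 0 < angle_speed w.
Proof. by rewrite invr_gt0 ltr_pwDl// powR_ge0. Qed.

Lemma angle_speed_le1 w : angle_speed w <= 1.
Proof. by rewrite invf_le1 ?lerDl ?powR_ge0// ltr_pwDl// powR_ge0. Qed.

Lemma angle_speed_continuous : continuous angle_speed.
Proof.
move=> x; apply: cvgV; first by rewrite gt_eqF// ltr_pwDl// powR_ge0.
apply: cvgD; first exact: cvg_cst.
by apply: abspow_continuous; have := q1; plra.
Qed.

(** Up to sign, the time along the flow w' = - (p - 1) (1 + |w|^q), which is the Riccati equation of
    the generalized sine; for p = 2 it is arctan. *)
Definition is_angle (s : R -> R) : Prop :=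
  s 0 = 0 /\ forall x, is_derive x 1 s (angle_speed x / (p - 1)).

Definition angle : R -> R := xget (fun=> 0) [set s | is_angle s].

Lemma angle_is_angle : is_angle angle.
Proof.
rewrite /angle; case: xgetP => [s _ []//|H]; exfalso.
have [|S SP] := @primitive_exists _ (fun x => angle_speed x / (p - 1)).
  by move=> x; apply: cvgM; [exact: angle_speed_continuous|exact: cvg_cst].
apply: (H (fun x => S x - S 0)); split; first by rewrite subrr.
by move=> x; rewrite -[_ / _]subr0; exact: is_derive_sub (SP x) (is_derive_const _ x).
Qed.

Lemma angle0 : angle 0 = 0. Proof. by case: angle_is_angle. Qed.

Lemma angle_is_derive x : is_derive x 1 angle (angle_speed x / (p - 1)).
Proof. by case: angle_is_angle. Qed.

Lemma angle_continuous : continuous angle.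
Proof. by move=> x; exact: is_derive_continuous (angle_is_derive x). Qed.

Lemma angle_lt x y : x < y -> angle x < angle y.
Proof.
move=> xy; apply: (is_derive_incr xy) => [z _|z _]; first exact: angle_is_derive.
by rewrite divr_gt0 ?angle_speed_gt0// subr_gt0.
Qed.

Lemma angle_mono : {mono angle : x y / x < y}.
Proof. by apply: leW_mono; apply: le_mono => x y; exact: angle_lt. Qed.

Lemma angle_inj : injective angle.
Proof.
move=> x y e; apply/eqP; have [xy|yx|//] := ltgtP x y.
- by have := angle_lt xy; rewrite e ltxx.
- by have := angle_lt yx; rewrite e ltxx.
Qed.

Lemma angle_le x y : (angle x <= angle y) = (x <= y).
Proof. by rewrite !leNgt angle_mono. Qed.

Lemma angleN x : angle (- x) = - angle x.
Proof.
pose D y := angle (- 1 * y + 0) + angle y.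
have dD y : is_derive y 1 D 0.
  have e : - 1 * (angle_speed (- 1 * y + 0) / (p - 1)) + angle_speed y / (p - 1) = 0.
    by rewrite /angle_speed addr0 (mulN1r y) normrN; ring.
  rewrite -e; apply: is_derive_add (angle_is_derive y).
  exact: is_derive_affine_comp (angle_is_derive _).
suff : D x = D 0 by rewrite /D mulr0 !addr0 mulN1r angle0 addr0 => /eqP; rewrite addr_eq0 => /eqP.
have [x0|/ltW x0] := leP 0 x.
- by apply/esym/(@is_derive_cst_eq _ D).
- exact: (@is_derive_cst_eq _ D).
Qed.

(** [eta s] is the Riccati variable of the generalized sine where that sine equals [s]: ((1 -
    s^p)^(1/p) / s)^(p-1). The substitution turns the integrand of [pi_p] into the derivative of
    [- angle], which identifies the range of [angle]. *)
Let eta s : R := ((s `^ p)^-1 - 1) `^ ((p - 1) / p).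
Let itg s : R := ((1 - s `^ p) `^ p^-1)^-1.

Let sp01 s : 0 < s < 1 -> 0 < s `^ p < 1.
Proof.
move=> /andP[s0 s1]; rewrite powR_gt0//=.
by apply: powR_lt1; plra.
Qed.

Let eta_gt0 s : 0 < s < 1 -> 0 < eta s.
Proof. by move=> /sp01/andP[? ?]; rewrite powR_gt0// subr_gt0 invf_gt1. Qed.

Let eta_derive s : 0 < s < 1 -> is_derive s 1 (fun s => - angle (eta s)) (itg s).
Proof.
move=> s01; have /andP[sp0 sp1] := sp01 s01; have /andP[s0 s1] := s01.
have X0 : 0 < (s `^ p)^-1 - 1 by rewrite subr_gt0 invf_gt1.
have d1 : is_derive s 1 (fun s => (s `^ p)^-1 - 1) (- (s `^ p) ^- 2 *: (p * s `^ (p - 1)) - 0).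
  have := @is_deriveV _ (@powR R ^~ p) _ _ _ (lt0r_neq0 sp0) (is_derive1_powR p s0).
  by move/is_derive_sub; apply; exact: is_derive_const.
have d2 := is_derive_comp d1 (is_derive1_powR ((p - 1) / p) X0).
have d3 := is_derive_opp (is_derive_comp d2 (angle_is_derive _)).
apply: is_derive_eq d3 _.
have E : `|((s `^ p)^-1 - 1) `^ ((p - 1) / p)| `^ q = (s `^ p)^-1 - 1.
  rewrite ger0_norm ?powR_ge0// -powRrM (_ : (p - 1) / p * q = 1).
    by rewrite powRr1// ltW.
  by rewrite /conjugate; field; plra.
rewrite /angle_speed E (addrC 1) subrK invrK subr0.
have -> : (p - 1) / p - 1 = - p^-1 by field; plra.
have hs : s `^ (p - 1) = s `^ p / s by rewrite powRB ?gt_eqF ?implybT// powRr1 ?ltW.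
have hX : ((s `^ p)^-1 - 1) `^ p^-1 = (1 - s `^ p) `^ p^-1 / s.
  have -> : (s `^ p)^-1 - 1 = (1 - s `^ p) * (s `^ p)^-1.
    by rewrite mulrBl mul1r divff// gt_eqF.
  rewrite powRM ?invr_ge0 ?powR_ge0//; last by plra.
  by rewrite -powRN -powRrM mulNr mulfV ?powR_inv1 ?ltW//; plra.
have u0 : 0 < (1 - s `^ p) `^ p^-1 by rewrite powR_gt0 ?subr_gt0.
rewrite powRN hX hs /itg -[_ *: _]/(_ * _).
move: (s `^ p) ((1 - s `^ p) `^ p^-1) u0 sp0 => a u u0 a0.
by field; rewrite !gt_eqF//=; plra.
Qed.

Let itg_continuous s : 0 < s < 1 -> {for s, continuous itg}.
Proof.
move=> s01; have /andP[sp0 sp1] := sp01 s01; have /andP[s0 s1] := s01.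
apply: cvgV; first by rewrite gt_eqF// powR_gt0// subr_gt0.
have h : 0 < 1 - s `^ p by plra.
have := is_derive_comp
  (is_derive_sub (is_derive_const 1 s) (is_derive1_powR p s0)) (is_derive1_powR p^-1 h).
exact: is_derive_continuous.
Qed.

Let itg_ge0 s : 0 <= itg s.
Proof. by rewrite invr_ge0 powR_ge0. Qed.

Let itg_integral s t : 0 < s -> s <= t -> t < 1 ->
  (\int[mu]_(x in `[s, t]) (itg x)%:E = (angle (eta s) - angle (eta t))%:E)%E.
Proof.
move=> s0 st t1.
have dF x : s <= x <= t -> is_derive x 1 (fun s => - angle (eta s)) (itg x).
  by move=> xst; apply: eta_derive; plra.
rewrite (is_derive_FTC2 st dF); first by rewrite opprK addrC.
apply: continuous_in_subspaceT => x; rewrite inE/= in_itv/= => xst.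
by apply: itg_continuous; plra.
Qed.

Let seta w : R := (1 + w `^ q) `^ (- p^-1).

Let setaK w : 0 < w -> eta (seta w) = w.
Proof.
move=> w0; have wq0 : 0 < w `^ q by exact: powR_gt0.
rewrite /eta /seta -powRrM mulNr mulVf; last by plra.
rewrite powR_inv1 ?invrK; last by plra.
rewrite addrAC subrr add0r -powRrM (_ : q * _ = 1) ?powRr1 ?ltW//.
by rewrite /conjugate; field; plra.
Qed.

Let seta01 w : 0 < w -> 0 < seta w < 1.
Proof.
move=> w0; have wq0 : 0 < w `^ q by exact: powR_gt0.
rewrite powR_gt0/=; last by plra.
rewrite /seta powRN invf_lt1 ?powR_gt0//; try plra.
by apply: powR_gt1; rewrite ?invr_gt0; plra.
Qed.

Let seta_le v w : 0 < v -> v <= w -> seta w <= seta v.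
Proof.
move=> v0 vw; have vq0 : 0 < v `^ q by exact: powR_gt0.
have w0 : 0 < w by plra.
have wq0 : 0 < w `^ q by exact: powR_gt0.
have hv : (1 + v `^ q) `^ p^-1 \is Num.pos by rewrite posrE powR_gt0; plra.
have hw : (1 + w `^ q) `^ p^-1 \is Num.pos by rewrite posrE powR_gt0; plra.
rewrite /seta !powRN (lef_pV2 hw hv).
apply: ge0_ler_powR; rewrite ?nnegrE ?invr_ge0 ?lerD2l; [plra|plra|plra|].
by apply: ge0_ler_powR; rewrite ?nnegrE//; have := q1; plra.
Qed.

(** Kept as an extended real: [pi_p] is a real-valued integral, and determines this one only once it
    is known to be finite. *)
Let J : \bar R := (\int[mu]_(x in `]0%R, 1%R[) (itg x)%:E)%E.

Let meas_itg : measurable_fun (`]0, 1[%classic : set R) itg.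
Proof.
apply: open_continuous_measurable_fun; first exact: interval_open.
by move=> x; rewrite inE/= in_itv/= => x01; apply: itg_continuous.
Qed.

Let angle_le_J w : ((angle w)%:E <= J)%E.
Proof.
have J0 : (0 <= J)%E by apply: integral_ge0 => x _; rewrite lee_fin.
have [w0|w0] := ltP 0 w; last first.
  apply: le_trans J0; rewrite lee_fin -angle0 angle_le//.
have key v : 0 < v -> v < w -> ((angle w - angle v)%:E <= J)%E.
  move=> v0 vw; rewrite -{1}(setaK w0) -(setaK v0) -itg_integral.
  - apply: ge0_subset_integral => //=.
    + by apply/measurable_EFinP.
    + by move=> x _; rewrite lee_fin.
    + move=> x; rewrite /= !in_itv/= => /andP[h1 h2].
      have /andP[a1 _] := seta01 w0; have /andP[_ a2] := seta01 v0.
      by rewrite (lt_le_trans a1 h1) (le_lt_trans h2 a2).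
  - by have /andP[] := seta01 w0.
  - by apply: seta_le => //; exact: ltW.
  - by have /andP[] := seta01 v0.
case: J J0 key => [j||] // _ key; last by rewrite leey.
rewrite lee_fin; apply/ler_addgt0Pr => e e0.
have : angle v @[v --> 0^'+] --> angle 0.
  by apply: cvg_at_right_filter; exact: angle_continuous.
rewrite angle0 => /cvgrPdist_lt/(_ e e0) nv.
near (0 : R)^'+ => v.
have v0 : 0 < v by near: v; exact: nbhs_right_gt.
have vw : v < w by near: v; exact: nbhs_right_lt.
have := key v v0 vw; rewrite lee_fin.
have : `|0 - angle v| < e by near: v.
by rewrite sub0r normrN ltr_norml; plra.
Unshelve. all: by end_near. Qed.

Let J_le l : (forall w, angle w <= l) -> (J <= l%:E)%E.
Proof.
(* The offset in [n.+2] keeps the margin at most 1/2, so that no segment is empty. *)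
move=> al; pose E n := `[n.+2%:R^-1, 1 - n.+2%:R^-1]%classic : set R.
have E01 n x : E n x -> 0 < x < 1.
  rewrite /E/= in_itv/= => /andP[h1 h2].
  have n0 : 0 < n.+2%:R^-1 :> R by rewrite invr_gt0.
  by move: (n.+2%:R^-1) n0 h1 h2 => c *; plra.
have EU : (`]0, 1[%classic : set R) = \bigcup_i E i.
  apply/seteqP; split => [x|x [n _ /E01]]; rewrite /= in_itv//= => /andP[x0 x1].
  have m0 : 0 < Num.min x (1 - x) by rewrite lt_min x0 subr_gt0.
  have [N _ HN] := near_infty_natSinv_lt (PosNum m0).
  exists N => //; rewrite /E/= in_itv/=; have := HN N (leqnn _); rewrite /=.
  rewrite lt_min => /andP[h1 h2].
  have : N.+2%:R^-1 <= N.+1%:R^-1 :> R by rewrite lef_pV2 ?posrE// ler_nat.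
  by move: (N.+1%:R^-1) (N.+2%:R^-1) h1 h2 => c d *; plra.
rewrite /J EU.
have ndE : nondecreasing_seq E.
  apply/nondecreasing_seqP => n; apply/subsetPset => x; rewrite /E/= !in_itv/= => /andP[h1 h2].
  have : n.+3%:R^-1 <= n.+2%:R^-1 :> R by rewrite lef_pV2 ?posrE// ler_nat.
  by move: (n.+2%:R^-1) (n.+3%:R^-1) h1 h2 => c' d *; plra.
have mE n : measurable (E n) by exact: measurable_itv.
have mI n : measurable_fun (E n) (fun x => (itg x)%:E).
  apply/measurable_EFinP; apply: measurable_funS meas_itg => //.
  by move=> x /E01; rewrite /= in_itv.
have I0 n x : E n x -> (0 <= (itg x)%:E)%E by rewrite lee_fin.
have c := @ge0_nondecreasing_set_cvg_integral _ (measurableTypeR R) R E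
  (fun x => (itg x)%:E) mu ndE mE mI I0.
apply: (cvge_to_le c); apply: nearW => n; have n0 : 0 < n.+2%:R^-1 :> R by rewrite invr_gt0.
have n1 : n.+2%:R^-1 <= 2^-1 :> R by rewrite lef_pV2 ?posrE// ler_nat.
rewrite /E; move: (n.+2%:R^-1) n0 n1 => d d0 d1.
rewrite itg_integral//; [|plra|plra].
rewrite lee_fin lerBlDr (le_trans (al _))// lerDl -angle0 angle_le powR_ge0//.
Qed.

(** For w >= 1 the derivative of [angle] is at most w^(-q) / (p - 1), and since q - 1 = 1 / (p - 1)
    this is the derivative of - w^(1-q), which is bounded. *)
Let angle_bounded w : angle w <= angle 1 + 1.
Proof.
have q0 : 0 < q - 1 by have := q1; plra.
have [w1|w1] := leP w 1; first by apply: ler_wpDr => //; rewrite angle_le.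
pose F t : R := - t `^ (1 - q) - angle t.
suff : F 1 <= F w by rewrite /F powR1; have := powR_ge0 w (1 - q); plra.
have dF x : 1 <= x -> is_derive x 1 F (- ((1 - q) * x `^ (1 - q - 1)) - angle_speed x / (p - 1)).
  move=> x1; have x0 : 0 < x by plra.
  exact: is_derive_sub (is_derive_opp (is_derive1_powR (1 - q) x0)) (angle_is_derive x).
apply: (is_derive_ndecr (ltW w1)) => [x /andP[x1 _]|x /andP[x1 _]]; first exact: dF.
have x0 : 0 < x by plra.
rewrite (_ : 1 - q - 1 = - q); last by ring.
rewrite (_ : 1 - q = - (p - 1)^-1); last by rewrite -conjugate_subr1; ring.
rewrite mulNr opprK subr_ge0 mulrC ler_pM2l ?invr_gt0; last by plra.
rewrite /angle_speed gtr0_norm// powRN lef_pV2 ?posrE ?powR_gt0//.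
  by rewrite lerDr.
by rewrite ltr_pwDl// powR_ge0.
Qed.

Definition half_period : R := pi_p p / 2.
Local Notation h := half_period.

Let JE : J = h%:E.
Proof.
have Jfin : J \is a fin_num.
  rewrite ge0_fin_numE; first by apply: le_lt_trans (J_le angle_bounded) (ltry _).
  by apply: integral_ge0 => x _; rewrite lee_fin.
by rewrite -(fineK Jfin); congr EFin; rewrite /half_period /pi_p mulrC mulKf.
Qed.

Lemma angle_lt_half w : angle w < h.
Proof.
apply: lt_le_trans (_ : angle (w + 1) <= _); first by rewrite angle_mono ltrDl.
by have := angle_le_J (w + 1); rewrite JE lee_fin.
Qed.

Lemma angle_gt_half w : - h < angle w.
Proof. by rewrite ltrNl -angleN angle_lt_half. Qed.

Lemma half_period_gt0 : 0 < h.
Proof. by rewrite -angle0 angle_lt_half. Qed.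

Lemma angle_onto t : - h < t < h -> exists w, angle w = t.
Proof.
have big s : s < h -> exists w, s < angle w.
  move=> sh; apply: contrapT => /forallNP no.
  have : (J <= s%:E)%E by apply: J_le => w; rewrite leNgt; apply/negP/no.
  by rewrite JE lee_fin; plra.
move=> /andP[ht th]; have [w tw] := big _ th.
have [|v tv] := big (- t); first by plra.
have vw : - v <= w by rewrite -angle_le angleN; plra.
have [|c _ e] := @IVT _ angle (- v) w t vw (continuous_subspaceT angle_continuous).
  rewrite angleN; case: (leP (- angle v) (angle w)); plra.
by exists c.
Qed.

Definition cangle (t : R) : R := xget 0 [set w | angle w = t].

Lemma cangleK t : - h < t < h -> angle (cangle t) = t.
Proof. by move=> /angle_onto[w e]; rewrite /cangle; case: xgetP => [//|/(_ w)]. Qed.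

Lemma angleK w : cangle (angle w) = w.
Proof. by rewrite /cangle; case: xgetP => [v _ /= /angle_inj//|/(_ w) /=/(_ erefl)]. Qed.

Lemma cangle_is_derive t : - h < t < h ->
  is_derive t 1 cangle ((p - 1) / angle_speed (cangle t)).
Proof.
move=> tt; have nz : angle_speed (cangle t) / (p - 1) != 0.
  by rewrite gt_eqF// divr_gt0 ?angle_speed_gt0// subr_gt0.
have nK : {near cangle t, cancel angle cangle} by near=> w; exact: angleK.
have nC : {near cangle t, continuous angle} by near=> w; exact: angle_continuous.
have := is_derive_inverse nK nC (angle_is_derive (cangle t)) nz.
by rewrite cangleK// invf_div.
Unshelve. all: by end_near. Qed.

(** Seen as a function of the angle, the speed has slope of size p |w|^(q-1) / (1 + |w|^q), because
    q (p - 1) = p; the quotient of powers is at most 1. This Lipschitz bound, uniform up to w = +oo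
    and - oo, is what makes the ODE regular for every p > 1. *)
Let speed_lip_le x y : x <= y ->
  `|angle_speed y - angle_speed x| <= p * (angle y - angle x).
Proof.
move=> xy; have q0 : 0 < q - 1 by have := q1; plra.
have dS (z : R) : is_derive z 1 angle_speed (- (q * spow (q - 1) z) / (1 + `|z| `^ q) ^+ 2).
  have z0 : 0 < 1 + `|z| `^ q by rewrite ltr_pwDl// powR_ge0.
  have := is_derive_inv (is_derive_add (is_derive_const 1 z) (abspow_is_derive z q1)) (lt0r_neq0 z0).
  by rewrite add0r.
have bnd z : `|q * spow (q - 1) z / (1 + `|z| `^ q) ^+ 2| <= p * (angle_speed z / (p - 1)).
  have z0 : 0 < 1 + `|z| `^ q by rewrite ltr_pwDl// powR_ge0.
  have qge0 : 0 <= q by have := q1; plra.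
  rewrite normrM normfV (normrM q) normr_spow// (ger0_norm qge0).
  rewrite (ger0_norm (exprn_ge0 2 (ltW z0))).
  rewrite (_ : p * _ = q * (1 + `|z| `^ q)^-1); last first.
    by rewrite /angle_speed /conjugate; field; rewrite gt_eqF//=; plra.
  rewrite -mulrA ler_wpM2l// ler_pdivrMr ?exprn_gt0// expr2 mulKf ?gt_eqF//.
  have [z1|/ltW z1] := leP `|z| 1.
    apply: ler_wpDr; first exact: powR_ge0.
    by apply: powR_le1; rewrite ?normr_ge0.
  by apply: ler_wpDl => //; rewrite ler_powR// gerBl.
have dA z := is_derive_scale p (angle_is_derive z).
rewrite ler_norml; apply/andP; split.
- have := is_derive_ndecr xy (fun z _ => is_derive_add (dS z) (dA z)).
  rewrite mulrBr => h; suff : angle_speed x + p * angle x <= angle_speed y + p * angle y by plra.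
  by apply: h => z _; have := bnd z; rewrite ler_norml mulNr; plra.
- have := is_derive_ndecr xy (fun z _ => is_derive_sub (dA z) (dS z)).
  rewrite mulrBr => h; suff : p * angle x - angle_speed x <= p * angle y - angle_speed y by plra.
  by apply: h => z _; have := bnd z; rewrite ler_norml mulNr; plra.
Qed.

Lemma angle_speed_lipschitz x y :
  `|angle_speed x - angle_speed y| <= p * `|angle x - angle y|.
Proof.
have [xy|/ltW yx] := leP x y.
- by rewrite distrC (distrC (angle x)) [X in p * X]ger0_norm ?subr_ge0 ?angle_le// speed_lip_le.
- by rewrite [X in p * X]ger0_norm ?subr_ge0 ?angle_le// speed_lip_le.
Qed.

Lemma angle_speed_vanish e : 0 < e -> exists w, angle_speed w < e.
Proof.
move=> e0; exists (e^-1 `^ q^-1); rewrite /angle_speed ger0_norm ?powR_ge0//.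
rewrite -powRrM mulVf ?powRr1 ?invr_ge0 ?(ltW e0)//; last by have := q1; plra.
by rewrite -[ltRHS]invrK ltf_pV2 ?posrE ?invr_gt0 ?ltr_pwDl ?invr_ge0 ?(ltW e0)// ltrDr.
Qed.

End angle.

(** * Gronwall's inequality for the positive part *)

Section gronwall.
Context {R : realType}.
Implicit Types (D dD : R -> R) (K s t x y : R).

Lemma sqr_pos_is_derive y :
  is_derive y 1 (fun z => (Num.max z 0) ^+ 2) (2 * Num.max y 0).
Proof.
have [y0|y0|->] := ltgtP y 0.
- rewrite mulr0.
  apply: (@is_derive_local _ (fun _ => 0) _ _ _ (y - 1) 0) => //; first by lra.
    by move=> z /andP[_ /ltW z0]; rewrite (max_r z0) expr0n.
- apply: (@is_derive_local _ (fun z => z * z) _ _ _ 0 (y + 1)) => //; first by lra.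
    by move=> z /andP[/ltW z0 _]; rewrite (max_l z0) expr2.
  have := is_derive_mul (is_derive_id y 1) (is_derive_id y 1).
  by move/is_derive_eq; apply; rewrite mul1r mulr1; ring.
- rewrite mulr0; apply/is_derive1_caratheodory.
  exists (fun z => Num.max z 0); split.
  + move=> z; rewrite maxxx expr0n subr0; case: (leP z 0) => z0.
      by rewrite expr0n mul0r.
    by rewrite subr0 expr2.
  + by apply: continuous_max; [exact: cvg_id|exact: cvg_cst].
  + by rewrite maxxx.
Qed.

(** The positive part of [D] need not be differentiable, but its square is; multiplied by exp (- 2 K
    x) it is nonincreasing. The differential inequality is asked only where D > 0, which is where
    comparison arguments can provide it. *)
Lemma gronwall_pos D dD K s t : s <= t ->
  (forall x, s <= x <= t -> is_derive x 1 D (dD x)) ->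
  (forall x, s <= x <= t -> 0 < D x -> dD x <= K * D x) ->
  Num.max (D t) 0 <= Num.max (D s) 0 * expR (K * (t - s)).
Proof.
move=> st dD_ dDK.
pose P x := - ((Num.max (D x) 0) ^+ 2 * expR (- (2 * K) * x + 0)).
pose dP x := - (2 * Num.max (D x) 0 * dD x * expR (- (2 * K) * x + 0) +
     (Num.max (D x) 0) ^+ 2 * (- (2 * K) * expR (- (2 * K) * x + 0))).
have dP_ x : s <= x <= t -> is_derive x 1 P (dP x).
  move=> xst; apply: is_derive_opp; apply: is_derive_mul.
    exact: is_derive_comp (dD_ x xst) (sqr_pos_is_derive _).
  exact: is_derive_affine_comp (is_derive_expR _).
have : P s <= P t.
  apply: (is_derive_ndecr st dP_) => x xst; rewrite /dP.
  have [D0|D0] := leP (D x) 0; first by rewrite expr0n mulr0 !mul0r addr0 oppr0.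
  set E := expR _; have E0 : 0 <= E by exact: expR_ge0.
  have -> : - (2 * D x * dD x * E + D x ^+ 2 * (- (2 * K) * E)) =
    2 * D x * E * (K * D x - dD x) by ring.
  by rewrite !mulr_ge0 ?subr_ge0 ?dDK ?expR_ge0// ltW.
rewrite /P lerN2 !addr0 => h.
rewrite -(@ler_pXn2r _ 2) ?nnegrE ?mulr_ge0 ?le_max ?lexx ?orbT ?expR_ge0//.
rewrite exprMn -expRM_natl.
have E : expR (2 * (K * (t - s))) = expR (- (2 * K) * s) * expR (2 * K * t).
  by rewrite -expRD; congr expR; ring.
move: h; rewrite -(ler_pM2r (expR_gt0 (2 * K * t))) -!mulrA -!expRD.
rewrite (_ : - (2 * K) * t + 2 * (K * t) = 0) ?expR0 ?mulr1; last by ring.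
by rewrite expr2; move/le_trans; apply; rewrite E -expRD -(mulrA 2 K t).
Qed.

End gronwall.

(** * Riccati equations *)

Section riccati.
Context {R : realType}.
Variable p : R.
Hypothesis p1 : 1 < p.
Implicit Types (w V F : R -> R) (a b e x y s t eps lam mu M : R).

Local Ltac plra := let H := fresh in pose proof p1 as H; lra.
Local Notation q := (conjugate p).
Local Notation angle := (angle p).
Local Notation H := (angle_speed p).
Local Notation h := (half_period p).

Definition ric y : R := (p - 1) * `|y| `^ q.

Definition riccati w x : R := 'D_1 w x + ric (w x).

Lemma ricN y : ric (- y) = ric y. Proof. by rewrite /ric normrN. Qed.

Lemma riccatiE w x (d : R) : is_derive x 1 w d -> riccati w x = d + ric (w x).
Proof. by move=> wd; rewrite /riccati derive_val. Qed.

Lemma riccati_is_derive w x : derivable w x 1 ->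
  is_derive x 1 w (riccati w x - ric (w x)).
Proof. by move=> /derivableP/is_derive_eq; apply; rewrite /riccati addrK. Qed.

(** The unbounded term disappears: [ric w] times the speed is (p - 1) (1 - H w). What remains
    depends on [w] only through the bounded speed. *)
Lemma angle_riccati w x : derivable w x 1 ->
  is_derive x 1 (fun y => angle (w y)) (- 1 + (1 + riccati w x / (p - 1)) * H (w x)).
Proof.
move=> /riccati_is_derive dw; have := is_derive_comp dw (angle_is_derive p1 (w x)).
move/is_derive_eq; apply; rewrite /ric /angle_speed.
have : 0 < 1 + `|w x| `^ q by rewrite ltr_pwDl// powR_ge0.
move: (`|w x| `^ q) (riccati w x) => A N A0.
by field; rewrite gt_eqF//=; plra.
Qed.

(** The initial order is only asked in the limit and for the angles, so that the comparison may
    start at an end where [w1] is infinite. A bound on one of the two Riccati values suffices, which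
    is why [w2] or [w1] may be a mere subsolution or supersolution. *)
Lemma riccati_compare w1 w2 a e M :
  (forall x, a < x < e -> [/\ derivable w1 x 1, derivable w2 x 1,
     riccati w2 x <= riccati w1 x & `|riccati w1 x| <= M \/ `|riccati w2 x| <= M]) ->
  (forall eps t, 0 < eps -> a < t < e ->
     exists2 s, a < s < t & angle (w2 s) - angle (w1 s) < eps) ->
  forall x, a < x < e -> w2 x <= w1 x.
Proof.
move=> hw start x /andP[ax xe].
pose K := (1 + M / (p - 1)) * p.
pose D y := angle (w2 y) - angle (w1 y).
pose dD y := (- 1 + (1 + riccati w2 y / (p - 1)) * H (w2 y)) -
             (- 1 + (1 + riccati w1 y / (p - 1)) * H (w1 y)).
have dD_ y : a < y < e -> is_derive y 1 D (dD y).
  by move=> /hw[d1 d2 _ _]; apply: is_derive_sub (angle_riccati d2) (angle_riccati d1).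
have dDK y : a < y < e -> 0 < D y -> dD y <= K * D y.
  move=> /hw[_ _ N21 NM] D0.
  have lip := angle_speed_lipschitz p1 (w2 y) (w1 y).
  rewrite -/(D y) (gtr0_norm D0) in lip.
  have H1 := angle_speed_gt0 p (w1 y); have H2 := angle_speed_gt0 p (w2 y).
  have pi : 0 < (p - 1)^-1 by rewrite invr_gt0; plra.
  move: lip; rewrite ler_norml => /andP[l1 l2].
  have key N : `|N| <= M ->
      (1 + N / (p - 1)) * (H (w2 y) - H (w1 y)) <= K * D y.
    move=> NM'; apply: le_trans (ler_norm _) _; rewrite normrM /K -mulrA.
    apply: ler_pM => //; last by rewrite ler_norml l1.
    apply: le_trans (ler_normD _ _) _; rewrite normr1 lerD2l normrM.
    by rewrite (gtr0_norm pi) ler_pM2r.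
  have N0 : 0 <= (riccati w1 y - riccati w2 y) / (p - 1).
    by rewrite mulr_ge0 ?subr_ge0// ltW.
  (* The product difference is split so that the bounded Riccati value multiplies the difference of
     the speeds; the other part has the good sign. *)
  case: NM => /key; apply: le_trans; rewrite /dD.
  - have := mulr_ge0 N0 (ltW H2); rewrite mulrBl.
    move: (riccati w1 y / (p - 1)) (riccati w2 y / (p - 1)) => A B *; nra.
  - have := mulr_ge0 N0 (ltW H1); rewrite mulrBl.
    move: (riccati w1 y / (p - 1)) (riccati w2 y / (p - 1)) => A B *; nra.
rewrite -(angle_le p1) -subr_le0; apply/ler_addgt0Pr => eps eps0; rewrite add0r.
pose C := expR (`|K| * (x - a)).
have C0 : 0 < C by exact: expR_gt0.
have [|s /andP[s_a sx] sD] := start (eps / C) x (divr_gt0 eps0 C0); first by rewrite ax.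
have sub y : s <= y <= x -> a < y < e by move=> /andP[? ?]; apply/andP; split; lra.
have := gronwall_pos (ltW sx) (fun y yx => dD_ y (sub y yx)) (fun y yx => dDK y (sub y yx)).
rewrite -/(D x) => G; apply: le_trans (_ : Num.max (D x) 0 <= _); first by rewrite le_max lexx.
apply: le_trans G _; rewrite -[leRHS](divfK (lt0r_neq0 C0)).
apply: ler_pM; rewrite ?expR_ge0 ?le_max ?lexx ?orbT//.
  by rewrite ge_max (ltW sD) divr_ge0// ltW.
rewrite /C ler_expR; apply: le_trans (_ : `|K| * (x - s) <= _).
  by apply: ler_wpM2r; [lra|exact: ler_norm].
by apply: ler_wpM2l => //; lra.
Qed.

(** Reflecting [u] at 0 replaces its Riccati variable by [- w (- x)]. Statements about right ends
    are deduced from those about left ends by this symmetry. *)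
Lemma is_derive_reflect w x (d : R) : is_derive (- x) 1 w d ->
  is_derive x 1 (fun y => - w (- y)) d.
Proof.
move=> wd; have wd' : is_derive (- 1 * x + 0) 1 w d by rewrite mulN1r addr0.
have := is_derive_opp (is_derive_affine_comp wd').
rewrite mulN1r opprK; congr is_derive; apply/funext => y.
by rewrite mulN1r addr0.
Qed.

Lemma derivable_reflect w x : derivable w (- x) 1 ->
  derivable (fun y => - w (- y)) x 1.
Proof. by move=> /derivableP/is_derive_reflect[]. Qed.

Lemma riccati_reflect w x : derivable w (- x) 1 ->
  riccati (fun y => - w (- y)) x = riccati w (- x).
Proof.
move=> /derivableP dw; rewrite (riccatiE (is_derive_reflect dw)) ricN.
by rewrite /riccati.
Qed.

Lemma riccati_compare_bwd w1 w2 e b M :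
  (forall x, e < x < b -> [/\ derivable w1 x 1, derivable w2 x 1,
     riccati w2 x <= riccati w1 x & `|riccati w1 x| <= M \/ `|riccati w2 x| <= M]) ->
  (forall eps t, 0 < eps -> e < t < b ->
     exists2 s, t < s < b & angle (w1 s) - angle (w2 s) < eps) ->
  forall x, e < x < b -> w1 x <= w2 x.
Proof.
move=> hw start x /andP[ex xb].
rewrite -lerN2 -[x]opprK.
apply: (@riccati_compare (fun y => - w1 (- y)) (fun y => - w2 (- y)) (- b) (- e) M).
- move=> y /andP[y1 y2]; have [|d1 d2 le bd] := hw (- y); first by apply/andP; split; lra.
  split; [exact: derivable_reflect|exact: derivable_reflect|..].
    by rewrite (riccati_reflect d1) (riccati_reflect d2).
  by rewrite (riccati_reflect d1) (riccati_reflect d2).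
- move=> eps t eps0 /andP[t1 t2].
  have [|s /andP[ts sb] sD] := start eps (- t) eps0; first by apply/andP; split; lra.
  exists (- s); first by apply/andP; split; lra.
  by rewrite opprK !(angleN p1); lra.
- by apply/andP; split; lra.
Qed.

(* For a positive Dirichlet eigenfunction [u] on ]a, b[ the function
   [w = |u'/u|^(p-2) u'/u] solves [w' = V - lam - (p-1) |w|^(p/(p-1))] and runs from
   [+oo] to [-oo]; only [w] is used to speak of the first eigenvalue [lam]. *)
Definition ground a b V lam w : Prop :=
  [/\ forall x, a < x < b -> is_derive x 1 w (V x - lam - ric (w x)),
      forall M, exists2 t, a < t < b & forall x, a < x < t -> M < w x &
      forall M, exists2 t, a < t < b & forall x, t < x < b -> w x < M].

(** Nothing is imposed at the ends: any real function lies below one that starts at +oo and above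
    one that ends at - oo. *)
Definition subsol a b F w : Prop :=
  forall x, a < x < b -> derivable w x 1 /\ riccati w x <= F x.

Lemma angle_near_half eps : 0 < eps -> exists M, forall y, M < y -> h - eps < angle y.
Proof.
move=> eps0; pose t : R := Num.max (h - eps) 0.
have h0 := half_period_gt0 p1.
have [|M MP] := @angle_onto _ _ p1 t.
  by rewrite /t; case: (leP (h - eps) 0) => ?; apply/andP; split; lra.
exists M => y My; have := angle_lt p1 My; rewrite MP.
by apply: le_lt_trans; rewrite /t le_max lexx.
Qed.

Lemma start_pinfty w1 w2 a e :
  (forall M, exists2 t, a < t < e & forall x, a < x < t -> M < w1 x) ->
  forall eps t, 0 < eps -> a < t < e ->
     exists2 s, a < s < t & angle (w2 s) - angle (w1 s) < eps.
Proof.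
move=> wy eps t /angle_near_half[M MP] /andP[at_ te].
have [t' /andP[at' t'e] wt'] := wy M.
pose m := Num.min t t'; have am : a < m by rewrite lt_min at_.
exists ((a + m) / 2).
  by apply/andP; split; [lra|apply: lt_le_trans (_ : m <= _); [lra|rewrite ge_min lexx]].
have : (a + m) / 2 < t' by apply: lt_le_trans (_ : m <= _); [lra|rewrite ge_min lexx orbT].
move=> s1; have /MP := wt' ((a + m) / 2) ltac:(apply/andP; split; lra).
by have := angle_lt_half p1 (w2 ((a + m) / 2)); lra.
Qed.

Lemma start_ninfty w1 w2 e b :
  (forall M, exists2 t, e < t < b & forall x, t < x < b -> w1 x < M) ->
  forall eps t, 0 < eps -> e < t < b ->
     exists2 s, t < s < b & angle (w1 s) - angle (w2 s) < eps.
Proof.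
move=> wy eps t /angle_near_half[M MP] /andP[et tb].
have [t' /andP[et' t'b] wt'] := wy (- M).
pose m := Num.max t t'; have mb : m < b by rewrite gt_max tb.
have tm : t <= m by rewrite le_max lexx.
have tm' : t' <= m by rewrite le_max lexx orbT.
exists ((b + m) / 2); first by apply/andP; split; lra.
have := wt' ((b + m) / 2) ltac:(apply/andP; split; lra).
rewrite ltrNr => /MP; rewrite (angleN p1).
by have := angle_gt_half p1 (w2 ((b + m) / 2)); lra.
Qed.

Lemma start_finite w1 w2 a e : {for a, continuous w1} -> {for a, continuous w2} ->
  w2 a <= w1 a ->
  forall eps t, 0 < eps -> a < t < e ->
     exists2 s, a < s < t & angle (w2 s) - angle (w1 s) < eps.
Proof.
move=> c1 c2 w21 eps t eps0 /andP[at_ te].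
have cD : {for a, continuous (fun s => angle (w2 s) - angle (w1 s))}.
  apply: cvgB; apply: continuous_comp => //; exact: angle_continuous.
have D0 : angle (w2 a) - angle (w1 a) < eps.
  by have := w21; rewrite -(angle_le p1); lra.
have near_a := @cvgr_lt _ _ _ _ _ _ cD _ D0.
have [d /= d0 dP] := near_a.
pose m := Num.min (t - a) d; have m0 : 0 < m by rewrite lt_min d0 subr_gt0 at_.
have md : m <= d by rewrite ge_min lexx orbT.
have mt : m <= t - a by rewrite ge_min lexx.
exists (a + m / 2); first by apply/andP; split; lra.
by apply: dP; rewrite /= opprD addrA subrr sub0r normrN gtr0_norm; lra.
Qed.

Lemma ground_derivable a b V lam w x : ground a b V lam w -> a < x < b ->
  derivable w x 1 /\ riccati w x = V x - lam.
Proof.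
move=> [dw _ _] xab; have d := dw x xab; split; first by case: d.
by rewrite (riccatiE d) subrK.
Qed.

Lemma bounded_shift V a b B lam x : (forall x, a < x < b -> `|V x| <= B) ->
  a < x < b -> `|V x - lam| <= B + `|lam|.
Proof. by move=> VB /VB ?; apply: le_trans (ler_normB _ _) _; rewrite lerD2r. Qed.

(** Comparison from the left end puts [w1] below [w], comparison from the right end puts it
    above. *)
Lemma ground_rigid a b V lam w w1 B : (forall x, a < x < b -> `|V x| <= B) ->
  ground a b V lam w -> subsol a b (fun x => V x - lam) w1 ->
  forall x, a < x < b -> w1 x = w x.
Proof.
move=> VB gw sw x xab; have [_ wy wNy] := gw.
have hyp y : a < y < b -> [/\ derivable w y 1, derivable w1 y 1,
     riccati w1 y <= riccati w y &
     `|riccati w y| <= B + `|lam| \/ `|riccati w1 y| <= B + `|lam|].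
  move=> yab; have [d1 e1] := ground_derivable gw yab.
  have [d2 e2] := sw y yab; split => //; first by rewrite e1.
  by left; rewrite e1; exact: bounded_shift yab.
apply/eqP; rewrite eq_le; apply/andP; split.
- by apply: (riccati_compare hyp) => //; exact: start_pinfty.
- by apply: (riccati_compare_bwd hyp) => //; exact: start_ninfty.
Qed.

Lemma riccati_eq_oo w w1 a b x : (forall y, a < y < b -> w1 y = w y) -> a < x < b ->
  derivable w x 1 -> riccati w1 x = riccati w x.
Proof.
move=> e xab /derivableP d; have /andP[ax xb] := xab.
have := @is_derive_local _ w w1 x _ a b ax xb (fun y yab => esym (e y yab)) d.
by move=> d1; rewrite /riccati e// derive_val.
Qed.

Lemma ground_rigid_riccati a b V lam w w1 B : (forall x, a < x < b -> `|V x| <= B) ->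
  ground a b V lam w -> subsol a b (fun x => V x - lam) w1 ->
  forall x, a < x < b -> riccati w1 x = V x - lam.
Proof.
move=> VB gw sw x xab; have e := ground_rigid VB gw sw.
have [d <-] := ground_derivable gw xab.
exact: riccati_eq_oo e xab d.
Qed.

Lemma ground_max a b V lam mu w w1 B : a < b -> (forall x, a < x < b -> `|V x| <= B) ->
  ground a b V lam w -> subsol a b (fun x => V x - mu) w1 -> mu <= lam.
Proof.
move=> ab VB gw sw; rewrite leNgt; apply/negP => lm.
(* A subsolution at a higher level is one at the level [lam] with strict inequality, which
   contradicts rigidity. *)
have sw' : subsol a b (fun x => V x - lam) w1.
  by move=> x /sw[? ?]; split => //; lra.
have xab : a < (a + b) / 2 < b by apply/andP; split; lra.
have := ground_rigid_riccati VB gw sw' xab.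
by have [_] := sw _ xab; lra.
Qed.

End riccati.

(** * Shooting *)

Section picard.
Context {R : realType}.
Implicit Types (u v y z : R -> R) (x s t : R).

Lemma geometric_limit (u : nat -> R) (d : R) :
  (forall n, `|u n.+1 - u n| <= d / 2 ^+ n) ->
  exists l, forall n, `|l - u n| <= 2 * d / 2 ^+ n.
Proof.
move=> ud.
have d0 : 0 <= d by have := ud 0%N; rewrite expr0 divr1; apply: le_trans.
pose e n := d / 2 ^+ n.
have eS n : e n = 2 * e n.+1.
  by rewrite /e exprS invfM mulrCA mulVKf.
have e0 n : 0 <= e n by rewrite divr_ge0// exprn_ge0.
(* The segments [A n, B n] are nested, because 2 e n = e n + 2 e (n+1). *)
pose A n := u n - 2 * e n; pose B n := u n + 2 * e n.
have AS n : A n <= A n.+1.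
  by have := ud n; rewrite -/(e n) ler_norml /A => /andP[h _]; have := eS n; lra.
have BS n : B n.+1 <= B n.
  by have := ud n; rewrite -/(e n) ler_norml /B => /andP[_ h]; have := eS n; lra.
have Am n k : A n <= A (n + k)%N.
  by elim: k => [|k IH]; [rewrite addn0|rewrite addnS; exact: le_trans IH (AS _)].
have Bm n k : B (n + k)%N <= B n.
  by elim: k => [|k IH]; [rewrite addn0|rewrite addnS; exact: le_trans (BS _) IH].
have AB n m : A n <= B m.
  apply: le_trans (Am n m) _; apply: le_trans (_ : B (n + m)%N <= _).
    by rewrite /A /B; have := e0 (n + m)%N; lra.
  by rewrite addnC.
pose S := [set A n | n in [set: nat]].
have supS : has_sup S.
  split; first by exists (A 0%N), 0%N.
  by exists (B 0%N) => _ [n _ <-].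
exists (sup S) => n.
have h1 : A n <= sup S by apply: sup_upper_bound => //; exists n.
have h2 : sup S <= B n by apply: sup_le_ub; [case: supS|move=> _ [m _ <-]].
by rewrite -mulrA -/(e n) ler_norml; move: h1 h2; rewrite /A /B; lra.
Qed.

Lemma is_derive_dominate (f g df dg : R -> R) s t : s <= t ->
  (forall x, s <= x <= t -> is_derive x 1 f (df x)) ->
  (forall x, s <= x <= t -> is_derive x 1 g (dg x)) ->
  (forall x, s <= x <= t -> `|df x| <= dg x) ->
  `|f t - f s| <= g t - g s.
Proof.
move=> st hf hg fg; rewrite ler_norml; apply/andP; split.
- have := is_derive_ndecr st (fun x xst => is_derive_add (hf x xst) (hg x xst)).
  move=> H; suff : f s + g s <= f t + g t by lra.
  by apply: H => x xst; have := fg x xst; rewrite ler_norml; lra.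
- have := is_derive_ndecr st (fun x xst => is_derive_sub (hg x xst) (hf x xst)).
  move=> H; suff : g s - f s <= g t - f t by lra.
  by apply: H => x xst; have := fg x xst; rewrite ler_norml; lra.
Qed.

Lemma lipschitz_continuous (f : R -> R) (L : R) :
  (forall x t, `|f x - f t| <= L * `|x - t|) -> continuous f.
Proof.
move=> fL x; apply/cvgrPdist_lt => e e0; rewrite near_simpl.
have L0 : 0 < `|L| + 1 by rewrite ltr_wpDl.
exists (e / (`|L| + 1)); first by rewrite /= divr_gt0.
move=> t /=; rewrite ltr_pdivlMr// => xt.
apply: le_lt_trans (fL _ _) _; apply: le_lt_trans xt.
rewrite mulrC; apply: ler_wpM2l => //.
by have := ler_norm L; lra.
Qed.

(** Measured against the weight exp (2 K (x - a)), each Picard step halves distances, so the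
    iteration converges on the whole half-line at once and no local solutions have to be
    continued. *)
Theorem picard (G : R -> R -> R) (K B a y0 : R) : 0 < K ->
  (forall y, continuous y -> continuous (fun x => G x (y x))) ->
  (forall x s t, `|G x s - G x t| <= K * `|s - t|) ->
  (forall x s, `|G x s| <= B) ->
  exists2 Y, Y a = y0 & forall x, a <= x -> is_derive x 1 Y (G x (Y x)).
Proof.
move=> K0 Gc GK GB.
have B0 : 0 <= B by apply: le_trans (GB 0 0).
have /choice[P PP] : forall z : R -> R, exists S : R -> R, continuous z ->
    S a = y0 /\ forall x, is_derive x 1 S (G x (z x)).
  move=> z; have [zc|?] := pselect (continuous z); last by exists z.
  have [S SP] := primitive_exists (Gc z zc).
  exists (fun x => S x - S a + y0) => _; split; first by rewrite subrr add0r.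
  move=> x; rewrite -[G _ _]addr0 -[G _ _]subr0.
  exact: is_derive_add (is_derive_sub (SP x) (is_derive_const _ x)) (is_derive_const _ x).
pose u n := iter n P (fun=> y0).
have uc n : continuous (u n).
  elim: n => [|n IH] x; first exact: cvg_cst.
  by have [_ d] := PP _ IH; exact: is_derive_continuous (d x).
have ud n x : is_derive x 1 (u n.+1) (G x (u n x)) by have [] := PP _ (uc n).
have ua n : u n a = y0 by case: n => [//|n]; have [] := PP _ (uc n).
(* As E' = 2 K E, a function whose derivative is bounded by K E gains at most E / 2: this is the
   factor 1/2 of the contraction. *)
pose E (k : R) x := k * expR (2 * K * x + - (2 * K * a)).
have Ed k x : is_derive x 1 (E k) (2 * K * E k x).
  have := is_derive_scale k (is_derive_affine_comp (is_derive_expR (2 * K * x + - (2 * K * a)))).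
  by rewrite (mulrCA k).
have Ea k : E k a = k by rewrite /E subrr expR0 mulr1.
have EM k l x : E (k * l) x = k * E l x by rewrite /E mulrA.
have EF (k c x : R) : E (2 * k / c) x = 2 * E k x / c by rewrite /E; ring.
have E0 k x : 0 <= k -> 0 <= E k x by move=> ?; rewrite /E mulr_ge0// expR_ge0.
(* Chosen so that the derivative of [E d] is at least B on the right of [a], which bounds the first
   iterate. *)
pose d := B / (2 * K).
have d0 : 0 <= d by rewrite divr_ge0// mulr_ge0// ltW.
have step f g (z1 z2 : R -> R) k x : 0 <= k -> a <= x -> f a = g a ->
    (forall s, is_derive s 1 f (G s (z1 s))) ->
    (forall s, is_derive s 1 g (G s (z2 s))) ->
    (forall s, a <= s -> `|z1 s - z2 s| <= E k s) ->
    `|f x - g x| <= E (k / 2) x.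
  move=> k0 ax fga df dg z12.
  have := @is_derive_dominate (fun s => f s - g s) (E (k / 2)) _ _ a x ax
    (fun s _ => is_derive_sub (df s) (dg s)) (fun s _ => Ed _ s).
  rewrite fga subrr subr0 Ea => H; apply: le_trans (H _) _; last first.
    by rewrite gerBl divr_ge0.
  move=> s /andP[a_s _]; apply: le_trans (GK _ _ _) _.
  rewrite mulrC [k / 2]mulrC EM mulrACA -mulrA.
  rewrite [leRHS](_ : _ = E k s * K); last by field.
  by rewrite ler_wpM2r ?z12// ltW.
have uu n x : a <= x -> `|u n.+1 x - u n x| <= E (d / 2 ^+ n) x.
  elim: n x => [|n IH] x ax.
    have := @is_derive_dominate (u 1%N) (E d) _ _ a x ax
      (fun s _ => ud 0%N s) (fun s _ => Ed _ s).
    rewrite ua Ea expr0 divr1 => H; apply: le_trans (H _) _; last by rewrite gerBl.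
    move=> s /andP[a_s _]; apply: le_trans (GB _ _) _.
    have dE : 2 * K * d = B by rewrite /d mulrC divfK// mulf_neq0// gt_eqF.
    rewrite -[leLHS]mulr1 -{1}dE -mulrA ler_wpM2l ?mulr_ge0 ?(ltW K0)// /E.
    rewrite ler_wpM2l// -[leLHS](@expR0 R) ler_expR.
    by rewrite -mulrBr mulr_ge0 ?subr_ge0// mulr_ge0// ltW.
  rewrite exprSr invfM mulrA; apply: (step _ _ (u n.+1) (u n)) => //.
  - by rewrite divr_ge0// exprn_ge0.
  - by rewrite !ua.
have /choice[v0 v0P] : forall x, exists l, a <= x ->
    forall n, `|l - u n x| <= 2 * E d x / 2 ^+ n.
  move=> x; have [ax|?] := pselect (a <= x); last by exists 0.
  have [|l lP] := @geometric_limit (u ^~ x) (E d x).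
    by move=> n; rewrite mulrC -EM mulrC uu.
  by exists l.
(* The limit exists only to the right of [a]; it is continued by a constant to be continuous on the
   line. *)
pose v x := v0 (Num.max a x).
have vP x n : a <= x -> `|v x - u n x| <= E (2 * d / 2 ^+ n) x.
  by move=> ax; rewrite /v (max_r ax) EF v0P.
have uL n s t : `|u n s - u n t| <= B * `|s - t|.
  wlog st : s t / t <= s.
    move=> H; have [/H//|/ltW/H] := leP t s.
    by rewrite (distrC (u n t)) (distrC t).
  case: n => [|n]; first by rewrite subrr normr0 mulr_ge0.
  have := @is_derive_dominate (u n.+1) (fun x => B * x + 0) _ _ t s st
     (fun x _ => ud n x) (fun x _ => is_derive_affine x B 0) (fun x _ => GB _ _).
  have s0 : 0 <= s - t by rewrite subr_ge0.
  by rewrite !addr0 -mulrBr (ger0_norm s0).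
have to0 (c k : R) : (forall n, k <= c / 2 ^+ n) -> k <= 0.
  move=> H; rewrite leNgt; apply/negP => k0.
  have c0 : 0 < c by have := H 0%N; rewrite expr0 divr1; lra.
  have [N _ /(_ N (leqnn N))] := near_infty_natSinv_lt (PosNum (divr_gt0 k0 c0)).
  rewrite /= ltNge => /negP; apply.
  rewrite ler_pdivrMr// mulrC; apply: le_trans (H N) _.
  rewrite ler_wpM2l ?(ltW c0)// lef_pV2 ?posrE ?exprn_gt0// -natrX ler_nat.
  exact: ltn_expl.
have vL s t : `|v s - v t| <= B * `|s - t|.
  pose s' := Num.max a s; pose t' := Num.max a t.
  have as' : a <= s' by rewrite le_max lexx.
  have at' : a <= t' by rewrite le_max lexx.
  have st' : `|s' - t'| <= `|s - t|.
    rewrite /s' /t'; case: (leP a s) => ?; case: (leP a t) => ?; rewrite ?subrr ?normr0 ?normr_ge0//.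
    - by rewrite !ger0_norm; lra.
    - by rewrite distrC (distrC s) !ger0_norm; lra.
  apply: le_trans (_ : B * `|s' - t'| <= _); last by rewrite ler_wpM2l.
  rewrite -subr_le0; apply: (to0 (2 * E d s' + 2 * E d t')) => n.
  have h1 := v0P s' as' n; have h2 := v0P t' at' n; have h3 := uL n s' t'.
  rewrite lerBlDr mulrDl /v -/s' -/t'.
  rewrite (_ : v0 s' - v0 t' = (v0 s' - u n s') + (u n s' - u n t') - (v0 t' - u n t')); last by ring.
  apply: le_trans (ler_normB _ _) _; have := ler_normD (v0 s' - u n s') (u n s' - u n t').
  by lra.
have vc : continuous v by exact: lipschitz_continuous vL.
have [Ya Yd] := PP v vc.
have Yv x : a <= x -> P v x = v x.
  move=> ax; apply/eqP; rewrite -subr_eq0 -normr_le0.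
  apply: (to0 (2 * E d x + 2 * E d x)) => n.
  have h1 : `|P v x - u n.+1 x| <= E (2 * d / 2 ^+ n / 2) x.
    apply: (step _ _ v (u n)) => //.
    - by rewrite divr_ge0 ?exprn_ge0// mulr_ge0.
    - by rewrite Ya ua.
    - by move=> s a_s; exact: vP.
  have h2 := vP x n.+1 ax.
  rewrite (_ : P v x - v x = (P v x - u n.+1 x) - (v x - u n.+1 x)); last by ring.
  apply: le_trans (ler_normB _ _) _.
  have h4 : 2 * E d x / 2 ^+ n.+1 <= 2 * E d x / 2 ^+ n.
    apply: ler_wpM2l; first by rewrite mulr_ge0 ?E0.
    by rewrite lef_pV2 ?posrE ?exprn_gt0// exprS ler_peMl ?exprn_ge0// ler1n.
  have e2 : 2 * d / 2 ^+ n / 2 = 2 * d / 2 ^+ n.+1 by rewrite exprSr invfM [RHS]mulrA.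
  by move: h1 h2; rewrite e2 !EF mulrDl; lra.
exists (P v) => // x ax; rewrite Yv//; exact: Yd.
Qed.

End picard.

(** * Existence of ground states and of nodal pairs *)

Section existence.
Context {R : realType}.
Variable p : R.
Hypothesis p1 : 1 < p.
Implicit Types (w V c Y : R -> R) (a b e x y s t eps lam mu M : R).

Local Ltac plra := let H := fresh in pose proof p1 as H; lra.
Local Notation q := (conjugate p).
Local Notation angle := (angle p).
Local Notation cangle := (cangle p).
Local Notation H := (angle_speed p).
Local Notation h := (half_period p).

Let h0 : 0 < h. Proof. exact: half_period_gt0. Qed.
Local Ltac hlra := let H1 := fresh in let H2 := fresh in
  pose proof p1 as H1; pose proof h0 as H2; lra.

Lemma angle_speed_le x y : `|x| <= `|y| -> H y <= H x.
Proof.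
move=> xy; have q0 : 0 <= q by have := conjugate_gt1 p1; plra.
rewrite /angle_speed lef_pV2 ?posrE ?ltr_pwDl ?powR_ge0// lerD2l.
exact: abspow_le.
Qed.

(** Let the second point of the Lipschitz estimate go to +oo, where the speed vanishes and the angle
    stays below [h]. *)
Lemma angle_speed_le_half x : H x <= p * (h - angle x).
Proof.
apply/ler_addgt0Pr => eps eps0; have [M HM] := angle_speed_vanish p1 eps0.
pose N : R := Num.max `|M| `|x|.
have N0 : 0 <= N by rewrite le_max normr_ge0.
have HN : H N < eps.
  by apply: le_lt_trans HM; apply: angle_speed_le; rewrite (ger0_norm N0) le_max lexx.
have xN : angle x <= angle N.
  by rewrite (angle_le p1); apply: le_trans (ler_norm x) _; rewrite le_max lexx orbT.
have := angle_speed_lipschitz p1 x N; rewrite distrC (distrC (angle x)).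
rewrite [X in _ <= p * X]ger0_norm ?subr_ge0// => lip.
have : H x - H N <= p * (h - angle x).
  apply: le_trans (_ : `|H N - H x| <= _); first by rewrite distrC ler_norm.
  apply: le_trans lip _; rewrite ler_wpM2l ?lerD2r ?ltW ?angle_lt_half//; plra.
by lra.
Qed.

Lemma angle_speedN x : H (- x) = H x.
Proof. by rewrite /angle_speed normrN. Qed.

Definition bump0 t : R := if `|t| < h then H (cangle t) else 0.

Lemma bump0_in t : - h < t < h -> bump0 t = H (cangle t).
Proof. by move=> th; rewrite /bump0 ltr_norml th. Qed.

Lemma bump0_out t : h <= `|t| -> bump0 t = 0.
Proof. by move=> th; rewrite /bump0 ltNge th. Qed.

Lemma bump0_ge0 t : 0 <= bump0 t.
Proof. by rewrite /bump0; case: ifP => // _; rewrite ltW// angle_speed_gt0. Qed.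

Lemma bump0_le1 t : bump0 t <= 1.
Proof. by rewrite /bump0; case: ifP => // _; exact: angle_speed_le1. Qed.

Lemma bump0_le t : bump0 t <= p * Num.max 0 (h - `|t|).
Proof.
have [th|th] := ltP `|t| h; last first.
  by rewrite bump0_out// mulr_ge0 ?le_max ?lexx//; plra.
have thin : - h < t < h by rewrite -ltr_norml.
have e := cangleK p1 thin; rewrite bump0_in// max_r ?subr_ge0 ?(ltW th)//.
have [t0|t0] := leP 0 t.
  by have := angle_speed_le_half (cangle t); rewrite e (ger0_norm t0).
by have := angle_speed_le_half (- cangle t); rewrite angle_speedN (angleN p1) e (ltr0_norm t0).
Qed.

Lemma bump0_lipschitz s t : `|bump0 s - bump0 t| <= p * `|s - t|.
Proof.
have P0 : 0 <= p by plra.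
wlog st : s t / `|s| <= `|t|.
  move=> W; have [/W//|/ltW/W] := leP `|s| `|t|.
  by rewrite distrC (distrC t).
have [th|th] := ltP `|t| h.
  have sh : `|s| < h by exact: le_lt_trans th.
  rewrite !bump0_in -?ltr_norml//; apply: le_trans (angle_speed_lipschitz p1 _ _) _.
  by rewrite !cangleK -?ltr_norml.
rewrite (bump0_out th) subr0 ger0_norm ?bump0_ge0//.
apply: le_trans (bump0_le s) _; rewrite ler_wpM2l// ge_max normr_ge0/=.
have : `|t| <= `|s| + `|s - t|.
  by rewrite -{1}(subKr s t) (le_trans (ler_normB _ _)).
by lra.
Qed.

(* In the variable [Y = angle w] the Riccati equation reads
   [Y' = -1 + c (x) bump0 (Y)] and stays regular at the Dirichlet ends [Y = h, -h]. The
   second copy of [bump0] lets [Y] run through a second nodal interval, from [-h] down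
   to [-3 h]. *)
Definition bump t : R := bump0 t + bump0 (t + 2 * h).

Lemma bump_ge0 t : 0 <= bump t. Proof. by rewrite addr_ge0 ?bump0_ge0. Qed.

Lemma bump_le2 t : bump t <= 2.
Proof. by have := bump0_le1 t; have := bump0_le1 (t + 2 * h); rewrite /bump; lra. Qed.

Lemma bump_lipschitz s t : `|bump s - bump t| <= 2 * p * `|s - t|.
Proof.
have := bump0_lipschitz s t; have := bump0_lipschitz (s + 2 * h) (t + 2 * h).
rewrite (_ : s + 2 * h - (t + 2 * h) = s - t); last by ring.
move=> h1 h2; rewrite /bump.
rewrite (_ : _ - _ = (bump0 s - bump0 t) + (bump0 (s + 2 * h) - bump0 (t + 2 * h))); last by ring.
by apply: le_trans (ler_normD _ _) _; lra.
Qed.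

Lemma bump_first t : - h < t < h -> bump t = bump0 t.
Proof.
by move=> th; rewrite /bump [X in _ + X]bump0_out ?addr0// ger0_norm; hlra.
Qed.

Lemma bump_second t : - h < t + 2 * h < h -> bump t = bump0 (t + 2 * h).
Proof.
move=> th; rewrite /bump [X in X + _]bump0_out ?add0r//.
by rewrite ler0_norm; hlra.
Qed.

Lemma bump_h : bump h = 0.
Proof. by rewrite /bump !bump0_out ?addr0//; rewrite ger0_norm; hlra. Qed.

Lemma bump_Nh : bump (- h) = 0.
Proof.
by rewrite /bump !bump0_out ?addr0//; [rewrite ger0_norm|rewrite normrN ger0_norm]; hlra.
Qed.

Lemma bump_0 : bump 0 = 1.
Proof.
rewrite bump_first; last by hlra.
rewrite bump0_in; last by hlra.
rewrite -(angle0 p1) (angleK p1) /angle_speed normr0 powR0 ?addr0 ?invr1//.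
by rewrite gt_eqF//; have := conjugate_gt1 p1; plra.
Qed.

Definition prufer c Y a := forall x, a <= x -> is_derive x 1 Y (- 1 + c x * bump (Y x)).

Lemma prufer_exists c C a y0 : continuous c -> (forall x, `|c x| <= C) ->
  exists2 Y, Y a = y0 & prufer c Y a.
Proof.
move=> cc cC; have C0 : 0 <= C by apply: le_trans (cC 0).
have P0 : 0 <= 2 * p by plra.
apply: (@picard _ (fun x y => - 1 + c x * bump y) (C * (2 * p) + 1) (1 + C * 2)).
- by rewrite ltr_wpDl// mulr_ge0.
- move=> y yc x; apply: cvgD; first exact: cvg_cst.
  apply: cvgM; first exact: cc.
  apply: continuous_comp; first exact: yc.
  by apply: (lipschitz_continuous (L := 2 * p)) => s t; exact: bump_lipschitz.
- move=> x s t; rewrite (_ : _ - _ = c x * (bump s - bump t)); last by ring.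
  rewrite normrM; apply: le_trans (_ : C * (2 * p) * `|s - t| <= _); last first.
    by rewrite ler_wpM2r// lerDl.
  by rewrite -mulrA ler_pM// bump_lipschitz.
- move=> x s; apply: le_trans (ler_normD _ _) _; rewrite normrN1 lerD2l normrM.
  by rewrite ler_pM// ger0_norm ?bump_ge0 ?bump_le2.
Qed.

Lemma prufer_S c Y a e : prufer c Y a -> a <= e -> prufer c Y e.
Proof. by move=> YP ae x ex; apply: YP; exact: le_trans ex. Qed.

Lemma prufer_continuous c Y a x : prufer c Y a -> a <= x -> {for x, continuous Y}.
Proof. by move=> YP ax; exact: is_derive_continuous (YP x ax). Qed.

(* The levels [h] and [- h] are crossed once, downwards, since [bump] vanishes there. *)
Lemma prufer_cross c C Y a l t : (forall x, `|c x| <= C) -> prufer c Y a ->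
  bump l = 0 -> Y a <= l -> a < t -> Y t < l.
Proof.
move=> cC YP bl Yal at_; have C0 : 0 <= C by apply: le_trans (cC 0).
pose K := C * (2 * p).
have P0 : 0 <= 2 * p by plra.
have K0 : 0 <= K by rewrite mulr_ge0.
have bnd x : `|c x * bump (Y x)| <= K * `|Y x - l|.
  rewrite normrM /K -mulrA ler_pM//.
  by have := bump_lipschitz (Y x) l; rewrite bl subr0.
have le0 x : a <= x -> Y x <= l.
  move=> ax; have dD s : a <= s <= x -> is_derive s 1 (fun s => Y s - l) (- 1 + c s * bump (Y s) - 0).
    by move=> /andP[a_s _]; exact: is_derive_sub (YP s a_s) (is_derive_const _ s).
  have := gronwall_pos ax dD (K := K).
  rewrite [X in _ <= X * _]max_r ?subr_le0// mul0r => G.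
  rewrite -subr_le0; apply: le_trans (_ : Num.max (Y x - l) 0 <= _); first by rewrite le_max lexx.
  apply: G => s /andP[a_s _] Ys; have := bnd s.
  by rewrite (gtr0_norm Ys) ler_norml; lra.
(* Integrating factor: the bound [bnd] makes the derivative of this product at least exp (K s) > 0,
   the strictness coming from the constant term - 1 of the equation. *)
have dE s : a <= s <= t -> is_derive s 1 (fun s => (l - Y s) * expR (K * s + 0))
    ((0 - (- 1 + c s * bump (Y s))) * expR (K * s + 0) + (l - Y s) * (K * expR (K * s + 0))).
  move=> /andP[a_s _]; apply: is_derive_mul.
    exact: is_derive_sub (is_derive_const _ s) (YP s a_s).
  exact: is_derive_affine_comp (is_derive_expR _).
have lt : (l - Y a) * expR (K * a + 0) < (l - Y t) * expR (K * t + 0).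
  apply: (is_derive_incr at_ dE).
  move=> s /andP[a_s _]; have := bnd s; have := le0 s a_s => Ysl.
  rewrite [`|Y s - l|]ler0_norm ?subr_le0// ler_norml => /andP[h1 h2].
  rewrite mulrA -mulrDl mulr_gt0 ?expR_gt0//; lra.
have : 0 < (l - Y t) * expR (K * t + 0).
  by apply: le_lt_trans lt; rewrite mulr_ge0 ?expR_ge0// subr_ge0.
by rewrite pmulr_lgt0 ?expR_gt0// subr_gt0.
Qed.

Lemma prufer_ground c V lam Y a b : a < b ->
  (forall x, a < x < b -> c x = 1 + (V x - lam) / (p - 1)) ->
  (forall x, a < x < b -> is_derive x 1 Y (- 1 + c x * bump0 (Y x))) ->
  {for a, continuous Y} -> {for b, continuous Y} ->
  Y a = h -> Y b = - h -> (forall x, a < x < b -> - h < Y x < h) ->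
  ground p a b V lam (fun x => cangle (Y x)).
Proof.
move=> ab cE Yd ca cb Ya Yb Yin; split.
- move=> x xab; have Yx := Yin x xab.
  have := is_derive_comp (Yd x xab) (cangle_is_derive p1 Yx).
  move/is_derive_eq; apply; rewrite bump0_in// cE// /ric /angle_speed.
  have : 0 < 1 + `|cangle (Y x)| `^ q by rewrite ltr_pwDl// powR_ge0.
  move: (`|cangle (Y x)| `^ q) => A A0; field; rewrite gt_eqF//=; plra.
- move=> M; have MY : angle M < Y a by rewrite Ya angle_lt_half.
  have nY := @cvgr_gt _ _ _ _ _ _ ca _ MY; have [d /= d0 dP] := nY.
  exists (Num.min (a + d) ((a + b) / 2)).
    by case: (leP (a + d) ((a + b) / 2)) => ?; apply/andP; split; lra.
  move=> x /andP[ax]; rewrite lt_min => /andP[xd xb].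
  have : a < x < b by apply/andP; split; lra.
  move=> xab; have : angle M < Y x.
    by apply: dP; rewrite /= ltr0_norm ?subr_lt0//; lra.
  by rewrite -{1}(cangleK p1 (Yin x xab)) (angle_mono p1).
- move=> M; have MY : Y b < angle M by rewrite Yb angle_gt_half.
  have nY := @cvgr_lt _ _ _ _ _ _ cb _ MY; have [d /= d0 dP] := nY.
  exists (Num.max (b - d) ((a + b) / 2)).
    by case: (leP (b - d) ((a + b) / 2)) => ?; apply/andP; split; lra.
  move=> x /andP[]; rewrite gt_max => /andP[xd xa] xb.
  have : a < x < b by apply/andP; split; lra.
  move=> xab; have : Y x < angle M.
    by apply: dP; rewrite /= gtr0_norm ?subr_gt0//; lra.
  by rewrite -{1}(cangleK p1 (Yin x xab)) (angle_mono p1).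
Qed.

(* The Riccati variable of the first eigenfunction [sin_p (k (x - a))] of the free
   p-Laplacian on an interval of length [2 h / k]. *)
Definition model k a x : R := k `^ (p - 1) * cangle (- k * x + (h + k * a)).

Lemma model_is_derive k a x : 0 < k -> a < x < a + 2 * h / k ->
  is_derive x 1 (model k a) (- ((p - 1) * k `^ p) - ric p (model k a x)).
Proof.
move=> k0 /andP[ax xb].
have kx : k * (x - a) < 2 * h by rewrite mulrC -ltr_pdivlMr//; lra.
have kx0 : 0 < k * (x - a) by rewrite mulr_gt0// subr_gt0.
have th : - h < - k * x + (h + k * a) < h by apply/andP; split; lra.
have := is_derive_scale (k `^ (p - 1)) (is_derive_affine_comp (cangle_is_derive p1 th)).
move/is_derive_eq; apply; rewrite /ric /model normrM powRM ?powR_ge0// ?normr_ge0//.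
rewrite (ger0_norm (powR_ge0 _ _)) -powRrM (_ : (p - 1) * q = p); last first.
  by rewrite /conjugate; field; plra.
rewrite /angle_speed invrK.
have -> : k `^ p = k * k `^ (p - 1) by rewrite mulr_powRB1 ?(ltW k0)//; plra.
by ring.
Qed.

Lemma model_ground k a : 0 < k ->
  ground p a (a + 2 * h / k) (fun=> 0) ((p - 1) * k `^ p) (model k a).
Proof.
move=> k0; have kp0 : 0 < k `^ (p - 1) by exact: powR_gt0.
have hk0 : 0 < 2 * h / k by rewrite divr_gt0//; hlra.
split.
- by move=> x /(model_is_derive k0)/is_derive_eq; apply; rewrite sub0r.
- move=> M; pose m : R := angle (M / k `^ (p - 1)).
  have mh : m < h by exact: angle_lt_half.
  have mh' : - h < m by exact: angle_gt_half.
  have dk : 0 < (h - m) / k by rewrite divr_gt0// subr_gt0.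
  have dk2 : (h - m) / k < 2 * h / k by rewrite ltr_pM2r ?invr_gt0//; lra.
  exists (a + (h - m) / k); first by apply/andP; split; lra.
  move=> x /andP[ax xt].
  have kx : k * (x - a) < h - m by rewrite mulrC -ltr_pdivlMr//; lra.
  have kx0 : 0 < k * (x - a) by rewrite mulr_gt0// subr_gt0.
  rewrite /model mulrC -ltr_pdivrMr// -(angle_mono p1) cangleK//; last by apply/andP; split; lra.
  by rewrite -/m; lra.
- move=> M; pose m : R := angle (M / k `^ (p - 1)).
  have mh : m < h by exact: angle_lt_half.
  have mh' : - h < m by exact: angle_gt_half.
  have dk : 0 < (h - m) / k by rewrite divr_gt0// subr_gt0.
  have dk2 : (h - m) / k < 2 * h / k by rewrite ltr_pM2r ?invr_gt0//; lra.
  exists (a + (h - m) / k); first by apply/andP; split; lra.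
  move=> x /andP[tx xb].
  have kx : h - m < k * (x - a) by rewrite mulrC -ltr_pdivrMr//; lra.
  have kx0 : k * (x - a) < 2 * h by rewrite mulrC -ltr_pdivlMr//; lra.
  rewrite /model mulrC -ltr_pdivlMr// -(angle_mono p1) cangleK//; last by apply/andP; split; lra.
  by rewrite -/m; lra.
Qed.

(** If c <= 1 - k^p, then [Y] falls at least as fast as the angle of the model solution, which loses
    a full nodal interval 2 h over a length 2 h / k. The number [j] counts the nodal intervals
    already passed. *)
Lemma prufer_stage c C Y a k (j : R) : (forall x, `|c x| <= C) -> prufer c Y a -> 1 <= k ->
  (forall x, c x <= 1 - k `^ p) -> (j = 0 \/ j = 1) -> Y a <= h - 2 * h * j ->
  Y (a + 2 * h / k) <= h - 2 * h * (j + 1).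
Proof.
move=> cC YP k1 ck j01 Ya; have k0 : 0 < k by lra.
have hk0 : 0 < 2 * h / k by rewrite divr_gt0//; hlra.
pose b := a + 2 * h / k; have ab : a < b by rewrite /b; lra.
have kb x : x < b -> k * (x - a) < 2 * h by move=> xb; rewrite mulrC -ltr_pdivlMr//; move: xb; rewrite /b; lra.
have k0x x : a < x -> 0 < k * (x - a) by move=> ax; rewrite mulr_gt0// subr_gt0.
pose Z x := angle (model k a x) - 2 * h * j.
have kp1 : 1 <= k `^ (p - 1).
  by have := @ler_powR _ _ k1 0 (p - 1); rewrite powRr0; apply; plra.
have ph x : a < x < b -> - h < - k * x + (h + k * a) < h.
  by move=> /andP[/k0x ? /kb ?]; apply/andP; split; lra.
(* The model is infinite at both ends, so its angle is compared there with its phase: the factor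
   k^(p-1) >= 1 pushes the angle above the phase on the first half and below it on the second. *)
have ZE1 x : a < x -> x <= (a + b) / 2 -> h - k * (x - a) - 2 * h * j <= Z x.
  move=> ax xm; have xab : a < x < b by apply/andP; split; lra.
  rewrite /Z lerD2r -{1}[h - _](cangleK p1 (_ : - h < h - k * (x - a) < h)); last first.
    by have := ph x xab; rewrite (_ : - k * x + (h + k * a) = h - k * (x - a)); last by ring.
  rewrite (angle_le p1) /model (_ : - k * x + (h + k * a) = h - k * (x - a)); last by ring.
  apply: ler_peMl => //; rewrite -(angle_le p1) (angle0 p1) (cangleK p1); last first.
    by have := ph x xab; rewrite (_ : - k * x + (h + k * a) = h - k * (x - a)); last by ring.
  rewrite subr_ge0 mulrC -ler_pdivlMr//; move: xm; rewrite /b; lra.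
have ZE2 x : (a + b) / 2 <= x -> x < b -> Z x <= h - k * (x - a) - 2 * h * j.
  move=> xm xb; have xab : a < x < b by apply/andP; split; lra.
  rewrite /Z lerD2r -[h - _](cangleK p1 (_ : - h < h - k * (x - a) < h)); last first.
    by have := ph x xab; rewrite (_ : - k * x + (h + k * a) = h - k * (x - a)); last by ring.
  rewrite (angle_le p1) /model (_ : - k * x + (h + k * a) = h - k * (x - a)); last by ring.
  apply: ler_neMl => //; rewrite -(angle_le p1) (angle0 p1) (cangleK p1); last first.
    by have := ph x xab; rewrite (_ : - k * x + (h + k * a) = h - k * (x - a)); last by ring.
  rewrite subr_le0 mulrC -ler_pdivrMr//; move: xm; rewrite /b; lra.
have bZ x : bump (Z x) = H (model k a x).
  have := angle_lt_half p1 (model k a x); have := angle_gt_half p1 (model k a x).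
  rewrite /Z => h1 h2; case: j01 => ->.
  - by rewrite mulr0 subr0 bump_first ?bump0_in ?h1// (angleK p1).
  - by rewrite mulr1 bump_second subrK ?h1// bump0_in ?h1// (angleK p1).
have dZ x : a < x < b -> is_derive x 1 Z (- 1 + (1 - k `^ p) * bump (Z x)).
  move=> xab; have dm := model_is_derive k0 xab.
  have := @angle_riccati _ _ p1 (model k a) x ltac:(by case: dm).
  rewrite (riccatiE p dm) subrK => dd.
  have := is_derive_sub dd (is_derive_const (2 * h * j) x).
  move/is_derive_eq; apply; rewrite subr0 bZ; congr (_ + _ * _).
  by field; plra.
have P0 : 0 <= 2 * p by plra.
pose K := `|1 - k `^ p| * (2 * p).
have YZ x : a < x < b -> Y x <= Z x.
  move=> /andP[ax xb]; rewrite -subr_le0; apply/ler_addgt0Pr => eps eps0; rewrite add0r.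
  pose E := expR (K * (x - a)); have E0 : 0 < E by exact: expR_gt0.
  have e2 : 0 < eps / E / 2 by rewrite !divr_gt0.
  have YM : Y a < Y a + eps / E / 2 by lra.
  have nY := @cvgr_lt _ _ _ _ _ _ (prufer_continuous YP (lexx a)) _ YM.
  have [d /= d0 dP] := nY.
  pose m : R := Num.min (Num.min d (eps / E / 2 / k)) (Num.min (x - a) ((b - a) / 2)).
  have e3 : 0 < eps / E / 2 / k by rewrite divr_gt0.
  have e4 : 0 < x - a by lra.
  have e5 : 0 < (b - a) / 2 by lra.
  have m0 : 0 < m by rewrite !lt_min d0 e3 e4 e5.
  have [m1 [m2 [m3 m4]]] : m <= d /\ m <= eps / E / 2 / k /\ m <= x - a /\ m <= (b - a) / 2.
    by rewrite /m !ge_min !lexx !orbT.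
  pose s := a + m / 2.
  have as_ : a < s by rewrite /s; lra.
  have sx : s < x by rewrite /s; lra.
  have Ys : Y s < Y a + eps / E / 2.
    by apply: dP; rewrite /= ltr0_norm ?subr_lt0//; rewrite /s; lra.
  have ks : k * (s - a) <= eps / E / 2 by rewrite mulrC -ler_pdivlMr// /s; lra.
  have Zs : h - k * (s - a) - 2 * h * j <= Z s by apply: ZE1 => //; rewrite /s; lra.
  have sub y : s <= y <= x -> a < y < b by move=> /andP[? ?]; apply/andP; split; lra.
  have dD y : s <= y <= x -> is_derive y 1 (fun y => Y y - Z y)
      ((- 1 + c y * bump (Y y)) - (- 1 + (1 - k `^ p) * bump (Z y))).
    move=> yx; have yab := sub y yx; apply: is_derive_sub (dZ y yab).
    by apply: YP; case/andP: yab => /ltW.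
  have := gronwall_pos (ltW sx) dD (K := K) => G.
  apply: le_trans (_ : Num.max (Y x - Z x) 0 <= _); first by rewrite le_max lexx.
  apply: le_trans (G _) _.
    move=> y yx D0; have := bump_lipschitz (Y y) (Z y); rewrite (gtr0_norm D0) => lip.
    apply: le_trans (_ : (1 - k `^ p) * (bump (Y y) - bump (Z y)) <= _).
      have := ler_wpM2r (bump_ge0 (Y y)) (ck y).
      move: (c y * _) => u; rewrite mulrBr; lra.
    apply: le_trans (ler_norm _) _; rewrite normrM /K -mulrA ler_wpM2l//.
  rewrite -[leRHS](divfK (lt0r_neq0 E0)); apply: ler_pM; rewrite ?expR_ge0 ?le_max ?lexx ?orbT//.
    rewrite ge_max; apply/andP; split; last by rewrite divr_ge0// ltW.
    by move: Ya Ys ks Zs; lra.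
  by rewrite /E ler_expR ler_wpM2l ?mulr_ge0//; lra.
apply/ler_addgt0Pr => eps eps0; rewrite -/b.
have YM : Y b - eps / 2 < Y b by lra.
have nY := @cvgr_gt _ _ _ _ _ _ (prufer_continuous YP (ltW ab)) _ YM.
have [d /= d0 dP] := nY.
pose m : R := Num.min d (Num.min (eps / k) ((b - a) / 2)).
have m0 : 0 < m by rewrite !lt_min d0 divr_gt0//=; lra.
have [m1 [m2 m3]] : m <= d /\ m <= eps / k /\ m <= (b - a) / 2.
  by rewrite /m !ge_min !lexx !orbT.
pose x := b - m / 2.
have Yx : Y b - eps / 2 < Y x.
  by apply: dP; rewrite /= gtr0_norm ?subr_gt0//; rewrite /x; lra.
have xb : x < b by rewrite /x; lra.
have xm : (a + b) / 2 <= x by rewrite /x; lra.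
have ax : a < x by lra.
have := YZ x ltac:(by rewrite ax); have := ZE2 x xm xb.
have km : k * m <= eps by rewrite mulrC -ler_pdivlMr.
have kxE : k * (x - a) = 2 * h - k * m / 2.
  by rewrite /x /b; field; rewrite gt_eqF.
by rewrite kxE mulrDr mulr1; lra.
Qed.

Lemma prufer_lam_continuous c1 c2 C Y1 Y2 a b d : (forall x, `|c1 x| <= C) ->
  prufer c1 Y1 a -> prufer c2 Y2 a -> Y1 a = Y2 a -> a <= b ->
  (forall x, `|c1 x - c2 x| <= d) ->
  `|Y1 b - Y2 b| <= 2 * d * expR ((C * (2 * p) + 1) * (b - a)).
Proof.
move=> cC P1 P2 Y12 ab cd.
have C0 : 0 <= C by apply: le_trans (cC 0).
have d0 : 0 <= d by apply: le_trans (cd 0).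
have P0 : 0 <= 2 * p by plra.
pose K := C * (2 * p).
have K0 : 0 <= K by rewrite mulr_ge0.
(* Barrier for the difference: since E' = (K + 1) E and E >= 2 d, the forcing 2 d is absorbed and
   [U - W - E] satisfies the hypothesis of Gronwall. *)
pose E x := 2 * d * expR ((K + 1) * x + - ((K + 1) * a)).
have dE x : is_derive x 1 E ((K + 1) * E x).
  have := is_derive_scale (2 * d) (is_derive_affine_comp (is_derive_expR ((K + 1) * x + - ((K + 1) * a)))).
  by rewrite (mulrCA (2 * d)).
have Ege x : a <= x -> 2 * d <= E x.
  move=> ax; rewrite /E -[leLHS]mulr1 ler_wpM2l ?mulr_ge0//.
  by rewrite -[leLHS](@expR0 R) ler_expR -mulrBr mulr_ge0 ?subr_ge0//; lra.
have F x : `|(c1 x * bump (Y1 x)) - (c2 x * bump (Y2 x))| <= 2 * d + K * `|Y1 x - Y2 x|.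
  rewrite (_ : _ - _ = (c1 x - c2 x) * bump (Y2 x) + c1 x * (bump (Y1 x) - bump (Y2 x))); last by ring.
  apply: le_trans (ler_normD _ _) _; rewrite !normrM; apply: lerD.
    by rewrite (mulrC 2) ler_pM// ger0_norm ?bump_ge0 ?bump_le2.
  by rewrite /K -mulrA ler_pM// bump_lipschitz.
have key (U W : R -> R) (u w : R -> R) : U a = W a ->
    (forall x, a <= x <= b -> is_derive x 1 U (u x)) ->
    (forall x, a <= x <= b -> is_derive x 1 W (w x)) ->
    (forall x, `|u x - w x| <= 2 * d + K * `|U x - W x|) ->
    U b - W b <= E b.
  move=> UW dU dW uw.
  have dD x : a <= x <= b -> is_derive x 1 (fun x => (U x - W x) - E x) ((u x - w x) - (K + 1) * E x).
    by move=> xab; exact: is_derive_sub (is_derive_sub (dU x xab) (dW x xab)) (dE x).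
  have := gronwall_pos ab dD (K := K) => G.
  have Ea : 2 * d <= E a by exact: Ege.
  rewrite [X in _ <= X * _]max_r ?mul0r in G; last by rewrite UW subrr; lra.
  rewrite -subr_le0; apply: le_trans (_ : Num.max (U b - W b - E b) 0 <= _); first by rewrite le_max lexx.
  apply: G => x /andP[ax xb] D0; have := uw x; have := Ege x ax => Ex.
  rewrite [X in K * X]ger0_norm; last by lra.
  rewrite ler_norml => /andP[_]; lra.
have EbE : E b = 2 * d * expR ((K + 1) * (b - a)) by rewrite /E mulrBr.
rewrite -EbE ler_norml; apply/andP; split.
- rewrite lerNl opprB; apply: (key Y2 Y1 (fun x => - 1 + c2 x * bump (Y2 x))
    (fun x => - 1 + c1 x * bump (Y1 x))) => //.
  + by move=> x /andP[? _]; exact: P2.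
  + by move=> x /andP[? _]; exact: P1.
  + move=> x; rewrite distrC (distrC (Y2 x)).
    by rewrite (_ : _ - _ = c1 x * bump (Y1 x) - c2 x * bump (Y2 x)) ?F//; ring.
- apply: (key Y1 Y2 (fun x => - 1 + c1 x * bump (Y1 x))
    (fun x => - 1 + c2 x * bump (Y2 x))) => //.
  + by move=> x /andP[? _]; exact: P1.
  + by move=> x /andP[? _]; exact: P2.
  + by move=> x; rewrite (_ : _ - _ = c1 x * bump (Y1 x) - c2 x * bump (Y2 x)) ?F//; ring.
Qed.

(** At the level 0 one has [bump 0 = 1], so Y' = - 1 + c >= 0 there and [Y] cannot cross it
    downwards. *)
Lemma prufer_low c C Y a b : (forall x, `|c x| <= C) -> (forall x, 1 <= c x) ->
  prufer c Y a -> Y a = h -> a <= b -> 0 <= Y b.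
Proof.
move=> cC c1 YP Ya ab.
have dD x : a <= x <= b -> is_derive x 1 (fun x => - Y x) (- (- 1 + c x * bump (Y x))).
  by move=> /andP[ax _]; exact: is_derive_opp (YP x ax).
have := gronwall_pos ab dD (K := 2 * p) => G.
rewrite [X in _ <= X * _]max_r ?mul0r in G; last by rewrite Ya; hlra.
rewrite -oppr_le0; apply: le_trans (_ : Num.max (- Y b) 0 <= _); first by rewrite le_max lexx.
apply: G => x /andP[ax xb] Y0; have := bump_lipschitz (Y x) 0.
rewrite bump_0 subr0 -[X in _ * X]normrN (gtr0_norm Y0) ler_norml => /andP[h1 _].
have := ler_wpM2r (bump_ge0 (Y x)) (c1 x); lra.
Qed.

Definition coef V lam x : R := 1 + (V x - lam) / (p - 1).

Lemma coef_bound V B lam x : (forall x, `|V x| <= B) ->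
  `|coef V lam x| <= 1 + (B + `|lam|) / (p - 1).
Proof.
move=> VB; have pi : 0 < (p - 1)^-1 by rewrite invr_gt0; plra.
apply: le_trans (ler_normD _ _) _; rewrite normr1 lerD2l normrM (gtr0_norm pi) ler_pM2r//.
by apply: le_trans (ler_normB _ _) _; rewrite lerD2r.
Qed.

Lemma coef_continuous V lam : continuous V -> continuous (coef V lam).
Proof.
move=> cV x; apply: cvgD; first exact: cvg_cst.
apply: cvgM; last exact: cvg_cst.
by apply: cvgB; [exact: cV|exact: cvg_cst].
Qed.

(** Intermediate value theorem in [lam] for the final angle [Y lam b]: j = 1 yields a ground state
    on the interval, j = 2 a pair of ground states on the two sides of a node. *)
Lemma shooting V B a b (j : R) : a < b -> continuous V -> (forall x, `|V x| <= B) ->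
  j = 1 \/ j = 2 ->
  exists lam Y, [/\ prufer (coef V lam) Y a, Y a = h & Y b = h - 2 * h * j].
Proof.
move=> ab cV VB j12; have B0 : 0 <= B by apply: le_trans (VB 0).
have pi : 0 < (p - 1)^-1 by rewrite invr_gt0; plra.
have /choice[Y YP] : forall lam, exists Y, Y a = h /\ prufer (coef V lam) Y a.
  move=> lam; have [|Y ? ?] := @prufer_exists (coef V lam) (1 + (B + `|lam|) / (p - 1)) a h
     (coef_continuous (lam := lam) cV).
    by move=> x; exact: coef_bound.
  by exists Y.
have Yc : continuous (fun lam => Y lam b).
  move=> lam; pose L := 2 * (p - 1)^-1 *
      expR (((1 + (B + `|lam|) / (p - 1)) * (2 * p) + 1) * (b - a)).
  have YL mu : `|Y lam b - Y mu b| <= L * `|lam - mu|.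
    have [Ya1 P1] := YP lam; have [Ya2 P2] := YP mu.
    apply: le_trans (prufer_lam_continuous (fun x => coef_bound lam x VB) P1 P2
      (d := (p - 1)^-1 * `|lam - mu|) _ (ltW ab) _) _; first by rewrite Ya1.
      move=> x; rewrite (_ : coef V lam x - coef V mu x = - ((p - 1)^-1 * (lam - mu))); last by rewrite /coef; ring.
      by rewrite normrN normrM (gtr0_norm pi).
    by rewrite /L le_eqVlt; apply/orP; left; apply/eqP; ring.
  have L0 : 0 <= L by rewrite !mulr_ge0 ?expR_ge0// ltW.
  apply/cvgrPdist_lt => e e0; rewrite near_simpl.
  exists (e / (L + 1)); first by rewrite /= divr_gt0//; lra.
  move=> mu /=; rewrite ltr_pdivlMr; last by lra.
  move=> lm; apply: le_lt_trans (YL mu) _; apply: le_lt_trans lm.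
  by rewrite mulrC ler_wpM2l//; lra.
(* At this level the coefficient is at least 1, and [Y] stays nonnegative. *)
pose l0 := - B.
have low : h - 2 * h * j <= Y l0 b.
  have [Ya P] := YP l0; apply: le_trans (_ : 0 <= _); first by case: j12 => ->; hlra.
  apply: (prufer_low (fun x => coef_bound l0 x VB) _ P Ya (ltW ab)).
  move=> x; rewrite /coef lerDl mulr_ge0 ?(ltW pi)// /l0 opprK.
  by have := VB x; rewrite ler_norml; lra.
(* Large enough for two stages of length 2 h / k to fit strictly into [a, b]. *)
pose k : R := 1 + 4 * h / (b - a).
have hk : 0 < 4 * h / (b - a) by rewrite divr_gt0//; hlra.
have k1 : 1 <= k by rewrite /k; lra.
have k0 : 0 < k by lra.
pose l1 := B + (p - 1) * k `^ p.
have high : Y l1 b <= h - 2 * h * j.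
  have [Ya P] := YP l1.
  have cC := (fun x => coef_bound l1 x VB).
  have ck x : coef V l1 x <= 1 - k `^ p.
    rewrite /coef lerD2l ler_pdivrMr; last by plra.
    by have := VB x; rewrite ler_norml /l1; lra.
  have hk0 : 0 < 2 * h / k by rewrite divr_gt0//; hlra.
  have s1 : Y l1 (a + 2 * h / k) <= h - 2 * h * 1.
    have := prufer_stage (j := 0) cC P k1 ck (or_introl erefl).
    by rewrite mulr0 subr0 Ya lexx add0r => /(_ isT).
  have P' : prufer (coef V l1) (Y l1) (a + 2 * h / k) by apply: prufer_S P _; lra.
  have s2 : Y l1 (a + 2 * h / k + 2 * h / k) <= h - 2 * h * (1 + 1).
    exact: (prufer_stage (j := 1) cC P' k1 ck (or_intror erefl) s1).
  have ab' : a + 2 * h / k + 2 * h / k < b.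
    have : 4 * h / k < b - a.
      rewrite ltr_pdivrMr// -ltr_pdivrMl ?subr_gt0// [ltLHS]mulrC /k; lra.
    lra.
  have db t y : a <= t -> Y l1 t <= - h -> t < y -> Y l1 y < - h.
    move=> at_ Yt ty; have Pt : prufer (coef V l1) (Y l1) t by exact: prufer_S P _.
    exact: prufer_cross cC Pt bump_Nh Yt ty.
  case: j12 => ->.
    have := db (a + 2 * h / k) b ltac:(lra) ltac:(move: s1; lra) ltac:(lra); lra.
  pose t2 := a + 2 * h / k + 2 * h / k.
  have bm : bump (h - 2 * h * 2) = 0.
    by rewrite /bump !bump0_out ?addr0//; rewrite ler0_norm; hlra.
  have Pt : prufer (coef V l1) (Y l1) t2 by apply: prufer_S P _; rewrite /t2; lra.
  have : Y l1 t2 <= h - 2 * h * 2 by rewrite /t2; lra.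
  by move=> Yt2; apply/ltW/(prufer_cross cC Pt bm Yt2); rewrite /t2.
have l01 : l0 <= l1.
  have kp : 0 <= (p - 1) * k `^ p by rewrite mulr_ge0 ?powR_ge0//; plra.
  by rewrite /l0 /l1; lra.
have [|lam _ e] := @IVT _ (fun lam => Y lam b) l0 l1 (h - 2 * h * j) l01 (continuous_subspaceT Yc).
  by rewrite min_r ?max_l ?low ?high//; apply: le_trans high low.
by exists lam, (Y lam); have [? ?] := YP lam.
Qed.

Theorem ground_exists V B a b : a < b -> continuous V -> (forall x, `|V x| <= B) ->
  exists lam w, ground p a b V lam w.
Proof.
move=> ab cV VB; have [|lam [Y [YP Ya Yb]]] := @shooting V B a b 1 ab cV VB; first by left.
have cC := (fun x => coef_bound lam x VB).
have Yb' : Y b = - h by rewrite Yb; ring.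
have Yin x : a < x < b -> - h < Y x < h.
  move=> /andP[ax xb]; apply/andP; split.
    rewrite ltNge; apply/negP => Yx.
    have Px : prufer (coef V lam) Y x by apply: prufer_S YP (ltW ax).
    by have := prufer_cross cC Px bump_Nh Yx xb; rewrite Yb' ltxx.
  by apply: (prufer_cross cC YP bump_h _ ax); rewrite Ya.
exists lam, (fun x => cangle (Y x)); apply: (prufer_ground ab (c := coef V lam)) => //.
- move=> x xab; rewrite -bump_first; last exact: Yin.
  by apply: YP; case/andP: xab => /ltW.
- exact: prufer_continuous YP (lexx a).
- exact: prufer_continuous YP (ltW ab).
Qed.

Theorem nodal_exists V B a b : a < b -> continuous V -> (forall x, `|V x| <= B) ->
  exists (mu c : R) w1 w2, [/\ a < c < b, ground p a c V mu w1 & ground p c b V mu w2].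
Proof.
move=> ab cV VB; have [|lam [Y [YP Ya Yb]]] := @shooting V B a b 2 ab cV VB; first by right.
have cC := (fun x => coef_bound lam x VB).
have Ycont : {within `[a, b], continuous Y}.
  apply: continuous_in_subspaceT => x; rewrite inE/= in_itv/= => /andP[ax _].
  exact: prufer_continuous YP ax.
(* The node is the point where [Y] passes from the first nodal interval of angles to the second. *)
have [|c] := @IVT _ Y a b (- h) (ltW ab) Ycont.
  by rewrite Ya Yb min_r ?max_l; hlra.
rewrite in_itv/= => /andP[ac cb] Yc.
have ac' : a < c.
  rewrite lt_neqAle ac andbT; apply/eqP => e; move: Yc; rewrite -e Ya; hlra.
have cb' : c < b.
  rewrite lt_neqAle cb andbT; apply/eqP => e; move: Yc; rewrite e Yb; hlra.
have Yin x : a < x < c -> - h < Y x < h.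
  move=> /andP[ax xc]; apply/andP; split.
    rewrite ltNge; apply/negP => Yx.
    have Px : prufer (coef V lam) Y x by apply: prufer_S YP (ltW ax).
    by have := prufer_cross cC Px bump_Nh Yx xc; rewrite Yc ltxx.
  by apply: (prufer_cross cC YP bump_h _ ax); rewrite Ya.
have bm : bump (- 3 * h) = 0.
  by rewrite /bump !bump0_out ?addr0//; rewrite ler0_norm; hlra.
have Pc : prufer (coef V lam) Y c by apply: prufer_S YP ac.
have Yin2 x : c < x < b -> - h < Y x + 2 * h < h.
  move=> /andP[cx xb]; apply/andP; split.
    rewrite -ltrBlDr (_ : - h - 2 * h = - 3 * h); last by ring.
    rewrite ltNge; apply/negP => Yx.
    have Px : prufer (coef V lam) Y x by apply: prufer_S Pc (ltW cx).
    by have := prufer_cross cC Px bm Yx xb; rewrite Yb; hlra.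
  have := prufer_cross cC Pc bump_Nh (_ : Y c <= - h) cx.
  by rewrite Yc lexx => /(_ isT); lra.
exists lam, c, (fun x => cangle (Y x)), (fun x => cangle (Y x + 2 * h)); split.
- by rewrite ac'.
- apply: (prufer_ground ac' (c := coef V lam)) => //.
  + move=> x xab; rewrite -bump_first; last exact: Yin.
    by apply: YP; case/andP: xab => /ltW.
  + exact: prufer_continuous YP (lexx a).
  + exact: prufer_continuous YP ac.
- apply: (prufer_ground cb' (c := coef V lam)) => //.
  + move=> x xcb; rewrite -bump_second; last exact: Yin2.
    have := is_derive_add (YP x _) (is_derive_const (2 * h) x); rewrite addr0; apply.
    by case/andP: xcb => cx _; exact: ltW (lt_trans ac' cx).
  + by apply: cvgD; [exact: prufer_continuous YP ac|exact: cvg_cst].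
  + by apply: cvgD; [exact: prufer_continuous YP (ltW ab)|exact: cvg_cst].
  + by rewrite Yc; ring.
  + by rewrite Yb; ring.
Qed.

End existence.

Lemma is_derive_unique {R : realType} (f : R -> R) (x d1 d2 : R) :
  is_derive x 1 f d1 -> is_derive x 1 f d2 -> d1 = d2.
Proof. by move=> [_ <-] [_ <-]. Qed.

(** * The gap of the Riccati eigenvalues *)

Section comparison.
Context {R : realType}.
Variable p : R.
Hypothesis p1 : 1 < p.
Implicit Types (w V L F : R -> R) (a b c e x y z s t eps lam mu M k m l beta : R).

Local Ltac plra := let H := fresh in pose proof p1 as H; lra.
Local Notation q := (conjugate p).
Local Notation angle := (angle p).
Local Notation H := (angle_speed p).
Local Notation h := (half_period p).
Local Notation riccati := (riccati p).
Local Notation ric := (ric p).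
Local Notation ground := (ground p).
Local Notation subsol := (subsol p).

Let h0 : 0 < h. Proof. exact: half_period_gt0. Qed.
Local Ltac hlra := let H1 := fresh in let H2 := fresh in
  pose proof p1 as H1; pose proof h0 as H2; lra.

Lemma ric_convex s x y : 0 <= s <= 1 ->
  ric (s * x + (1 - s) * y) <= s * ric x + (1 - s) * ric y.
Proof.
move=> s01; rewrite /ric (mulrCA s) (mulrCA (1 - s)) -mulrDr ler_wpM2l//; first by plra.
exact: abspow_convex (conjugate_gt1 p1) s01.
Qed.

Lemma ric_scale k x : 0 < k -> ric (k `^ (p - 1) * x) = k `^ p * ric x.
Proof.
move=> k0; rewrite /ric normrM powRM ?powR_ge0// ?normr_ge0//.
rewrite (ger0_norm (powR_ge0 _ _)) -powRrM (_ : (p - 1) * q = p); first by ring.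
by rewrite /conjugate; field; plra.
Qed.

Lemma ground_ext a b V V' lam w : (forall x, a < x < b -> V x = V' x) ->
  ground a b V lam w -> ground a b V' lam w.
Proof. by move=> VV [dw ? ?]; split => // x xab; rewrite -VV//; exact: dw. Qed.

Lemma ground_subsol a b V lam w : ground a b V lam w ->
  subsol a b (fun x => V x - lam) w.
Proof. by move=> g x xab; have [? ->] := ground_derivable g xab. Qed.

Lemma ground_reflect a b V lam w : ground a b V lam w ->
  ground (- b) (- a) (fun x => V (- x)) lam (fun x => - w (- x)).
Proof.
move=> [dw wy wNy]; split.
- move=> x /andP[bx xa]; rewrite ricN; apply: is_derive_reflect; apply: dw.
  by apply/andP; split; lra.
- move=> M; have [t /andP[at_ tb] tP] := wNy (- M); exists (- t).
    by apply/andP; split; lra.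
  by move=> x /andP[bx xt]; rewrite ltrNr; apply: tP; apply/andP; split; lra.
- move=> M; have [t /andP[at_ tb] tP] := wy (- M); exists (- t).
    by apply/andP; split; lra.
  by move=> x /andP[bx xt]; rewrite ltrNl; apply: tP; apply/andP; split; lra.
Qed.

Lemma subsol_reflect a b F w : subsol a b F w ->
  subsol (- b) (- a) (fun x => F (- x)) (fun x => - w (- x)).
Proof.
move=> sw x /andP[bx xa]; have [|d Nd] := sw (- x); first by apply/andP; split; lra.
by split; [exact: derivable_reflect|rewrite riccati_reflect].
Qed.

Lemma pinfty_restrict w a b c : a < c -> 
  (forall M, exists2 t, a < t < b & forall x, a < x < t -> M < w x) ->
  (forall M, exists2 t, a < t < c & forall x, a < x < t -> M < w x).
Proof.
move=> ac wy M; have [t /andP[at_ tb] tP] := wy M.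
exists (Num.min t ((a + c) / 2)).
  by case: (leP t ((a + c) / 2)) => ?; apply/andP; split; lra.
by move=> x /andP[ax]; rewrite lt_min => /andP[xt _]; apply: tP; rewrite ax.
Qed.

Lemma continuous_le_right (f g : R -> R) x e : x < e ->
  {for x, continuous f} -> {for x, continuous g} ->
  (forall y, x < y < e -> f y <= g y) -> f x <= g x.
Proof.
move=> xe cf cg fg; rewrite -subr_ge0.
have cd : {for x, continuous (fun y => g y - f y)} by exact: cvgB cg cf.
rewrite leNgt; apply/negP => d0.
have nd := @cvgr_lt _ _ _ _ _ _ cd _ d0; have [d /= dp dP] := nd.
pose m : R := Num.min d (e - x).
have m0 : 0 < m by rewrite lt_min dp subr_gt0.
have [m1 m2] : m <= d /\ m <= e - x by rewrite /m !ge_min !lexx !orbT.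
have := dP (x + m / 2); rewrite /= ltr0_norm; last by lra.
by have := fg (x + m / 2) ltac:(apply/andP; split; lra); lra.
Qed.

Lemma continuous_le_left (f g : R -> R) x e : e < x ->
  {for x, continuous f} -> {for x, continuous g} ->
  (forall y, e < y < x -> f y <= g y) -> f x <= g x.
Proof.
move=> ex cf cg fg; rewrite -subr_ge0.
have cd : {for x, continuous (fun y => g y - f y)} by exact: cvgB cg cf.
rewrite leNgt; apply/negP => d0.
have nd := @cvgr_lt _ _ _ _ _ _ cd _ d0; have [d /= dp dP] := nd.
pose m : R := Num.min d (x - e).
have m0 : 0 < m by rewrite lt_min dp subr_gt0.
have [m1 m2] : m <= d /\ m <= x - e by rewrite /m !ge_min !lexx !orbT.
have := dP (x - m / 2); rewrite /= gtr0_norm; last by lra.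
by have := fg (x - m / 2) ltac:(apply/andP; split; lra); lra.
Qed.

Lemma ground_continuous a b V lam w x : ground a b V lam w -> a < x < b ->
  {for x, continuous w}.
Proof. by move=> [dw _ _] /dw; exact: is_derive_continuous. Qed.

(** * Comparison of two ground states *)

Section pair.
Variables (a b B lV lL : R) (V L wV wL : R -> R).
Hypothesis VB : forall x, a < x < b -> `|V x| <= B.
Hypothesis LB : forall x, a < x < b -> `|L x| <= B.
Hypothesis gV : ground a b V lV wV.
Hypothesis gL : ground a b L lL wL.

(** The starting condition is supplied by [wV], which is infinite at [a]. *)
Lemma ground_le_from_left e : e <= b -> (forall x, a < x < e -> L x - lL <= V x - lV) ->
  forall x, a < x < e -> wL x <= wV x.
Proof.
move=> eb LV x xae.
have ae : a < e by case/andP: xae => ? ?; lra.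
apply: (@riccati_compare _ p p1 wV wL a e (B + `|lV|)) => //.
- move=> y yae; have yab : a < y < b by case/andP: yae => -> /lt_le_trans ->.
  have [d1 e1] := ground_derivable gV yab; have [d2 e2] := ground_derivable gL yab.
  split => //; first by rewrite e1 e2 LV.
  by left; rewrite e1; exact: bounded_shift yab.
- apply: (start_pinfty p1); have [_ wy _] := gV.
  exact: (pinfty_restrict ae wy).
Qed.

(** The comparison runs backwards from the finite values at [c]; for this the potentials must be
    ordered the other way round. *)
Lemma ground_le_from_right e c : a <= e -> c < b -> e < c -> wL c <= wV c ->
  (forall x, e < x < c -> V x - lV <= L x - lL) ->
  forall x, e < x < c -> wL x <= wV x.
Proof.
move=> ae cb ec wc LV x xec.
have cab : a < c < b by rewrite cb andbT (le_lt_trans ae ec).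
rewrite -lerN2 -[x]opprK.
apply: (@riccati_compare _ p p1 (fun x => - wL (- x)) (fun x => - wV (- x)) (- c) (- e) (B + `|lV|)) => //.
- move=> y /andP[y1 y2]; have yab : a < - y < b by apply/andP; split; lra.
  have [d1 e1] := ground_derivable gV yab; have [d2 e2] := ground_derivable gL yab.
  split; [exact: derivable_reflect|exact: derivable_reflect|..].
    by rewrite (riccati_reflect p d1) (riccati_reflect p d2) e1 e2 LV//; apply/andP; split; lra.
  by right; rewrite (riccati_reflect p d1) e1; exact: bounded_shift yab.
- apply: (start_finite p1).
  + apply: cvgN; apply: continuous_comp; first exact: opp_continuous.
    by rewrite opprK; exact: ground_continuous gL cab.
  + apply: cvgN; apply: continuous_comp; first exact: opp_continuous.
    by rewrite opprK; exact: ground_continuous gV cab.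
  + by rewrite !opprK lerN2.
- by case/andP: xec => ? ?; apply/andP; split; lra.
Qed.

(* Adding the increment of [Z] over [wL] to [wV] gives a subsolution for [V]: by
   convexity of [ric] the two outer values dominate the two inner ones. *)
Lemma concentrate_left c z Z mu U : a < c <= b -> lL < z ->
  subsol a c (fun x => L x - z) Z -> ground a c V mu U ->
  (forall x, a < x < c -> wL x <= wV x) ->
  lV + z - lL <= mu /\
  (lV + z - lL = mu -> forall x, a < x < c -> wV x = wL x /\ V x - lV = L x - lL).
Proof.
move=> /andP[ac cb] lz sZ gU wLV.
have sub x : a < x < c -> a < x < b by case/andP => -> /lt_le_trans ->.
have ZwL x : a < x < c -> Z x <= wL x.
  move=> xac; apply: (@riccati_compare _ p p1 wL Z a c (B + `|lL|)) => //.
  - move=> y yac; have [d2 e2] := ground_derivable gL (sub y yac).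
    have [d1 e1] := sZ y yac; split => //; first by rewrite e2; lra.
    by left; rewrite e2; exact: bounded_shift (sub y yac).
  - apply: (start_pinfty p1); have [_ wy _] := gL.
    exact: (pinfty_restrict ac wy).
(* A contact point would be a minimum of [wL - Z]; equality of the derivatives there contradicts lL
   < z. *)
have ZwLs x : a < x < c -> Z x < wL x.
  move=> xac; rewrite lt_neqAle ZwL// andbT; apply/eqP => e.
  have dD y : a < y < c -> derivable (fun y => wL y - Z y) y 1.
    move=> yac; have [d2 _] := ground_derivable gL (sub y yac).
    by have [d1 _] := sZ y yac; apply: derivableB.
  have [d2 e2] := ground_derivable gL (sub x xac); have [d1 e1] := sZ x xac.
  have := @derive1_at_min R (fun y => wL y - Z y) a c x (ltW ac).
  rewrite !in_itv/= => /(_ _ xac) D0.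
  have d0 : is_derive x 1 (fun y => wL y - Z y) 0.
    apply: D0 => y; rewrite in_itv/= => yac; first exact: dD.
    by rewrite e subrr subr_ge0 ZwL.
  have := is_derive_sub (riccati_is_derive p d2) (riccati_is_derive p d1).
  by move/(is_derive_unique d0); rewrite e e2; lra.
pose W x := wV x + Z x - wL x.
have WP x : a < x < c -> derivable W x 1 /\
    riccati W x = (V x - lV) + riccati Z x - (L x - lL) -
       (ric (wV x) + ric (Z x) - (ric (wL x) + ric (W x))).
  move=> xac; have [d1 e1] := ground_derivable gV (sub x xac).
  have [d2 e2] := ground_derivable gL (sub x xac); have [d3 _] := sZ x xac.
  have dW := is_derive_sub (is_derive_add (riccati_is_derive p d1) (riccati_is_derive p d3))
    (riccati_is_derive p d2).
  split; first by case: dW.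
  by rewrite (riccatiE p dW) e1 e2 /W; ring.
have four x : a < x < c -> ric (wL x) + ric (W x) <= ric (wV x) + ric (Z x).
  move=> xac; rewrite /ric -!mulrDr ler_wpM2l//; first by plra.
  by apply: abspow_majorize; [exact: conjugate_gt1|exact: ZwL|exact: wLV].
have sW : subsol a c (fun x => V x - (lV + z - lL)) W.
  move=> x xac; have [d ->] := WP x xac; split => //.
  by have [_] := sZ x xac; have := four x xac; lra.
have VB' x : a < x < c -> `|V x| <= B by move=> /sub; exact: VB.
split; first exact: (ground_max p1 ac VB' gU sW).
(* In the equality case [W] is rigid, so the majorization of the four values is an equality; as Z <
   wL strictly, this forces wV = wL. *)
move=> E; rewrite E in sW; have NW := ground_rigid_riccati p1 VB' gU sW.
have weq x : a < x < c -> wV x = wL x.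
  move=> xac; apply/eqP; rewrite eq_le wLV// andbT leNgt; apply/negP => lt.
  have := NW x xac; have [_ ->] := WP x xac; have [_] := sZ x xac.
  have : ric (wL x) + ric (W x) < ric (wV x) + ric (Z x).
    rewrite /ric -!mulrDr ltr_pM2l; last by plra.
    by apply: abspow_majorize_lt => //; [exact: conjugate_gt1|exact: ZwLs].
  by rewrite -E; lra.
move=> x xac; split; first exact: weq.
have [d1 <-] := ground_derivable gV (sub x xac).
have [d2 <-] := ground_derivable gL (sub x xac).
exact: riccati_eq_oo weq xac d2.
Qed.

End pair.

(** Convexity with denominators cleared, on the open interval: affine functions satisfy it with
    equality and can be subtracted by linear arithmetic. *)
Definition conv3 a b V := forall x y z, a < x -> x < y -> y < z -> z < b ->
  (z - x) * V y <= (z - y) * V x + (y - x) * V z.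

Lemma concentrate_right a b B lV lL V L wV wL c z Z mu U :
  (forall x, a < x < b -> `|V x| <= B) -> (forall x, a < x < b -> `|L x| <= B) ->
  ground a b V lV wV -> ground a b L lL wL ->
  a <= c < b -> lL < z ->
  subsol c b (fun x => L x - z) Z -> ground c b V mu U ->
  (forall x, c < x < b -> wV x <= wL x) ->
  lV + z - lL <= mu /\
  (lV + z - lL = mu -> forall x, c < x < b -> wV x = wL x /\ V x - lV = L x - lL).
Proof.
move=> VB LB gV gL /andP[ac cb] lz sZ gU wVL.
have N s t x : - t < x < - s -> s < - x < t by case/andP => ? ?; apply/andP; split; lra.
have cb' : - b < - c <= - a by apply/andP; split; lra.
have [h1 h2] := @concentrate_left (- b) (- a) B lV lL (fun x => V (- x)) (fun x => L (- x))
  (fun x => - wV (- x)) (fun x => - wL (- x)) (fun x xx => VB _ (N _ _ _ xx)) (fun x xx => LB _ (N _ _ _ xx))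
  (ground_reflect gV) (ground_reflect gL) (- c) z (fun x => - Z (- x)) mu (fun x => - U (- x)) cb' lz
  (subsol_reflect sZ) (ground_reflect gU)
  (fun x xx => ltac:(rewrite lerN2; exact: wVL (N _ _ _ xx))).
split => // E x /andP[cx xb]; have [|e1 e2] := h2 E (- x); first by apply/andP; split; lra.
by move: e1 e2; rewrite opprK => /oppr_inj.
Qed.

(** The difference [f] of the shifted potentials is convex. If f c > 0, it is nonnegative on at
    least one side of [c], and there the comparison starts from the Dirichlet end. If f c <= 0, the
    sign of wV c - wL c selects the side; on it [f] is positive at most on a piece touching the end
    of the interval, so each point is reached either from that end or from [c]. *)
Theorem compare_gap a b B lV lL V L wV wL c z Z1 Z2 mu U1 U2 :
  (forall x, a < x < b -> `|V x| <= B) -> (forall x, a < x < b -> `|L x| <= B) ->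
  {for c, continuous V} -> {for c, continuous L} ->
  conv3 a b (fun x => V x - L x) ->
  ground a b V lV wV -> ground a b L lL wL -> a < c < b -> lL < z ->
  subsol a c (fun x => L x - z) Z1 -> subsol c b (fun x => L x - z) Z2 ->
  ground a c V mu U1 -> ground c b V mu U2 ->
  lV + z - lL <= mu /\
  (lV + z - lL = mu -> forall x, a < x < b -> V x - L x = lV - lL).
Proof.
move=> VB LB cV cL cvx gV gL /andP[ac cb] lz sZ1 sZ2 gU1 gU2.
pose f x := V x - L x - (lV - lL).
have cab : a < c < b by rewrite ac.
have f3 x y t : a < x -> x < y -> y < t -> t < b -> (t - x) * f y <= (t - y) * f x + (y - x) * f t.
  by move=> ax xy yt tb; have := cvx x y t ax xy yt tb; rewrite /f; lra.
have left : (forall x, a < x < c -> wL x <= wV x) ->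
  lV + z - lL <= mu /\
  (lV + z - lL = mu -> forall x, a < x < c -> wV x = wL x /\ V x - lV = L x - lL).
  have ac' : a < c <= b by rewrite ac ltW.
  exact: (concentrate_left VB LB gV gL ac' lz sZ1 gU1).
have right : (forall x, c < x < b -> wV x <= wL x) ->
  lV + z - lL <= mu /\
  (lV + z - lL = mu -> forall x, c < x < b -> wV x = wL x /\ V x - lV = L x - lL).
  have cb' : a <= c < b by rewrite cb ltW.
  exact: (concentrate_right VB LB gV gL cb' lz sZ2 gU2).
have fc : {for c, continuous f}.
  by apply: cvgB; [exact: cvgB cV cL|exact: cvg_cst].
have c0 : {for c, continuous (fun=> 0 : R)} by exact: cvg_cst.
have cwV := ground_continuous gV cab; have cwL := ground_continuous gL cab.
have [qc|qc] := ltP 0 (f c).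
  have [[x1 /andP[ax1 x1c] fx1]|nx1] := pselect (exists2 x1, a < x1 < c & f x1 < 0).
  - have fp x : c < x < b -> 0 <= f x.
      move=> /andP[cx xb]; have := f3 x1 c x ax1 x1c cx xb.
      have h1 : 0 < (x - x1) * f c by rewrite mulr_gt0// subr_gt0 (lt_trans x1c cx).
      have h2 : (x - c) * f x1 <= 0 by rewrite mulr_ge0_le0 ?subr_ge0 ?(ltW cx) ?(ltW fx1).
      by move=> h3; rewrite -(pmulr_rge0 _ (_ : 0 < c - x1)) ?subr_gt0//; lra.
    have [|h1 h2] := right.
      move=> x /andP[cx xb]; rewrite -lerN2 -[x]opprK.
      apply: (@ground_le_from_left (- b) (- a) B lV lL (fun x => V (- x)) (fun x => L (- x))
        (fun x => - wV (- x)) (fun x => - wL (- x)) _ (ground_reflect gV) (ground_reflect gL) (- c)).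
      + by move=> y /andP[? ?]; apply: VB; apply/andP; split; lra.
      + by lra.
      + by move=> y /andP[? ?]; have := fp (- y) ltac:(apply/andP; split; lra); rewrite /f; lra.
      + by apply/andP; split; lra.
    (* Equality would make [f] vanish on the whole side, hence f c <= 0 by continuity. *)
    split => // E; exfalso.
    have : f c <= 0.
      apply: (continuous_le_right cb fc c0) => x xcb.
      by have [_] := h2 E x xcb; rewrite /f; lra.
    by lra.
  - have fp x : a < x < c -> 0 <= f x.
      by move=> xac; rewrite leNgt; apply/negP => fx; apply: nx1; exists x.
    have [|h1 h2] := left.
      apply: (ground_le_from_left VB gV gL (ltW cb)).
      by move=> x /fp; rewrite /f; lra.
    split => // E; exfalso.
    have : f c <= 0.
      apply: (continuous_le_left ac fc c0) => x xcb.
      by have [_] := h2 E x xcb; rewrite /f; lra.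
    by lra.
have leftP : wL c <= wV c -> forall x, a < x < c -> wL x <= wV x.
  move=> wc x /andP[ax xc]; have xab : a < x < b by rewrite ax (lt_trans xc cb).
  (* By convexity and f c <= 0: if f x > 0 then [f] is nonnegative from [a] to [x], otherwise it is
     nonpositive from [x] to [c]. *)
  have [fx|fx] := ltP 0 (f x).
  - apply: (continuous_le_left ax (ground_continuous gL xab) (ground_continuous gV xab)).
    apply: (ground_le_from_left VB gV gL (ltW (lt_trans xc cb))).
    move=> y /andP[ay yx]; suff : 0 <= f y by rewrite /f; lra.
    have := f3 y x c ay yx xc cb.
    have h1 : 0 < (c - y) * f x by rewrite mulr_gt0// subr_gt0 (lt_trans yx xc).
    have h2 : (x - y) * f c <= 0 by rewrite mulr_ge0_le0 ?subr_ge0 ?(ltW yx).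
    by move=> h3; rewrite -(pmulr_rge0 _ (_ : 0 < c - x)) ?subr_gt0//; lra.
  - apply: (continuous_le_right xc (ground_continuous gL xab) (ground_continuous gV xab)).
    apply: (ground_le_from_right VB gV gL (ltW ax) cb xc wc).
    move=> y /andP[xy yc]; suff : f y <= 0 by rewrite /f; lra.
    have := f3 x y c ax xy yc cb.
    have h1 : (c - y) * f x <= 0 by rewrite mulr_ge0_le0 ?subr_ge0 ?(ltW yc).
    have h2 : (y - x) * f c <= 0 by rewrite mulr_ge0_le0 ?subr_ge0 ?(ltW xy).
    by move=> h3; rewrite -(pmulr_rle0 _ (_ : 0 < c - x)) ?subr_gt0//; lra.
have rightP : wV c <= wL c -> forall x, c < x < b -> wV x <= wL x.
  move=> wc x /andP[cx xb]; have xab : a < x < b by rewrite xb (lt_trans ac cx).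
  have VB' y : - b < y < - a -> `|V (- y)| <= B.
    by move=> /andP[? ?]; apply: VB; apply/andP; split; lra.
  have [fx|fx] := ltP 0 (f x).
  - apply: (continuous_le_right xb (ground_continuous gV xab) (ground_continuous gL xab)).
    move=> y /andP[xy yb]; rewrite -lerN2 -[y]opprK.
    apply: (@ground_le_from_left (- b) (- a) B lV lL (fun x => V (- x)) (fun x => L (- x))
        (fun x => - wV (- x)) (fun x => - wL (- x)) VB' (ground_reflect gV) (ground_reflect gL) (- x)).
    + by lra.
    + move=> u /andP[u1 u2]; have yu : x < - u by lra.
      suff : 0 <= f (- u) by rewrite /f; lra.
      have := f3 c x (- u) ac cx yu ltac:(lra).
      have h1 : 0 < (- u - c) * f x by rewrite mulr_gt0// subr_gt0 (lt_trans cx yu).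
      have h2 : (- u - x) * f c <= 0 by rewrite mulr_ge0_le0 ?subr_ge0 ?(ltW yu).
      by move=> h3; rewrite -(pmulr_rge0 _ (_ : 0 < x - c)) ?subr_gt0//; lra.
    + by apply/andP; split; lra.
  - apply: (continuous_le_left cx (ground_continuous gV xab) (ground_continuous gL xab)).
    move=> y /andP[cy yx]; rewrite -lerN2 -[y]opprK.
    apply: (@ground_le_from_right (- b) (- a) B lV lL (fun x => V (- x)) (fun x => L (- x))
        (fun x => - wV (- x)) (fun x => - wL (- x)) VB' (ground_reflect gV) (ground_reflect gL) (- x) (- c)).
    + by lra.
    + by lra.
    + by lra.
    + by rewrite !opprK lerN2.
    + move=> u /andP[u1 u2]; have cu : c < - u by lra. have ux : - u < x by lra.
      suff : f (- u) <= 0 by rewrite /f; lra.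
      have := f3 c (- u) x ac cu ux xb.
      have h1 : (- u - c) * f x <= 0 by rewrite mulr_ge0_le0 ?subr_ge0 ?(ltW cu).
      have h2 : (x - - u) * f c <= 0 by rewrite mulr_ge0_le0 ?subr_ge0 ?(ltW ux).
      by move=> h3; rewrite -(pmulr_rle0 _ (_ : 0 < x - c)) ?subr_gt0//; lra.
    + by apply/andP; split; lra.
(* Equality on one side gives wV c = wL c by continuity; the argument then applies to both sides. *)
have fin : (lV + z - lL = mu) -> wV c = wL c ->
    forall x, a < x < b -> V x - L x = lV - lL.
  move=> E wc; have [|_ /(_ E) hl] := left; first by apply: leftP; rewrite wc.
  have [|_ /(_ E) hr] := right; first by apply: rightP; rewrite wc.
  move=> x /andP[ax xb]; have [xc|xc|->] := ltgtP x c.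
  - by have [|_] := hl x; [rewrite ax|lra].
  - by have [|_] := hr x; [rewrite xc|lra].
  have f1 : f c <= 0.
    apply: (continuous_le_left ac fc c0) => y yac.
    by have [_] := hl y yac; rewrite /f; lra.
  have f2 : 0 <= f c.
    apply: (continuous_le_left ac c0 fc) => y yac.
    by have [_] := hl y yac; rewrite /f; lra.
  by move: f1 f2; rewrite /f; lra.
have [wc|/ltW wc] := leP (wL c) (wV c).
- have [|h1 h2] := left; first exact: leftP.
  split => // E; apply: fin => //; apply/eqP; rewrite eq_le wc andbT.
  by apply: (continuous_le_left ac cwV cwL) => x xac; have [-> _] := h2 E x xac.
- have [|h1 h2] := right; first exact: rightP.
  split => // E; apply: fin => //; apply/eqP; rewrite eq_le wc/=.
  by apply: (continuous_le_right cb cwL cwV) => x xac; have [-> _] := h2 E x xac.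
Qed.

Lemma subsol_convex a b F1 F2 w1 w2 s : 0 <= s <= 1 -> subsol a b F1 w1 -> subsol a b F2 w2 ->
  subsol a b (fun x => s * F1 x + (1 - s) * F2 x) (fun x => s * w1 x + (1 - s) * w2 x).
Proof.
move=> s01 h1 h2 x xab; have [d1 e1] := h1 x xab; have [d2 e2] := h2 x xab.
have d := is_derive_add (is_derive_scale s (riccati_is_derive p d1))
  (is_derive_scale (1 - s) (riccati_is_derive p d2)).
split; first by case: d.
have [s0 s1] := andP s01; have s2 : 0 <= 1 - s by lra.
rewrite (riccatiE p d); have := ric_convex (w1 x) (w2 x) s01.
by have := ler_wpM2l s0 e1; have := ler_wpM2l s2 e2; lra.
Qed.

Lemma subsol_rescale a b F w k m : 0 < k -> subsol a b F w ->
  forall c e, (forall x, c < x < e -> a < k * x + m < b) ->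
  subsol c e (fun x => k `^ p * F (k * x + m)) (fun x => k `^ (p - 1) * w (k * x + m)).
Proof.
move=> k0 sw c e ce x xce; have [d N] := sw _ (ce x xce).
have dd := is_derive_scale (k `^ (p - 1)) (is_derive_affine_comp (riccati_is_derive p d)).
split; first by case: dd.
rewrite (riccatiE p dd) ric_scale// mulrA [k `^ (p - 1) * k]mulrC mulr_powRB1 ?(ltW k0)//; last by plra.
by rewrite -mulrDr subrK ler_wpM2l// powR_ge0.
Qed.

Lemma subsol_le a b F F' w : (forall x, a < x < b -> F x <= F' x) ->
  subsol a b F w -> subsol a b F' w.
Proof. by move=> FF sw x xab; have [d N] := sw x xab; split => //; exact: le_trans N (FF x xab). Qed.

(** * Subsolutions for linear potentials *)

Section linear.
Variables (D beta lL : R) (wL : R -> R).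
Hypothesis D0 : 0 < D.
Let a := - (D / 2).
Let b := D / 2.
Let k : R := 2 * h / D.
Let kap : R := (p - 1) * k `^ p.
Hypothesis gL : ground a b (fun x => beta * x) lL wL.

Let k0 : 0 < k. Proof. by rewrite divr_gt0// mulr_gt0// h0. Qed.

Let bE : b = a + 2 * h / k.
Proof.
have := h0; have := D0 => D1 h1; rewrite /b /a /k; field.
by rewrite !gt_eqF.
Qed.

Let gM : ground a b (fun=> 0) kap (model p k a).
Proof. by rewrite bE; exact: model_ground. Qed.

Let ab : a < b. Proof. by have := D0 => D1; rewrite /a /b; lra. Qed.

(** As the potential is odd, averaging [wL] with its reflection gives a subsolution for the zero
    potential at the level [lL], to be compared with the model of level [kap]. *)
Lemma linear_ground_le : lL <= kap.
Proof.
have s1 := ground_subsol gL; have s2 := subsol_reflect s1.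
have bN : - b = a by []. have aN : - a = b by rewrite /a opprK.
rewrite bN aN in s2.
have s3 := subsol_convex (s := 1 / 2) ltac:(apply/andP; split; lra) s1 s2.
apply: (ground_max p1 ab _ gM (B := 0)) => [x _|]; first by rewrite normr0.
apply: subsol_le s3 => x _; lra.
Qed.

Lemma linear_subsol m l : 0 < l <= D -> exists Z, subsol (m - l / 2) (m + l / 2)
  (fun x => beta * x - (lL + beta * m + kap * (D / l) `^ p - kap)) Z.
Proof.
move=> /andP[l0 lD]; pose r := D / l.
have r0 : 0 < r by rewrite divr_gt0.
have r1 : 1 <= r by rewrite ler_pdivlMr// mul1r.
(* Rescaling by [r] multiplies the slope of a linear potential by r^(p+1); the weight [s] of the
   average restores the slope [beta]. The slack left at the end is (1 - 1/r) (kap - lL) >= 0. *)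
pose s := (r `^ (p + 1))^-1.
have rp0 : 0 < r `^ p by exact: powR_gt0.
have rp1 : r `^ (p + 1) = r `^ p * r.
  by rewrite powRD ?powRr1 ?(ltW r0)// (gt_eqF r0) implybT.
have s01 : 0 <= s <= 1.
  rewrite invr_ge0 powR_ge0/= invf_le1 ?powR_gt0//.
  by have := @ler_powR _ _ r1 0 (p + 1); rewrite powRr0; apply; plra.
have sw := subsol_convex s01 (ground_subsol gL) (ground_subsol gM).
have sub x : m - l / 2 < x < m + l / 2 -> a < r * x + - (r * m) < b.
  move=> /andP[x1 x2]; have : - (l / 2) < x - m < l / 2 by apply/andP; split; lra.
  rewrite -mulrBr /a /b => /andP[h1 h2].
  have E : D / 2 = r * (l / 2) by rewrite /r mulrA divfK// gt_eqF.
  by rewrite E -mulrN !ltr_pM2l// h1.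
exists (fun x => r `^ (p - 1) * (s * wL (r * x + - (r * m)) + (1 - s) * model p k a (r * x + - (r * m)))).
apply: subsol_le (subsol_rescale r0 sw sub) => x _.
have rs : r `^ p * s = r^-1.
  by rewrite /s rp1 invfM mulrA divff ?mul1r// gt_eqF.
have -> : r `^ p * (s * (beta * (r * x + - (r * m)) - lL) + (1 - s) * (0 - kap)) =
   (r `^ p * s) * (r * (beta * (x - m)) - lL) + (r `^ p - r `^ p * s) * (0 - kap) by ring.
rewrite rs mulrBr mulKf ?gt_eqF//.
have ri : 0 <= 1 - r^-1 by rewrite subr_ge0 invf_le1.
have := mulr_ge0 ri (_ : 0 <= kap - lL); rewrite subr_ge0 linear_ground_le => /(_ isT).
by rewrite -/r; move: (r `^ p) (r^-1) => A1 A2; nra.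
Qed.

End linear.

(** The hypothesis says r1 + r2 = r1 r2, whence r1 r2 >= 4. By the arithmetic-geometric inequality
    the square of the sum of the powers is at least 4 (r1 r2)^(p-1) >= 4^p, with equality only if
    the two powers agree. *)
Lemma powR_sum_ge r1 r2 : 0 < r1 -> 0 < r2 -> r1^-1 + r2^-1 = 1 ->
  2 `^ p <= r1 `^ (p - 1) + r2 `^ (p - 1) /\
  (2 `^ p = r1 `^ (p - 1) + r2 `^ (p - 1) -> r1 = r2).
Proof.
move=> r10 r20 r12; have q0 : 0 < p - 1 by plra.
have e : r1 + r2 = r1 * r2.
  have : (r1^-1 + r2^-1) * (r1 * r2) = 1 * (r1 * r2) by rewrite r12.
  by rewrite mul1r => <-; field; rewrite !gt_eqF.
have P4 : 4 <= r1 * r2.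
  have h1 : 0 < r1 * r2 by exact: mulr_gt0.
  have : 4 * (r1 * r2) <= (r1 * r2) * (r1 * r2).
    by rewrite -{2 3}e; have := sqr_ge0 (r1 - r2); rewrite expr2; lra.
  by rewrite ler_pM2r.
set x := r1 `^ (p - 1); set y := r2 `^ (p - 1).
have x0 : 0 < x by exact: powR_gt0. have y0 : 0 < y by exact: powR_gt0.
have t0 : 0 < (2 : R) `^ p by exact: powR_gt0.
have tt : 2 `^ p * 2 `^ p = 4 * 4 `^ (p - 1) :> R.
  have -> : (4 : R) = 2 * 2 by ring.
  rewrite powRM//; have := @mulr_powRB1 R 2 p ltac:(lra) ltac:(plra) => <-; ring.
have xyE : x * y = (r1 * r2) `^ (p - 1) by rewrite powRM// ltW.
have xy4 : 4 `^ (p - 1) <= x * y.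
  by rewrite xyE ge0_ler_powR ?nnegrE ?(ltW q0)// ltW// mulr_gt0.
have sq := sqr_ge0 (x - y); rewrite expr2 in sq.
split.
  rewrite leNgt; apply/negP => lt.
  have : (x + y) * (x + y) < 2 `^ p * 2 `^ p by apply: ltr_pM => //; lra.
  by rewrite tt; lra.
move=> E; have : (x + y) * (x + y) = 4 * 4 `^ (p - 1) by rewrite -tt E.
move=> E2; have : (x - y) * (x - y) <= 0 by lra.
move=> h1; have /eqP : (x - y) * (x - y) = 0 by apply/eqP; rewrite eq_le h1.
rewrite mulf_eq0 orbb subr_eq0 => /eqP xy.
by apply: (@powR_injective _ (p - 1) q0) => //; rewrite nnegrE ltW.
Qed.

Theorem ode_gap V B D : 0 < D -> continuous V -> (forall x, `|V x| <= B) ->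
  conv3 (- (D / 2)) (D / 2) V ->
  exists (lam mu c : R) w w1 w2,
    [/\ ground (- (D / 2)) (D / 2) V lam w, - (D / 2) < c < D / 2,
        ground (- (D / 2)) c V mu w1 & ground c (D / 2) V mu w2] /\
    (lam + gap_bound p D <= mu /\
     (mu = lam + gap_bound p D -> exists k, forall x, - (D / 2) < x < D / 2 -> V x = k)).
Proof.
move=> D0 cV VB cvx; set a := - (D / 2); set b := D / 2.
have ab : a < b by rewrite /a /b; lra.
have [lV [wV gV]] := ground_exists p1 ab cV VB.
have [mu [c [U1 [U2 [cab gU1 gU2]]]]] := nodal_exists p1 ab cV VB.
have /andP[ac cb] := cab.
pose k : R := 2 * h / D.
have k0 : 0 < k by rewrite divr_gt0// mulr_gt0// h0.
pose kap : R := (p - 1) * k `^ p.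
have kap0 : 0 < kap by rewrite mulr_gt0 ?powR_gt0//; plra.
pose l1 := c - a; pose l2 := b - c.
have l12 : l1 + l2 = D by rewrite /l1 /l2 /a /b; field.
have l10 : 0 < l1 by rewrite subr_gt0. have l20 : 0 < l2 by rewrite subr_gt0.
pose m1 := a + l1 / 2; pose m2 := b - l2 / 2.
pose r1 := D / l1; pose r2 := D / l2.
have r10 : 0 < r1 by rewrite divr_gt0. have r20 : 0 < r2 by rewrite divr_gt0.
(* The midpoints of the two halves differ by D / 2 whatever [c] is; this slope therefore makes the
   two levels equal. *)
pose beta := 2 * kap / D * (r1 `^ p - r2 `^ p).
pose L x := beta * clamp a b x.
have cL : continuous L.
  by move=> x; apply: cvgM; [exact: cvg_cst|exact: clamp_continuous].
have LB x : `|L x| <= `|beta| * (D / 2).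
  rewrite normrM ler_wpM2l// ler_norml; have := clamp_itv x (ltW ab).
  by rewrite /a /b.
have LE x : a < x < b -> L x = beta * x.
  by move=> /andP[ax xb]; rewrite /L clamp_id// !ltW.
have [lL [wL gL]] := ground_exists p1 ab cL LB.
have gL' := ground_ext LE gL.
pose z := lL + beta * m1 + kap * r1 `^ p - kap.
have zE : z = lL + beta * m2 + kap * r2 `^ p - kap.
  rewrite /z; have -> : m1 = m2 - D / 2 by rewrite /m1 /m2 /l1 /l2 /a /b; field.
  have : beta * (D / 2) = kap * (r1 `^ p - r2 `^ p) by rewrite /beta; field; rewrite gt_eqF.
  by rewrite mulrBr; lra.
have rr : r1^-1 + r2^-1 = 1 by rewrite /r1 /r2 !invf_div -mulrDl l12 divff// gt_eqF.
have [S1 S2] := powR_sum_ge r10 r20 rr.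
have zl : z - lL = kap * (r1 `^ (p - 1) + r2 `^ (p - 1) - 1).
  (* Averaging the two expressions of [z] with the lengths as weights eliminates [beta], because l1
     m1 + l2 m2 is the integral of x over the symmetric interval. *)
  have E1 : l1 / D * (z - lL) + l2 / D * (z - lL) = z - lL.
    by rewrite -mulrDl -mulrDl l12 divff ?mul1r// gt_eqF.
  rewrite -E1 {2}zE /z.
  have P1 : r1 `^ p = r1 * r1 `^ (p - 1) by rewrite mulr_powRB1 ?(ltW r10)//; plra.
  have P2 : r2 `^ p = r2 * r2 `^ (p - 1) by rewrite mulr_powRB1 ?(ltW r20)//; plra.
  rewrite P1 P2 /beta /m1 /m2 /r1 /r2 /a /b.
  move: (_ `^ _) (_ `^ _) (_ `^ p - _) => A1 A2 A3.
  have -> : l2 = D - l1 by lra.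
  by field; rewrite !gt_eqF//=; lra.
have gapE : gap_bound p D = kap * (2 `^ p - 1).
  rewrite /gap_bound /kap /k; have -> : 2 * h = pi_p p by rewrite /half_period mulrC divfK.
  by ring.
have two1 : 1 < 2 `^ p :> R by apply: powR_gt1; plra.
have lz : lL < z.
  have : 0 < z - lL by rewrite zl mulr_gt0//; lra.
  by lra.
have l1D : 0 < l1 <= D by apply/andP; split; lra.
have l2D : 0 < l2 <= D by apply/andP; split; lra.
have [Z1 sZ1] := linear_subsol D0 gL' m1 l1D.
have [Z2 sZ2] := linear_subsol D0 gL' m2 l2D.
have I1 : m1 - l1 / 2 = a by rewrite /m1; ring.
have I2 : m1 + l1 / 2 = c by rewrite /m1 /l1; field.
have I3 : m2 - l2 / 2 = c by rewrite /m2 /l2; field.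
have I4 : m2 + l2 / 2 = b by rewrite /m2; ring.
rewrite I1 I2 in sZ1; rewrite I3 I4 in sZ2.
have sZ1' : subsol a c (fun x => L x - z) Z1.
  apply: subsol_le sZ1 => x /andP[ax xc]; by rewrite LE ?ax ?(lt_trans xc cb).
have sZ2' : subsol c b (fun x => L x - z) Z2.
  apply: subsol_le sZ2 => x /andP[cx xb]; rewrite LE ?xb ?(lt_trans ac cx)//.
  by rewrite [X in _ <= _ - X]zE.
pose B' : R := Num.max B (`|beta| * (D / 2)).
have VB' x : a < x < b -> `|V x| <= B' by move=> _; rewrite le_max VB.
have LB' x : a < x < b -> `|L x| <= B' by move=> _; rewrite le_max LB orbT.
have cvx' : conv3 a b (fun x => V x - L x).
  move=> x y t ax xy yt tb; have := cvx x y t ax xy yt tb.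
  have xab : a < x < b by rewrite ax (lt_trans xy (lt_trans yt tb)).
  have yab : a < y < b by rewrite (lt_trans ax xy) (lt_trans yt tb).
  have tab : a < t < b by rewrite tb (lt_trans ax (lt_trans xy yt)).
  by rewrite (LE x xab) (LE y yab) (LE t tab); lra.
have [G1 G2] := compare_gap VB' LB' (cV c) (cL c) cvx' gV gL cab lz sZ1' sZ2' gU1 gU2.
exists lV, mu, c, wV, U1, U2; split; first by split.
have S3 : gap_bound p D <= z - lL by rewrite gapE zl ler_pM2l//; lra.
split; first by lra.
move=> E; have zg : z - lL = gap_bound p D by apply/eqP; rewrite eq_le S3 andbT; lra.
have r12 : r1 = r2.
  by apply: S2; move: zg; rewrite gapE zl => /(mulfI (lt0r_neq0 kap0)); lra.
have b0 : beta = 0 by rewrite /beta r12 subrr mulr0.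
exists (lV - lL) => x xab; have := G2 ltac:(lra) x xab.
by rewrite LE// b0 mul0r subr0.
Qed.

End comparison.

Lemma lipschitz_functional_continuous {R : realType} (X : normedModType R) (L : X -> R) (K : R) :
  0 < K -> (forall x y, `|L x - L y| <= K * `|x - y|) -> continuous L.
Proof.
move=> K0 LK x; apply/cvgrPdist_lt => e e0; apply/nbhs_ballP.
exists (e / K); first by rewrite /= divr_gt0.
move=> y; rewrite -ball_normE/= => xy.
by apply: le_lt_trans (LK _ _) _; rewrite mulrC -ltr_pdivlMr.
Qed.

#[local] Instance ae_lebesgue_itvD_filter {R : realType} (D : R) :
  Filter (nbhs (almost_everywhere (lebesgue_itvD D))).
Proof. exact: (ae_filter_ringOfSetsType (lebesgue_itvD D)). Qed.

(** * Lower bounds for the variational eigenvalues *)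

Section measure.
Context {R : realType}.
Variables (p : R) (p1 : 1 < p) (D : R) (D0 : 0 < D).
Local Ltac plra := let H := fresh in let H2 := fresh in pose proof p1 as H; pose proof D0 as H2; lra.
Local Notation leb := (@lebesgue_measure R).
Local Notation mu := (lebesgue_itvD D).
Local Notation Lp := (LspaceType mu (EFin_le1 p1)).
Local Notation a := (- (D / 2)).
Local Notation b := (D / 2).

Lemma itvD_measureE (A : set (measurableTypeR R)) : mu A = leb (A `&` itvD D).
Proof. by []. Qed.

Lemma itvD_integral (J : set (measurableTypeR R)) (f : measurableTypeR R -> \bar R) :
  measurable J -> measurable_fun setT f ->
  (\int[mu]_(x in J) f x = \int[leb]_(x in J `&` itvD D) f x)%E.
Proof.
move=> mJ mf.
have mI : measurable (itvD D : set (measurableTypeR R)) by exact: measurable_itv.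
have mJI : measurable (J `&` itvD D) by exact: measurableI.
rewrite (@eq_measure_integral _ _ _ (J `&` itvD D) mu leb f); last first.
  by move=> A mA AJ; rewrite itvD_measureE setIidl// => x /AJ [].
rewrite (integral_mkcond J) (integral_mkcond (J `&` itvD D)).
apply: ae_eq_integral => //.
- by apply/(measurable_restrictT _ mJ)/measurable_funTS.
- by apply/(measurable_restrictT _ mJI)/measurable_funTS.
- exists (~` itvD D); split.
  + exact: measurableC.
  + by rewrite itvD_measureE setICl measure0.
  + move=> x /= xP xI; apply: xP => _; rewrite /patch.
    have -> // : (x \in J `&` itvD D) = (x \in J).
    by apply/idP/idP; rewrite !inE => // -[].
Qed.

Lemma itvD_integralT (f : measurableTypeR R -> \bar R) : measurable_fun setT f ->
  (\int[mu]_x f x = \int[leb]_(x in itvD D) f x)%E.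
Proof. by move=> mf; rewrite itvD_integral// setTI. Qed.

Lemma itvD_measureT : mu setT = D%:E.
Proof.
rewrite itvD_measureE setTI lebesgue_measure_itv/= lte_fin.
rewrite ifT; last by plra.
by rewrite -EFinD; congr EFin; plra.
Qed.

Lemma itvD_fin : mu setT \is a fin_num. Proof. by rewrite itvD_measureT. Qed.

Lemma Lspace_measurable (f : Lp) : measurable_fun setT (f : R -> R).
Proof. by have := Lspace_Lfun f; rewrite inE => /andP[]; rewrite inE. Qed.

Lemma Lspace_powR_integrable (f : Lp) : mu.-integrable setT (fun x => (`|f x| `^ p)%:E).
Proof. by apply: Lfun_integrable; [exact: EFin_le1|exact: Lspace_Lfun]. Qed.

Lemma Lspace_normP (f : Lp) : (\int[mu]_x (`|f x| `^ p)%:E)%E = (`|f| `^ p)%:E.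
Proof.
have p0 : p != 0 by rewrite gt_eqF//; plra.
have := @powR_Lnorm _ _ _ mu (EFin \o f) p p0 => <-.
rewrite Lspace_normE.
have f0 : ('N[mu]_p%:E[EFin \o f] < +oo)%E by exact: Lebesgue_finite.
have f1 : ('N[mu]_p%:E[EFin \o f])%E \is a fin_num by rewrite ge0_fin_numE ?Lnorm_ge0.
by rewrite -[in LHS](fineK f1) poweR_EFin.
Qed.

Lemma Lspace_integrable (f : Lp) : mu.-integrable setT (EFin \o (f : R -> R)).
Proof.
apply/Lfun1_integrable.
by apply: (Lfun_subset (lexx _) (EFin_le1 p1) itvD_fin (EFin_le1 p1)); exact: Lspace_Lfun.
Qed.

Implicit Types (phi V f F : R -> R) (x s t c lam : R).

Lemma supp_integral (E : set (measurableTypeR R)) (f F : R -> R) (s c : R) : s <= c ->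
  (forall x, is_derive x 1 F (f x)) -> continuous f -> `[s, c] `<=` E ->
  (forall x, E x -> ~ (s <= x <= c) -> f x = 0) ->
  (\int[leb]_(x in E) (f x)%:E = (F c - F s)%:E)%E.
Proof.
move=> sc dF cf sE f0.
rewrite -(@is_derive_FTC2 _ F f s c sc)//; last first.
  by apply: continuous_subspaceT.
rewrite (integral_mkcond E) (integral_mkcond (`[s, c]%classic : set (measurableTypeR R))).
apply: eq_integral => x _; rewrite /patch.
have [xE|xE] := pselect (E x); have [xs|xs] := pselect (`[s, c]%classic x).
- by rewrite !mem_set.
- by rewrite mem_set// memNset//= f0// => xsc; apply: xs; rewrite /= in_itv.
- by case: xE; exact: sE.
- by rewrite !memNset.
Qed.

Lemma segment_sub_itvD s t : a < s -> t < b -> `[s, t] `<=` itvD D.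
Proof.
move=> as_ tb x /=; rewrite /itvD/= !in_itv/= => /andP[sx xt].
by rewrite (lt_le_trans as_ sx) (le_lt_trans xt tb).
Qed.

Lemma compact_itv (K : set R) (c : R) : compact K -> K `<=` itvD D -> a < c < b ->
  exists s t, [/\ a < s, s < c, c < t, t < b & K `<=` `[s, t]].
Proof.
move=> cK KI /andP[ac cb]; have [->|K0] := eqVneq K set0.
  by exists ((a + c) / 2), ((b + c) / 2); split => //; lra.
have {K0} K0 : K !=set0 by apply/set0P.
have ci : {within K, continuous (fun x : R => x)} by apply: continuous_subspaceT => ?.
have [m /set_mem mK mP] := compact_EVT_min K0 cK ci.
have [M /set_mem MK MP] := compact_EVT_max K0 cK ci.
have := KI _ mK; have := KI _ MK; rewrite /itvD/= !in_itv/= => /andP[M1 M2] /andP[m1 m2].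
exists (Num.min m ((a + c) / 2)), (Num.max M ((b + c) / 2)); split.
- by rewrite lt_min m1; lra.
- by rewrite gt_min; apply/orP; right; lra.
- by rewrite lt_max; apply/orP; right; lra.
- by rewrite gt_max M2; lra.
- move=> x xK; rewrite /= in_itv/= ge_min le_max.
  by have /= -> := mP x (mem_set xK); have /= -> := MP x (mem_set xK).
Qed.

Lemma test_function_is_derive phi x : test_function D phi ->
  is_derive x 1 phi ((phi^`())%classic x).
Proof.
by move=> [dphi _]; apply: DeriveDef; [exact: (dphi 0%N x)|rewrite derive1E].
Qed.

Lemma test_function_derive_continuous phi : test_function D phi ->
  continuous (phi^`())%classic.
Proof.
move=> [dphi _] x; apply/differentiable_continuous/derivable1_diffP.
exact: (dphi 1%N x).
Qed.

Lemma test_function_continuous phi : test_function D phi -> continuous phi.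
Proof. by move=> tphi x; exact: is_derive_continuous (test_function_is_derive x tphi). Qed.

Lemma test_function_supp phi c : test_function D phi -> a < c < b ->
  exists s t, [/\ a < s, s < c, c < t, t < b &
    forall x, ~ (s < x < t) -> phi x = 0 /\ (phi^`())%classic x = 0].
Proof.
move=> tphi cab; have [_ [K [cK KI phi0]]] := tphi.
have [s [t [as_ sc ct tb Kst]]] := compact_itv cK KI cab.
exists ((a + s) / 2), ((t + b) / 2); split; [lra|lra|lra|lra|move=> x xst'].
have xst : ~ (s <= x <= t) by move=> /andP[? ?]; apply: xst'; apply/andP; split; lra.
have phi0' y : ~ (s <= y <= t) -> phi y = 0.
  by move=> yst; apply: phi0 => /Kst /=; rewrite in_itv.
split; first exact: phi0'.
apply: is_derive_unique (test_function_is_derive x tphi) _.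
apply: (@is_derive_ext _ (fun=> 0) phi x 0).
have [xs|sx] := ltP x s.
  near=> y; rewrite phi0'// => /andP[sy _].
  have : y < s by near: y; exact: lt_nbhsl.
  by rewrite ltNge sy.
have tx : t < x by rewrite ltNge; apply/negP => xt; apply: xst; rewrite sx xt.
near=> y; rewrite phi0'// => /andP[_ ty].
have : t < y by near: y; exact: lt_nbhsr.
by rewrite ltNge ty.
Unshelve. all: by end_near. Qed.

(** Young's inequality says that [E - lam N - w |phi|^p] has nonnegative derivative; primitives
    stand for integrals, so that the estimate is an instance of monotonicity. *)
Lemma young_gain phi V lam (w E N : R -> R) s t : s <= t ->
  (forall x, s <= x <= t -> is_derive x 1 phi ((phi^`())%classic x)) ->
  (forall x, s <= x <= t -> is_derive x 1 E (`|(phi^`())%classic x| `^ p + V x * `|phi x| `^ p)) ->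
  (forall x, s <= x <= t -> is_derive x 1 N (`|phi x| `^ p)) ->
  (forall x, s <= x <= t -> derivable w x 1 /\ riccati p w x <= V x - lam) ->
  w t * `|phi t| `^ p - w s * `|phi s| `^ p <= (E t - E s) - lam * (N t - N s).
Proof.
move=> st dphi dE dN dw.
pose psi := (phi^`())%classic.
pose F x := E x - lam * N x - w x * `|phi x| `^ p.
pose dF x := `|psi x| `^ p + V x * `|phi x| `^ p - lam * `|phi x| `^ p
  - ((riccati p w x - ric p (w x)) * `|phi x| `^ p +
     w x * (p * spow (p - 1) (phi x) * psi x)).
suff : F s <= F t by rewrite /F; lra.
apply: (@is_derive_ndecr _ F dF) => // x xst.
- have [wd _] := dw x xst.
  apply: is_derive_sub.
    by apply: is_derive_sub; [exact: dE|apply: is_derive_scale; exact: dN].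
  apply: is_derive_mul; first exact: riccati_is_derive.
  apply: (@is_derive_comp _ (fun y => `|y| `^ p) phi); first exact: dphi.
  by apply: abspow_is_derive.
- have [_ wr] := dw x xst; rewrite /dF /ric.
  have := @abspow_young _ p (conjugate p) (phi x) (psi x) (w x) p1 erefl.
  have := ler_wpM2r (powR_ge0 `|phi x| p) wr.
  set A := _ `^ (conjugate p); set P := `|phi x| `^ p; set S := spow _ _; set Y := psi x.
  move: (riccati p w x) (w x) (`|Y| `^ p) (V x) => r ww Yp v h1 h2.
  rewrite -subr_ge0 in h1; rewrite -subr_ge0 in h2.
  apply: le_trans (addr_ge0 h1 h2) _.
  by rewrite le_eqVlt; apply/orP; left; apply/eqP; ring.
Qed.

(** The gain is added over the two sides of [c], with [w1] on the left and [w2] on the right, and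
    the jump of the Riccati variable at [c] remains. Both reach slightly beyond [c], so their values
    there are finite. *)
Lemma weak_duality phi V lam c w1 w2 c1 c2 : test_function D phi -> continuous V ->
  [/\ a < c2, c2 < c, c < c1 & c1 < b] ->
  subsol p a c1 (fun x => V x - lam) w1 -> subsol p c2 b (fun x => V x - lam) w2 ->
  exists e n : R, [/\
    (\int[leb]_(x in itvD D) (`|(phi^`())%classic x| `^ p + V x * `|phi x| `^ p)%:E = e%:E)%E,
    (\int[leb]_(x in itvD D) (`|phi x| `^ p)%:E = n%:E)%E,
    (\int[leb]_(x in `]-oo, c] `&` itvD D) ((phi^`())%classic x)%:E = (phi c)%:E)%E &
    (w1 c - w2 c) * `|phi c| `^ p <= e - lam * n].
Proof.
move=> tphi cV [ac2 c2c cc1 c1b] s1 s2.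
have [|s [t [as_ sc ct tb phi0]]] := @test_function_supp phi c tphi.
  by apply/andP; split; lra.
have p0 : 0 < p by plra.
have cp x : {for x, continuous (fun x => `|phi x| `^ p)}.
  by apply: abspow_comp_continuous => //; exact: test_function_continuous.
have cd x : {for x, continuous (fun x => `|(phi^`())%classic x| `^ p)}.
  by apply: abspow_comp_continuous => //; exact: test_function_derive_continuous.
have ce : continuous (fun x => `|(phi^`())%classic x| `^ p + V x * `|phi x| `^ p).
  by move=> x; apply: cvgD; [exact: cd|apply: cvgM; [exact: cV|exact: cp]].
have [E dE] := primitive_exists ce; have [N dN] := primitive_exists cp.
have pN0 : p != 0 by rewrite gt_eqF.
have [ps _] : phi s = 0 /\ (phi^`())%classic s = 0.
  by apply: phi0; rewrite ltxx.
have [pt _] : phi t = 0 /\ (phi^`())%classic t = 0.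
  by apply: phi0; rewrite ltxx andbF.
have {}phi0 x : ~ (s <= x <= t) -> phi x = 0 /\ (phi^`())%classic x = 0.
  by move=> xst; apply: phi0 => /andP[sx xt]; apply: xst; rewrite !ltW.
exists (E t - E s), (N t - N s); split.
- apply: supp_integral => //; first lra.
    exact: segment_sub_itvD.
  by move=> x _ /phi0[-> ->]; rewrite normr0 powR0// mulr0 addr0.
- apply: supp_integral => //; first lra.
    exact: segment_sub_itvD.
  by move=> x _ /phi0[-> _]; rewrite normr0 powR0.
- transitivity (phi c - phi s)%:E; last by rewrite ps subr0.
  apply: supp_integral.
  + exact: ltW.
  + by move=> x; exact: test_function_is_derive.
  + exact: test_function_derive_continuous.
  + move=> x /=; rewrite /itvD/= !in_itv/= => /andP[? ?]; split; first by [].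
    by apply/andP; split; lra.
  + move=> x [/= + _]; rewrite in_itv/= => xc xsc; apply: (phi0 x _).2.
    by move=> /andP[sx xt]; apply: xsc; rewrite sx xc.
- have := @young_gain phi V lam w1 E N s c (ltW sc) _ _ _ _.
  rewrite ps normr0 powR0// mulr0 subr0 => g1.
  have := @young_gain phi V lam w2 E N c t (ltW ct) _ _ _ _.
  rewrite pt normr0 powR0// mulr0 sub0r => g2.
  have {}g1 : w1 c * `|phi c| `^ p <= E c - E s - lam * (N c - N s).
    apply: g1 => x /andP[sx xc]; first exact: test_function_is_derive.
    by apply: s1; apply/andP; split; lra.
  have {}g2 : - (w2 c * `|phi c| `^ p) <= E t - E c - lam * (N t - N c).
    apply: g2 => x /andP[sx xc]; first exact: test_function_is_derive.
    by apply: s2; apply/andP; split; lra.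
  by lra.
Qed.

Implicit Types (h g : R -> R) (C : R).

Definition weight_norm (h : R -> R) (f : Lp) : R := fine (\int[mu]_x (h x * `|f x| `^ p)%:E)%E.

Lemma weight_integrable h C (f : Lp) : measurable_fun setT h -> (forall x, 0 <= h x <= C) ->
  mu.-integrable setT (fun x => (h x * `|f x| `^ p)%:E).
Proof.
move=> mh hC; have := @integrableZl _ _ _ mu _ measurableT C _ (Lspace_powR_integrable f).
apply: le_integrable => //.
- apply/measurable_EFinP/measurable_funM => //.
  apply: (measurableT_comp (measurable_powR _)) => //.
  by apply: measurableT_comp => //; exact: Lspace_measurable.
- move=> x _; rewrite -EFinM/= lee_fin.
  have /andP[h0 h1] := hC x.
  have P0 := powR_ge0 `|f x| p.
  by rewrite !normrM (ger0_norm h0) (ger0_norm P0) (ger0_norm (le_trans h0 h1)) ler_wpM2r.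
Qed.

Lemma weight_normE h C (f : Lp) : measurable_fun setT h -> (forall x, 0 <= h x <= C) ->
  (\int[mu]_x (h x * `|f x| `^ p)%:E)%E = (weight_norm h f)%:E.
Proof.
move=> mh hC; rewrite fineK//; apply: integrable_fin_num => //.
exact: weight_integrable hC.
Qed.

Lemma weight_norm1 (f : Lp) : weight_norm (fun=> 1) f = `|f| `^ p.
Proof.
rewrite /weight_norm; under eq_integral do rewrite mul1r.
by rewrite Lspace_normP.
Qed.

Lemma weight_norm_ge0 h (f : Lp) : (forall x, 0 <= h x) -> 0 <= weight_norm h f.
Proof.
move=> h0; rewrite fine_ge0// integral_ge0// => x _.
by rewrite lee_fin mulr_ge0// powR_ge0.
Qed.

(** Convexity applied to x = s (y / s) + (1 - s) ((x - y) / (1 - s)). As [s] tends to 1 the factor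
    of [|y|^p] tends to 1, which lets estimates pass to limits in L^p. *)
Lemma abspow_split s x y : 0 < s < 1 ->
  `|x| `^ p <= s `^ (1 - p) * `|y| `^ p + (1 - s) `^ (1 - p) * `|x - y| `^ p.
Proof.
move=> /andP[s0 s1].
have sE r (z : R) : 0 < r -> r * `|r^-1 * z| `^ p = r `^ (1 - p) * `|z| `^ p.
  move=> r0; rewrite normrM powRM// gtr0_norm ?invr_gt0// mulrA.
  rewrite -powR_inv1 ?(ltW r0)// -powRrM mulN1r -{1}(powRr1 (ltW r0)) -powRD//.
  by rewrite (gt_eqF r0) implybT.
have s01 : 0 <= s <= 1 by rewrite !ltW.
have := @abspow_convex _ p s (s^-1 * y) ((1 - s)^-1 * (x - y)) p1 s01.
have s2 : 0 < 1 - s by rewrite subr_gt0.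
rewrite !sE// !mulrA !divff ?gt_eqF// !mul1r.
by rewrite addrC subrK.
Qed.

Lemma weight_norm_split h C (f g : Lp) s : measurable_fun setT h ->
  (forall x, 0 <= h x <= C) -> 0 < s < 1 ->
  weight_norm h f <= s `^ (1 - p) * weight_norm h g + (1 - s) `^ (1 - p) * (C * `|f - g| `^ p).
Proof.
move=> mh hC s01.
have h0 x : 0 <= h x by case/andP: (hC x).
have C0 : 0 <= C by have /andP[c1 c2] := hC 0; exact: le_trans c2.
set P := s `^ (1 - p); set Q := (1 - s) `^ (1 - p).
have P0 : 0 <= P by exact: powR_ge0.
have Q0 : 0 <= Q by exact: powR_ge0.
have mf (k : Lp) : measurable_fun setT (fun x => (h x * `|k x| `^ p)%:E).
  by have /integrableP[] := weight_integrable k mh hC.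
have mf1 (k : Lp) : measurable_fun setT (fun x => (`|k x| `^ p)%:E).
  by have /integrableP[] := Lspace_powR_integrable k.
have hp0 (k : Lp) x : (0 <= (h x * `|k x| `^ p)%:E)%E by rewrite lee_fin mulr_ge0 ?powR_ge0.
have p0 (k : Lp) x : (0 <= (`|k x| `^ p)%:E)%E by rewrite lee_fin powR_ge0.
suff : (\int[mu]_x (h x * `|f x| `^ p)%:E <= P%:E * \int[mu]_x (h x * `|g x| `^ p)%:E
    + (Q * C)%:E * \int[mu]_x (`|(f - g) x| `^ p)%:E)%E.
  rewrite (weight_normE f mh hC) (weight_normE g mh hC) Lspace_normP.
  by rewrite -!EFinM -EFinD lee_fin -mulrA.
have e1 : (P%:E * \int[mu]_x (h x * `|g x| `^ p)%:E = \int[mu]_x (P%:E * (h x * `|g x| `^ p)%:E))%E.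
  by rewrite (ge0_integralZl mu measurableT (mf g)).
have e2 : ((Q * C)%:E * \int[mu]_x (`|(f - g) x| `^ p)%:E =
    \int[mu]_x ((Q * C)%:E * (`|(f - g) x| `^ p)%:E))%E.
  by rewrite (ge0_integralZl mu measurableT (mf1 _))// lee_fin mulr_ge0.
have m1 : measurable_fun setT (fun x => P%:E * (h x * `|g x| `^ p)%:E)%E.
  by apply: emeasurable_funM.
have m2 : measurable_fun setT (fun x => (Q * C)%:E * (`|(f - g) x| `^ p)%:E)%E.
  by apply: emeasurable_funM.
have g1 x : (0 <= P%:E * (h x * `|g x| `^ p)%:E)%E by rewrite mule_ge0.
have g2 x : (0 <= (Q * C)%:E * (`|(f - g) x| `^ p)%:E)%E by rewrite mule_ge0// lee_fin mulr_ge0.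
rewrite e1 e2 -ge0_integralD//.
apply: ae_ge0_le_integral => //.
- exact: mf.
- by move=> x _; rewrite adde_ge0.
- by apply: emeasurable_funD.
- have := LspaceDE f (- g); have := LspaceNE g.
  apply: filterS2 => x /(_ I) /= e3 /(_ I) /= e4 _.
  rewrite -!EFinM -EFinD lee_fin e4 e3.
  have := @abspow_split s (f x) (g x) s01.
  move=> /(ler_wpM2l (h0 x)); move=> /le_trans; apply.
  rewrite -/P -/Q mulrDr mulrCA lerD2l mulrCA -mulrA ler_wpM2l// ler_wpM2r ?powR_ge0//.
  by case/andP: (hC x).
Qed.

(* Applied to [u'] this is [u c]: an odd continuous functional, so it vanishes somewhere
   on any admissible set of genus at least 2. *)
Definition halfline_integral (c : R) (f : Lp) : R := (\int[mu]_(x in `]-oo, c]) f x)%R.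

Lemma halfline_integrable c (f : Lp) : mu.-integrable `]-oo, c] (EFin \o (f : R -> R)).
Proof. by have := Lspace_integrable f; apply: integrableS. Qed.

Lemma halfline_integral_ae c (f : Lp) (g : R -> R) : measurable_fun setT g ->
  (f : R -> R) = g %[ae mu] -> halfline_integral c f = (\int[mu]_(x in `]-oo, c]) g x)%R.
Proof.
move=> mg fg; congr fine; apply: ae_eq_integral => //.
- by apply/measurable_EFinP/measurable_funTS; exact: Lspace_measurable.
- by apply/measurable_EFinP/measurable_funTS.
- by apply: filterS fg => x /(_ I) /= ->.
Qed.

Lemma halfline_integralZ c k (f : Lp) :
  halfline_integral c (k *: f) = k * halfline_integral c f.
Proof.
rewrite (@halfline_integral_ae c _ (k \*: (f : R -> R))); last exact: LspaceZE.
  by rewrite /= RintegralZl//; exact: halfline_integrable.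
by apply: measurable_funM => //; exact: Lspace_measurable.
Qed.

Lemma halfline_integralD c (f g : Lp) :
  halfline_integral c (f + g) = halfline_integral c f + halfline_integral c g.
Proof.
rewrite (@halfline_integral_ae c _ ((f : R -> R) \+ g)); last exact: LspaceDE.
  by rewrite /= RintegralD//; exact: halfline_integrable.
by apply: measurable_funD => //; exact: Lspace_measurable.
Qed.

Lemma halfline_integralN c (f : Lp) : halfline_integral c (- f) = - halfline_integral c f.
Proof. by rewrite -scaleN1r halfline_integralZ mulN1r. Qed.

Lemma halfline_integral_le c (f : Lp) : `|halfline_integral c f| <= (D + 1) * `|f|.
Proof.
(* From |g| <= 1 + |g|^p; applied to the normalized function this becomes linear in the norm by
   homogeneity. *)
have main (g : Lp) : `|halfline_integral c g| <= D + `|g| `^ p.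
  have mJ : measurable (`]-oo, c]%classic : set (measurableTypeR R)) by exact: measurable_itv.
  rewrite -lee_fin EFin_normr_Rintegral//; last exact: halfline_integrable.
  have mg := Lspace_measurable g.
  have mgp : measurable_fun setT (fun x => (`|g x| `^ p)%:E).
    by have /integrableP[] := Lspace_powR_integrable g.
  apply: (@le_trans _ _ (\int[mu]_(x in `]-oo, c]) (1 + (`|g x| `^ p)%:E))%E).
    apply: le_trans (le_abse_integral _ _ _) _ => //.
      by apply/measurable_EFinP/measurable_funTS.
    apply: ge0_le_integral => //.
    - by apply/measurableT_comp => //; apply/measurable_EFinP/measurable_funTS.
    - by apply/measurable_funTS; exact: emeasurable_funD.
    - move=> x _ /=; rewrite -EFinD lee_fin.
      have [g1|g1] := leP `|g x| 1; first by apply: ler_wpDr => //; exact: powR_ge0.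
      rewrite ler_wpDl//.
      have := @ler_powR _ `|g x| (ltW g1) 1 p (ltW p1).
      by rewrite powRr1.
  apply: (@le_trans _ _ (\int[mu]_x (1 + (`|g x| `^ p)%:E))%E).
    apply: ge0_subset_integral => //.
    - exact: emeasurable_funD.
    - by move=> x _; rewrite adde_ge0// lee_fin powR_ge0.
  rewrite ge0_integralD//.
  rewrite integral_cst// mul1e Lspace_normP.
  by rewrite EFinD -[in leRHS]itvD_measureT.
have [f0|f0] := eqVneq `|f| 0.
  have -> : f = 0 by apply/eqP; rewrite -normr_eq0 f0.
  by have := halfline_integralZ c 0 (0 : Lp); rewrite scale0r mul0r => ->; rewrite !normr0 mulr0.
have fp : 0 < `|f| by rewrite lt_def f0 normr_ge0.
have := main (`|f|^-1 *: f).
rewrite halfline_integralZ normrM normrZ normfV normr_id mulVf// powR1.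
by rewrite mulrC ler_pdivrMr.
Qed.

Lemma halfline_integral_continuous c : continuous (halfline_integral c).
Proof.
apply: (@lipschitz_functional_continuous _ Lp _ (D + 1)); first by plra.
by move=> f g; rewrite -halfline_integralN -halfline_integralD halfline_integral_le.
Qed.

Implicit Types (w : Lp * Lp) (B : R).

Lemma shifted_bounds V B : (forall x, `|V x| <= B) -> forall x, 0 <= V x + B <= 2 * B.
Proof. by move=> VB x; have := VB x; rewrite ler_norml => /andP[v1 v2]; apply/andP; split; lra. Qed.

Lemma measurable_abspow (f : R -> R) : measurable_fun setT f ->
  measurable_fun setT (fun x => `|f x| `^ p).
Proof.
move=> mf; apply: (measurableT_comp (measurable_powR _)) => //.
exact: measurableT_comp.
Qed.

(** Shifting [V] by [B] makes the weight nonnegative, so that the energy is a combination of finite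
    integrals of nonnegative functions. *)
Lemma energyE V B w : continuous V -> (forall x, `|V x| <= B) ->
  energy V w = (`|w.2| `^ p + weight_norm (fun x => V x + B) w.1 - B * `|w.1| `^ p)%:E.
Proof.
move=> cV VB; have VB2 := shifted_bounds VB.
have mV : measurable_fun setT V by exact: continuous_measurable_fun.
have mVB : measurable_fun setT (fun x => V x + B) by exact: measurable_funD.
have m1 := measurable_abspow (Lspace_measurable w.1).
have m2 := measurable_abspow (Lspace_measurable w.2).
rewrite /energy -itvD_integralT; last first.
  by apply/measurable_EFinP; apply: measurable_funD => //; exact: measurable_funM.
have i2 := Lspace_powR_integrable w.2.
have i1 := Lspace_powR_integrable w.1.
have iV := weight_integrable w.1 mVB VB2.
have iB : mu.-integrable setT (fun x => (B%:E * (`|w.1 x| `^ p)%:E)%E) by exact: integrableZl.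
transitivity (\int[mu]_x (((`|w.2 x| `^ p)%:E + ((V x + B) * `|w.1 x| `^ p)%:E) -
   (B%:E * (`|w.1 x| `^ p)%:E)))%E.
  by apply: eq_integral => x _; rewrite -EFinM -EFinN -!EFinD; congr EFin; ring.
have i3 : mu.-integrable setT (fun x => ((`|w.2 x| `^ p)%:E + ((V x + B) * `|w.1 x| `^ p)%:E)%E).
  exact: integrableD.
rewrite (integralB measurableT i3 iB) (integralD measurableT i2 iV) integralZl//.
by rewrite (weight_normE _ mVB VB2) !Lspace_normP -EFinM -EFinN -!EFinD.
Qed.

Lemma test_pair_energy V phi w : test_function D phi -> continuous V ->
  (w.1 : R -> R) = phi %[ae mu] -> (w.2 : R -> R) = (phi^`())%classic %[ae mu] ->
  energy V w =
  (\int[leb]_(x in itvD D) (`|(phi^`())%classic x| `^ p + V x * `|phi x| `^ p)%:E)%E.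
Proof.
move=> tphi cV e1 e2.
have mV : measurable_fun setT V by exact: continuous_measurable_fun.
have m1 := measurable_abspow (Lspace_measurable w.1).
have m2 := measurable_abspow (Lspace_measurable w.2).
have n1 := measurable_abspow (continuous_measurable_fun (test_function_continuous tphi)).
have n2 := measurable_abspow (continuous_measurable_fun (test_function_derive_continuous tphi)).
have mw : measurable_fun setT (fun x => (`|w.2 x| `^ p + V x * `|w.1 x| `^ p)%:E).
  by apply/measurable_EFinP; apply: measurable_funD => //; exact: measurable_funM.
have mphi : measurable_fun setT (fun x => (`|(phi^`())%classic x| `^ p + V x * `|phi x| `^ p)%:E).
  by apply/measurable_EFinP; apply: measurable_funD => //; exact: measurable_funM.
rewrite /energy -(itvD_integralT mw) -(itvD_integralT mphi).
apply: ae_eq_integral => //; move: e1 e2.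
by apply: filterS2 => x /(_ I) h1 /(_ I) h2 _; rewrite h1 h2.
Qed.

Lemma test_pair_norm phi w : test_function D phi -> (w.1 : R -> R) = phi %[ae mu] ->
  (`|w.1| `^ p)%:E = (\int[leb]_(x in itvD D) (`|phi x| `^ p)%:E)%E.
Proof.
move=> tphi e1; rewrite -Lspace_normP.
have m1 := measurable_abspow (Lspace_measurable w.1).
have n1 := measurable_abspow (continuous_measurable_fun (test_function_continuous tphi)).
rewrite -itvD_integralT; last exact/measurable_EFinP.
apply: ae_eq_integral => //; try exact/measurable_EFinP.
by apply: filterS e1 => x /(_ I) h1 _; rewrite h1.
Qed.

Lemma test_pair_halfline phi w c : test_function D phi ->
  (w.2 : R -> R) = (phi^`())%classic %[ae mu] ->
  halfline_integral c w.2 =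
  fine (\int[leb]_(x in `]-oo, c] `&` itvD D) ((phi^`())%classic x)%:E)%E.
Proof.
move=> tphi e2.
have mphi := continuous_measurable_fun (test_function_derive_continuous tphi).
rewrite (halfline_integral_ae c mphi e2) /Rintegral itvD_integral//.
exact/measurable_EFinP.
Qed.

(* Young's inequality gives [(w |phi|^p)' <= |phi'|^p + (V - lam) |phi|^p] for test
   functions; the estimate then passes to their closure. *)
Lemma energy_ge V B lam c (w1 w2 : R -> R) c1 c2 (w : Lp * Lp) : continuous V -> (forall x, `|V x| <= B) ->
  [/\ a < c2, c2 < c, c < c1 & c1 < b] ->
  subsol p a c1 (fun x => V x - lam) w1 -> subsol p c2 b (fun x => V x - lam) w2 ->
  W1p0 w ->
  ((lam * `|w.1| `^ p + (w1 c - w2 c) * `|halfline_integral c w.2| `^ p)%:E <= energy V w)%E.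
Proof.
move=> cV VB cc s1 s2 [_ wcl]; have VB2 := shifted_bounds VB.
have mV : measurable_fun setT V by exact: continuous_measurable_fun.
have mVB : measurable_fun setT (fun x => V x + B) by exact: measurable_funD.
set K := w1 c - w2 c.
rewrite (energyE _ cV VB) lee_fin.
set M := `|w.2| `^ p + _.
have M0 : 0 <= M.
  by rewrite addr_ge0 ?powR_ge0// weight_norm_ge0// => x; case/andP: (VB2 x).
have p0 : 0 < p by plra.
have B0 : 0 <= B by exact: le_trans (VB 0).
(* It is enough to prove the estimate up to the factor s^(1-p). If M < X, take [r] strictly between
   M / X and 1 and s = r^(1/(p-1)): the factor is 1 / r, too small to reach [X]. *)
suff : forall s, 0 < s < 1 ->
    K * `|halfline_integral c w.2| `^ p + (lam + B) * `|w.1| `^ p <= s `^ (1 - p) * M.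
  set X := _ + _ => XM; suff : X <= M by rewrite /X; lra.
  rewrite leNgt; apply/negP => MX.
  have X0 : 0 < X by exact: le_lt_trans MX.
  pose r := (M / X + 1) / 2; have MX0 : 0 <= M / X by rewrite divr_ge0// ltW.
  have MX1 : M / X < 1 by rewrite ltr_pdivrMr// mul1r.
  have r0 : 0 < r by rewrite /r; lra.
  have p10 : 0 < (p - 1)^-1 by rewrite invr_gt0; plra.
  have := XM (r `^ (p - 1)^-1).
  rewrite powR_gt0//= powR_lt1//; last by rewrite /r; apply/andP; split; lra.
  have pN : p - 1 != 0 by rewrite gt_eqF//; plra.
  have eN : (p - 1)^-1 * (1 - p) = - 1 by field.
  move=> /(_ isT); rewrite -powRrM eN.
  rewrite powRN powRr1 ?(ltW r0)// mulrC ler_pdivlMr//; apply/negP; rewrite -ltNge.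
  by rewrite mulrC -ltr_pdivrMr// /r; lra.
move=> s s01.
pose Q := (1 - s) `^ (1 - p).
(* [Psi] is continuous and bounded above by s^(1-p) M on test pairs, hence on their closure; at t =
   w its error terms vanish. *)
pose Psi (t : Lp * Lp) : R := K * `|halfline_integral c t.2| `^ p + (lam + B) * `|t.1| `^ p
  - Q * (`|t.2 - w.2| `^ p + 2 * B * `|t.1 - w.1| `^ p).
have PsiC : continuous Psi.
  have nc (L : Lp * Lp -> R) : continuous L -> continuous (fun t : Lp * Lp => `|L t| `^ p).
    by move=> cL t; apply: abspow_comp_continuous => //; exact: cL.
  have nc1 (L : Lp * Lp -> Lp) : continuous L -> continuous (fun t : Lp * Lp => `|L t| `^ p).
    move=> cL t; have -> : (fun t : Lp * Lp => `|L t| `^ p) = (fun t : Lp * Lp => `|(`|L t|)| `^ p).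
      by apply/funext => z; rewrite normr_id.
    apply: nc => z; apply: (@continuous_comp _ _ _ L (fun y => `|y|)); first exact: cL.
    exact: norm_continuous.
  have c1' : continuous (fun t : Lp * Lp => t.1) by move=> t; exact: cvg_fst.
  have c2' : continuous (fun t : Lp * Lp => t.2) by move=> t; exact: cvg_snd.
  move=> t; apply: cvgB; [apply: cvgD|apply: cvgM; [exact: cvg_cst|apply: cvgD]].
  - apply: cvgM; [exact: cvg_cst|apply: nc => z].
    apply: (@continuous_comp _ _ _ (fun t : Lp * Lp => t.2)); first exact: c2'.
    exact: halfline_integral_continuous.
  - by apply: cvgM; [exact: cvg_cst|exact: nc1].
  - by apply: nc1 => z; apply: cvgB; [exact: c2'|exact: cvg_cst].
  - apply: cvgM; [exact: cvg_cst|].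
    by apply: nc1 => z; apply: cvgB; [exact: c1'|exact: cvg_cst].
have PsiM (t : Lp * Lp) : test_pair t -> Psi t <= s `^ (1 - p) * M.
  move=> [phi tphi [e1 e2]].
  have [e [n [E1 E2 E3 E4]]] := weak_duality tphi cV cc s1 s2.
  have En := test_pair_energy tphi cV e1 e2; rewrite (energyE _ cV VB) E1 in En.
  have nE := test_pair_norm tphi e1; rewrite E2 in nE.
  have hE := test_pair_halfline c tphi e2; rewrite E3/= in hE.
  case: En nE => En [nE]; rewrite -hE -nE -En -/K in E4.
  have h1 := weight_norm_split t.1 w.1 mVB VB2 s01.
  have one1 (x : R) : 0 <= (1 : R) <= 1 by rewrite ler01 lexx.
  have h2 := @weight_norm_split (fun=> 1) 1 t.2 w.2 s (measurable_cst _) one1 s01.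
  rewrite !weight_norm1 mul1r in h2.
  rewrite /Psi /M -/Q; rewrite -/Q in h1 h2; move: E4 h1 h2.
  move: (`|halfline_integral c t.2| `^ p) (weight_norm _ t.1) (weight_norm _ w.1) => X Y Z.
  move: (`|t.1| `^ p) (`|t.2| `^ p) (`|w.2| `^ p) => T1 T2 W2.
  move: (s `^ (1 - p)) (`|t.1 - w.1| `^ p) (`|t.2 - w.2| `^ p) => P Y1 Y2.
  move=> h0 h1 h2.
  have -> : Q * (Y2 + 2 * B * Y1) = Q * Y2 + Q * (2 * B * Y1) by ring.
  have -> : P * (W2 + Z) = P * W2 + P * Z by ring.
  have -> : (lam + B) * T1 = lam * T1 + B * T1 by ring.
  by clear -h0 h1 h2; lra.
have clM : closed [set t | Psi t <= s `^ (1 - p) * M].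
  by apply: (closed_comp _ (@closed_le _ _)) => t _; exact: PsiC.
have := @closureS _ (@test_pair R p p1 D) [set t | Psi t <= s `^ (1 - p) * M] PsiM w wcl.
rewrite -(closure_id _).1//=.
by rewrite /Psi !subrr !normr0 powR0 ?gt_eqF// mulr0 addr0 mulr0 subr0.
Qed.

(** A ground state on ]c, e[ is infinite at [e]. Dilating it slightly about [c] moves the
    singularity beyond [e], and the uniform continuity of [V] pays for this with an arbitrarily
    small loss in the level. *)
Lemma dilate V B (c d mu lam : R) (w : R -> R) : continuous V -> (forall x, `|V x| <= B) ->
  c < d -> lam < mu -> forall e, c < e -> e < d ->
  subsol p c e (fun x => V x - mu) w ->
  exists2 e', e < e' < d & exists w' : R -> R, subsol p c e' (fun x => V x - lam) w'.
Proof.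
move=> cV VB cd lm e ce ed ws; pose eps := (mu - lam) / 2.
have eps0 : 0 < eps by rewrite /eps; lra.
have : \forall k \near (1 : R)^'-, forall x, `[c, d]%classic x ->
    `|V (k * x + c * (1 - k)) - V x| < eps.
  apply: (compact_near_coveringP _).1; first exact: segment_compact.
  move=> x _.
  pose F := filter_prod (nbhs x) ((1 : R)^'-).
  have FF : Filter F by exact: filter_prod_filter.
  have c1 : (fun z : R * R => z.1) @ F --> x by exact: cvg_fst.
  have c2 : (fun z : R * R => z.2) @ F --> (1 : R).
    by apply: cvg_trans (@cvg_snd _ _ _ _ _) _; exact: cvg_within.
  have cvgL : (fun z : R * R => z.2 * z.1 + c * (1 - z.2)) @ F --> x.
    have e1 : x = 1 * x + c * (1 - 1) :> R by ring.
    rewrite [X in _ --> X]e1.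
    apply: cvgD; first exact: cvgM c2 c1.
    by apply: cvgM; [exact: cvg_cst|apply: cvgB => //; exact: cvg_cst].
  have cvgV : (fun z : R * R => V (z.2 * z.1 + c * (1 - z.2)) - V z.1) @ F --> (0 : R).
    rewrite -(subrr (V x)).
    apply: cvgB; first by apply: cvg_comp cvgL _; exact: cV.
    by apply: cvg_comp c1 _; exact: cV.
  exact: (@cvgr0_norm_lt _ _ _ _ _ _ cvgV eps eps0).
move=> unif.
have near1 : \forall k \near (1 : R)^'-, (1 - `|k| `^ p) * (B + `|mu|) < eps.
  have : (fun k : R => (1 - `|k| `^ p) * (B + `|mu|)) @ (1 : R)^'- --> (1 - 1) * (B + `|mu|).
    apply: cvgM; last exact: cvg_cst.
    apply: cvgB; first exact: cvg_cst.
    have := @abspow_continuous _ p (lt_trans ltr01 p1) (1 : R).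
    by rewrite /continuous_at normr1 powR1; exact: cvg_at_left_filter.
  by rewrite subrr mul0r => /cvgr_lt; apply.
(* Ratios [k] above this one keep the dilated end below [d]. *)
have ed1 : (e - c) / (d - c) < 1 by rewrite ltr_pdivrMr; lra.
have [k [kunif k1 ke klt k0]] : exists k : R, [/\ forall x, `[c, d]%classic x ->
    `|V (k * x + c * (1 - k)) - V x| < eps, (1 - `|k| `^ p) * (B + `|mu|) < eps,
    (e - c) / (d - c) < k, k < 1 & 0 < k].
  apply: (@filter_ex _ ((1 : R)^'-)); near=> k; split.
  - by near: k.
  - by near: k.
  - by near: k; exact: nbhs_left_gt.
  - by near: k; exact: nbhs_left_lt.
  - by near: k; exact: nbhs_left_gt.
have dc : 0 < d - c by lra.
have ek : (e - c) / k < d - c by rewrite ltr_pdivrMr// mulrC -ltr_pdivrMr.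
have ek2 : e - c < (e - c) / k.
  by rewrite ltr_pdivlMr// -subr_gt0 -{1}[e - c]mulr1 -mulrBr mulr_gt0//; lra.
exists (c + (e - c) / k); first by apply/andP; split; lra.
exists (fun x => k `^ (p - 1) * w (k * x + c * (1 - k))).
have kx x : c < x < c + (e - c) / k -> c < k * x + c * (1 - k) < e.
  move=> /andP[cx xe]; have := mulr_gt0 k0 (_ : 0 < x - c).
  have : x - c < (e - c) / k by lra.
  rewrite ltr_pdivlMr// mulrC => h1 /(_ _)h2.
  have {}h2 : 0 < k * (x - c) by apply: h2; lra.
  have -> : k * x + c * (1 - k) = k * (x - c) + c by ring.
  by apply/andP; split; lra.
apply: subsol_le (subsol_rescale p1 k0 ws kx) => x xce.
set y := k * x + _.
have := kunif x; rewrite /= in_itv/= -/y => /(_ _) h1.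
have {}h1 : `|V y - V x| < eps by apply: h1; case/andP: xce => ? ?; apply/andP; split; lra.
have kp1 : k `^ p <= 1 by apply: powR_le1; [plra|apply/andP; split; lra].
rewrite ger0_norm ?(ltW k0)// in k1.
have h2 : (1 - k `^ p) * - (V y - mu) <= (1 - k `^ p) * (B + `|mu|).
  apply: ler_wpM2l; first by rewrite subr_ge0.
  have := VB y; rewrite ler_norml => /andP[v1 v2]; have := ler_norm mu.
  by lra.
have := ltr_norml (V y - V x) eps; rewrite h1 => /esym/andP[h3 h4].
rewrite /eps in h4 k1; have : k `^ p * (V y - mu) = V y - mu + (1 - k `^ p) * - (V y - mu) by ring.
by lra.
Unshelve. all: by end_near. Qed.

Lemma genus_obstruction (A : set (Lp * Lp)) (n k : nat) : (k%:R%:E <= genus A)%E ->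
  (n < k)%N -> ~ odd_map_to A n.
Proof.
move=> kA nk odd; have : (genus A <= n%:R%:E)%E by apply: ereal_inf_lbound; exists n.
by move=> /(le_trans kA); rewrite lee_fin ler_nat leqNgt nk.
Qed.

Lemma lambda1_ge V B lam (w : R -> R) : continuous V -> (forall x, `|V x| <= B) ->
  ground p a b V lam w -> (lam%:E <= lambda p1 D 1 V)%E.
Proof.
move=> cV VB gw; have sw := ground_subsol gw.
(* The estimate is cut at 0 with [w1 = w2 = w], so its jump term is zero. *)
have cc : [/\ a < - (D / 4), - (D / 4) < 0, 0 < D / 4 & D / 4 < b].
  by split; plra.
have s1 : subsol p a (D / 4) (fun x => V x - lam) w.
  case: cc => _ _ _ db; clear -sw db => x /andP[x1 x2]; apply: sw.
  by rewrite x1 (lt_trans x2).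
have s2 : subsol p (- (D / 4)) b (fun x => V x - lam) w.
  case: cc => ad _ _ _; clear -sw ad => x /andP[x1 x2]; apply: sw.
  by rewrite x2 (lt_trans ad).
apply: le_ereal_inf_tmp => _ [A [AS cA Asym gA] <-].
(* The empty set maps vacuously into R^0 minus 0, so it has genus 0. *)
have [A0|/set0P[u Au]] := eqVneq A set0.
  exfalso; apply: (genus_obstruction gA (n := 0%N)) => //; exists (fun=> 0); split.
  - by rewrite A0; apply: continuous_subspaceT => x; exact: cvg_cst.
  - by rewrite A0.
  - by rewrite A0.
have [uW u1] := AS u Au; rewrite /= in u1.
apply: (@le_trans _ _ (energy V u)); last by apply: ereal_sup_ubound; exists u.
by have := energy_ge cV VB cc s1 s2 uW; rewrite subrr mul0r addr0 u1 powR1 mulr1.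
Qed.

(** Otherwise [L] itself would be an odd map into R minus 0, and the genus at most 1. *)
Lemma odd_functional_vanishes (A : set (Lp * Lp)) (L : Lp * Lp -> R) : continuous L ->
  (forall u, L (- u) = - L u) -> (2%:R%:E <= genus A)%E -> exists2 u, A u & L u = 0.
Proof.
move=> cL oL gA; apply: contrapT => nA.
apply: (genus_obstruction gA (n := 1%N)) => //.
exists (fun u => L u *: const_mx 1); split.
- apply: continuous_subspaceT => x; apply: cvgZr_tmp; exact: cL.
- by move=> u Au; rewrite oL scaleNr.
- move=> u Au; rewrite scaler_eq0 negb_or; apply/andP; split.
    by apply/eqP => Lu; apply: nA; exists u.
  apply/eqP => /matrixP/(_ 0 0); rewrite !mxE => /eqP; rewrite oner_eq0//.
Qed.

Lemma lambda2_ge V B mu c (w1 w2 : R -> R) : continuous V -> (forall x, `|V x| <= B) ->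
  a < c < b -> ground p a c V mu w1 -> ground p c b V mu w2 ->
  (mu%:E <= lambda p1 D 2 V)%E.
Proof.
move=> cV VB /andP[ac cb] g1 g2; apply/lee_subgt0Pr => e e0.
rewrite -EFinB; set lam := mu - e; have lm : lam < mu by rewrite /lam; lra.
have [c1 /andP[cc1 c1b] [v1 s1]] :=
  dilate cV VB (lt_trans ac cb) lm ac cb (ground_subsol g1).
have cVN : continuous (fun x => V (- x)).
  by move=> x; apply: (@continuous_comp _ _ _ (@GRing.opp R)); [exact: opp_continuous|exact: cV].
have ab : - b < - a by lra.
have bc : - b < - c by lra.
have ca : - c < - a by lra.
have [c2 /andP[cc2 c2a] [v2 s2]] :=
  dilate cVN (fun x => VB (- x)) ab lm bc ca (subsol_reflect (ground_subsol g2)).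
have {}s2 : subsol p (- c2) b (fun x => V x - lam) (fun x => - v2 (- x)).
  have := subsol_reflect s2; rewrite opprK; apply: subsol_le => x _.
  by rewrite opprK.
have cc : [/\ a < - c2, - c2 < c, c < c1 & c1 < b].
  by clear -cc1 c1b cc2 c2a; split => //; lra.
have p0 : 0 < p by plra.
apply: le_ereal_inf_tmp => _ [A [AS cA Asym gA] <-].
have cL : continuous (fun u : Lp * Lp => halfline_integral c u.2).
  move=> t; apply: (@continuous_comp _ _ _ (fun t : Lp * Lp => t.2)); first exact: cvg_snd.
  exact: halfline_integral_continuous.
(* The trace of this [u] at the node is zero, which removes the jump term, whose sign is unknown. *)
have [u Au Lu] := odd_functional_vanishes cL (fun u => halfline_integralN c u.2) gA.
have [uW u1] := AS u Au; rewrite /= in u1.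
apply: (@le_trans _ _ (energy V u)); last by apply: ereal_sup_ubound; exists u.
have := energy_ge cV VB cc s1 s2 uW.
by rewrite Lu normr0 powR0 ?gt_eqF// u1 powR1 mulr1 mulr0 addr0.
Qed.

End measure.

(** * Smooth competitors *)

Section smooth_functions.
Context {R : realType}.
Implicit Types (f g F : R -> R) (x c m t : R).

(** The successive derivatives are carried as data, so that closure properties are proved on the
    whole sequence without computing iterated derivatives. *)
Definition smooth f : Prop :=
  exists d : nat -> R -> R, d 0%N = f /\ forall n x, is_derive x 1 (d n) (d n.+1 x).

Lemma smooth_derivable f n x : smooth f -> derivable (derive1n n f) x 1.
Proof.
move=> [d [d0 dd]]; have -> : derive1n n f = d n.
  elim: n => [//|n IH]; rewrite derive1nS; apply/funext => y.
  by rewrite IH derive1E; have [_] := dd n y.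
by have [] := dd n x.
Qed.

Lemma smooth_derive f : smooth f ->
  forall x, is_derive x 1 f ((f^`())%classic x).
Proof.
move=> sf x; have := @smooth_derivable f 0%N x sf; rewrite derive1n0 => /derivableP.
by move/is_derive_eq; apply; rewrite derive1E.
Qed.

Lemma smooth_cst c : smooth (fun=> c).
Proof.
exists (fun n => if n is 0%N then fun=> c else fun=> 0); split=> // n x.
by case: n => [|n]; exact: is_derive_const.
Qed.

Lemma smooth_add f g : smooth f -> smooth g -> smooth (fun x => f x + g x).
Proof.
move=> [d [d0 dd]] [e [e0 de]]; exists (fun n x => d n x + e n x).
by split=> [|n x]; [rewrite d0 e0|exact: is_derive_add].
Qed.

Lemma smooth_scale c f : smooth f -> smooth (fun x => c * f x).
Proof.
move=> [d [d0 dd]]; exists (fun n x => c * d n x).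
by split=> [|n x]; [rewrite d0|exact: is_derive_scale].
Qed.

Lemma smooth_affine c m f : smooth f -> smooth (fun x => f (c * x + m)).
Proof.
move=> [d [d0 dd]]; exists (fun n x => c ^+ n * d n (c * x + m)).
split=> [|n x]; first by apply/funext => x; rewrite expr0 mul1r d0.
have := is_derive_scale (c ^+ n) (is_derive_affine_comp (dd n (c * x + m))).
by move/is_derive_eq; apply; rewrite exprSr mulrA.
Qed.

Lemma smooth_primitive f F : smooth f -> (forall x, is_derive x 1 F (f x)) -> smooth F.
Proof.
move=> [d [d0 dd]] dF; exists (fun n => if n is n'.+1 then d n' else F).
by split=> // -[|n] x //=; rewrite d0.
Qed.

Lemma smooth_continuous f : smooth f -> continuous f.
Proof. by move=> sf x; exact: is_derive_continuous (smooth_derive sf x). Qed.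

(** The functions exp (- 1/t) / t^k; their derivatives are combinations of functions of the same
    family, which gives smoothness by iteration. *)
Definition flat (k : nat) t : R := if 0 < t then (t^-1) ^+ k * expR (- t^-1) else 0.

Lemma flat_le k t : 0 < t -> (t^-1) ^+ k * expR (- t^-1) <= k.+2%:R ^+ k.+2 * t ^+ 2.
Proof.
move=> t0; have i0 : 0 < t^-1 by rewrite invr_gt0.
(* The inequality y <= exp y at y = 1 / (t (k + 2)), raised to the power k + 2; two of these powers
   leave the factor t^2 that makes the function flat at 0. *)
have h : (t^-1 / k.+2%:R) ^+ k.+2 <= expR (t^-1).
  have -> : expR (t^-1) = (expR (t^-1 / k.+2%:R)) ^+ k.+2.
    by rewrite -expRM_natr divfK.
  apply: lerXn2r; rewrite ?nnegrE ?expR_ge0 ?divr_ge0 ?(ltW i0)//.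
  by apply: le_trans (expR_ge1Dx _); rewrite lerDr.
rewrite expRN ler_pdivrMr ?expR_gt0//.
have -> : (t^-1) ^+ k = k.+2%:R ^+ k.+2 * t ^+ 2 * (t^-1 / k.+2%:R) ^+ k.+2.
  have t1 : t != 0 by rewrite gt_eqF.
  have kn : (k.+2%:R : R) ^+ k.+2 != 0 by rewrite expf_neq0// pnatr_eq0.
  rewrite expr_div_n !exprVn; set P := _%:R ^+ _ in kn *.
  have -> : t ^- k.+2 = t ^- k * t ^- 2 by rewrite -[k.+2]addn2 exprD invfM.
  have tk : t ^+ k != 0 by rewrite expf_neq0.
  by field; rewrite ?kn ?t1 ?tk.
by apply: ler_wpM2l => //; rewrite mulr_ge0 ?exprn_ge0 ?(ltW t0).
Qed.

Lemma flat_ge0 k t : 0 <= flat k t.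
Proof.
rewrite /flat; case: ifPn => // t0.
by rewrite mulr_ge0 ?expR_ge0 ?exprn_ge0 ?invr_ge0 ?ltW.
Qed.

Lemma flat_quad k t : flat k t <= k.+2%:R ^+ k.+2 * t ^+ 2.
Proof.
rewrite /flat; case: ifPn => t0; first exact: flat_le.
by apply: mulr_ge0; [exact: exprn_ge0|exact: sqr_ge0].
Qed.

Lemma quad_is_derive0 f (C : R) : (forall t, `|f t| <= C * t ^+ 2) -> is_derive (0:R) 1 f 0.
Proof.
move=> fC; have f0 : f 0 = 0.
  by apply/eqP; rewrite -normr_le0; apply: le_trans (fC 0) _; rewrite expr0n mulr0.
have C0 : 0 <= C by have := fC 1; rewrite expr1n mulr1; apply: le_trans.
have h : (fun h : R => h^-1 *: (f (h *: 1 + 0) - f 0)) @ 0^' --> (0 : R).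
  apply/cvgr0Pnorm_lt => e e0.
  have e1 : 0 < e / (C + 1) by rewrite divr_gt0// ltr_wpDl.
  near=> h; have h0 : h != 0 by near: h; exact: nbhs_dnbhs_neq.
  have hC : `|h| < e / (C + 1) by near: h; exact: dnbhs0_lt.
  rewrite f0 subr0 addr0 -[h *: 1]/(h * 1) mulr1 -[_ *: _]/(_ * _) normrM normfV.
  have hp : 0 < `|h| by rewrite normr_gt0.
  rewrite mulrC ltr_pdivrMr//; apply: le_lt_trans (fC h) _.
  rewrite -(real_normK (num_real h)) expr2 mulrA ltr_pM2r//.
  have := hC; rewrite ltr_pdivlMr; last by rewrite ltr_wpDl.
  by move=> hC1; nra.
have L := cvg_lim (@Rhausdorff R) h.
by apply: DeriveDef; [apply/cvg_ex; exists 0; exact: h|exact: L].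
Unshelve. all: by end_near. Qed.

Lemma is_derive_expn f x (d : R) k : is_derive x 1 f d ->
  is_derive x 1 (fun y => f y ^+ k) (k%:R * f x ^+ k.-1 * d).
Proof.
move=> df; elim: k => [|k IH]; first by rewrite !mul0r; exact: is_derive_const.
have := is_derive_mul df IH.
have -> : (fun y => f y * f y ^+ k) = (fun y => f y ^+ k.+1).
  by apply/funext => y; rewrite exprS.
move/is_derive_eq; apply; rewrite -natr1.
by case: k {IH} => [|k] /=; rewrite ?expr0 ?exprS; ring.
Qed.

Lemma flat_is_derive k t : is_derive t 1 (flat k) (flat k.+2 t - k%:R * flat k.+1 t).
Proof.
have [t0|t0|->] := ltgtP t 0.
- have fE j : flat j t = 0 by rewrite /flat ltNge ltW.
  rewrite !fE mulr0 subr0; apply: (@is_derive_ext _ (fun=> 0)).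
  near=> y; rewrite /flat ltNge ltW//.
  by near: y; exact: lt_nbhsl.
- rewrite /flat t0.
  apply: (@is_derive_ext _ (fun t => (t^-1) ^+ k * expR (- t^-1))).
    near=> y; have -> // : 0 < y by near: y; exact: lt_nbhsr.
  have t1 : t != 0 by rewrite gt_eqF.
  have dI : is_derive t 1 (fun t => t^-1) (- (t^-1) ^+ 2).
    have := is_derive_inv (is_derive_id t 1) t1; move/is_derive_eq; apply.
    by rewrite exprVn mulN1r.
  have de : is_derive t 1 (fun t => expR (- t^-1)) ((t^-1) ^+ 2 * expR (- t^-1)).
    have := is_derive_comp (is_derive_opp dI) (is_derive_expR (- t^-1)).
    by move/is_derive_eq; apply; rewrite opprK mulrC.
  have dk : is_derive t 1 (fun t => (t^-1) ^+ k) (- k%:R * (t^-1) ^+ k.+1).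
    have := is_derive_expn k dI; move/is_derive_eq; apply.
    by case: k => [|k] /=; rewrite ?exprS; ring.
  have := is_derive_mul dk de; move/is_derive_eq; apply.
  by rewrite !exprS; ring.
- have fE j : flat j 0 = 0 by rewrite /flat ltxx.
  rewrite !fE mulr0 subr0; apply: (@quad_is_derive0 _ (k.+2%:R ^+ k.+2)) => s.
  by rewrite ger0_norm ?flat_ge0 ?flat_quad.
Unshelve. all: by end_near. Qed.

(** The polynomial factor closes the family under differentiation: functions [flat] of lower index
    are powers of the argument times [flat k.+2], so the chain rule only changes [Q] and raises the
    index. *)
Definition flat_bump (Q : {poly R}) k x : R := Q.[x] * flat k (x * (1 - x)).

Lemma flat_lower k t : flat k t = t ^+ 2 * flat k.+2 t.
Proof.
rewrite /flat; case: ifPn => [t0|]; last by rewrite mulr0.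
have tt : t ^+ 2 * t^-1 ^+ 2 = 1 by rewrite -exprMn divff ?gt_eqF// expr1n.
by rewrite mulrA -[k.+2]addn2 [t^-1 ^+ (k + 2)]exprD [t ^+ 2 * _]mulrCA tt mulr1.
Qed.

Lemma flat_lower1 k t : flat k.+1 t = t * flat k.+2 t.
Proof.
rewrite /flat; case: ifPn => [t0|]; last by rewrite mulr0.
by rewrite mulrA [_ ^+ k.+2]exprS mulrA divff ?gt_eqF// mul1r.
Qed.

Lemma flat_bump_is_derive Q k x : exists Q', forall x,
  is_derive x 1 (flat_bump Q k) (flat_bump Q' k.+2 x).
Proof.
pose r : {poly R} := 'X * (1 - 'X); pose dr : {poly R} := 1 - 2%:P * 'X.
exists (Q^`() * r ^+ 2 + Q * dr * (1 - k%:R%:P * r)) => {}x.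
have d1 : is_derive x 1 (horner Q) (Q^`()).[x] by exact: is_derive_poly.
have dx : is_derive x 1 (fun y : R => y * (1 - y)) (1 - 2 * x).
  have := is_derive_mul (is_derive_id x 1) (is_derive_sub (is_derive_const 1 x) (is_derive_id x 1)).
  by move/is_derive_eq; apply; ring.
have d2 := is_derive_comp dx (flat_is_derive k (x * (1 - x))).
have := is_derive_mul d1 d2; move/is_derive_eq; apply.
rewrite /flat_bump [flat k _]flat_lower [flat k.+1 _]flat_lower1 /r /dr !hornerE/=.
by ring.
Qed.

Lemma smooth_flat_bump Q k : smooth (flat_bump Q k).
Proof.
have /choice[D DP] : forall z : {poly R} * nat, exists z' : {poly R} * nat,
    forall x, is_derive x 1 (flat_bump z.1 z.2) (flat_bump z'.1 z'.2 x).
  by move=> [P j]; have [P' PP] := flat_bump_is_derive P j 0; exists (P', j.+2).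
exists (fun n => let z := iter n D (Q, k) in flat_bump z.1 z.2); by split.
Qed.

Lemma smooth_bump_exists : exists f, [/\ smooth f, forall x, 0 <= f x,
  forall x, x <= 0 -> f x = 0, forall x, 1 <= x -> f x = 0 & forall x, 0 < x < 1 -> 0 < f x].
Proof.
exists (flat_bump 1 0); split; first exact: smooth_flat_bump.
- by move=> x; rewrite /flat_bump hornerE mul1r flat_ge0.
- by move=> x x0; rewrite /flat_bump /flat ifN ?mulr0// -leNgt; nra.
- by move=> x x0; rewrite /flat_bump /flat ifN ?mulr0// -leNgt; nra.
- move=> x /andP[x0 x1]; rewrite /flat_bump hornerE mul1r /flat.
  have -> : 0 < x * (1 - x) by rewrite mulr_gt0 ?subr_gt0.
  by rewrite mul1r expR_gt0.
Qed.

Lemma smooth_transition_exists : exists f, [/\ smooth f, forall x y, x <= y -> f x <= f y,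
  forall x, x <= 0 -> f x = 0 & forall x, 1 <= x -> f x = f 1] /\ 0 < f 1.
Proof.
have [b [sb b0 bl br bp]] := smooth_bump_exists.
have [F0 dF0] := primitive_exists (smooth_continuous sb).
pose F x := F0 x - F0 0.
have dF x : is_derive x 1 F (b x).
  by have := is_derive_sub (dF0 x) (is_derive_const (F0 0) x); rewrite subr0.
have mF x y : x <= y -> F x <= F y.
  by move=> xy; apply: (@is_derive_ndecr _ F b).
exists F; split; [split=> //|].
- exact: smooth_primitive dF.
- move=> x x0; have -> : F x = F 0; last by rewrite /F subrr.
  apply: (is_derive_cst_eq x0) => y /andP[_ y0].
  by have := dF y; rewrite bl.
- move=> x x1; apply/esym; apply: (is_derive_cst_eq x1) => y /andP[y1 _].
  by have := dF y; rewrite br.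
- have F00 : F 0 = 0 by rewrite /F subrr.
  have h : F (1/4) < F (3/4).
    apply: (@is_derive_incr _ F b); first lra.
    by move=> x /andP[x1 x2]; apply: bp; apply/andP; split; lra.
  have := mF 0 (1/4); have := mF (3/4) 1; rewrite F00.
  by move=> /(_ _)h1 /(_ _)h2; have := h1 _; have := h2 _; lra.
Qed.

(** The normalized primitive of a smooth plateau [chi], constant on [e, 1 - e]: its slope exceeds
    the minimal value 1 only because of the two margins. *)
Lemma smooth_step_exists (eta : R) : 0 < eta -> exists S dS : R -> R,
  [/\ smooth S, forall x, is_derive x 1 S (dS x), forall x, 0 <= dS x <= 1 + eta,
    forall x, x <= 0 -> S x = 0 /\ dS x = 0 & forall x, 1 <= x -> S x = 1 /\ dS x = 0].
Proof.
move=> eta0.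
have [T [[sT mT Tl Tr] T1]] := smooth_transition_exists.
(* Solves (1 - 2 e) (1 + eta) = 1, so that maximum over integral of [chi] is at most 1 + eta. *)
pose e := eta / (2 * (1 + eta)).
have e1 : 0 < 2 * (1 + eta) by lra.
have e0 : 0 < e by rewrite divr_gt0.
have e2 : e < 1 / 2.
  by rewrite /e ltr_pdivrMr//; lra.
have ee : (1 - 2 * e) * (1 + eta) = 1 by rewrite /e; field; lra.
pose chi x := T (e^-1 * x + 0) - T (e^-1 * x + (1 - e^-1)).
have ie : 1 < e^-1 by rewrite invf_gt1//; lra.
have T0 x : 0 <= T x.
  have [x0|/ltW x0] := leP x 0; first by rewrite Tl.
  by rewrite -(Tl 0)// mT.
have TT x : T x <= T 1.
  have [x1|/ltW x1] := leP x 1; first exact: mT.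
  by rewrite Tr.
have chi0 x : 0 <= chi x.
  by rewrite subr_ge0 mT//; lra.
have chi1 x : chi x <= T 1.
  by rewrite /chi; have := TT (e^-1 * x + 0); have := T0 (e^-1 * x + (1 - e^-1)); lra.
have schi : smooth chi.
  have h := smooth_add (smooth_affine e^-1 0 sT) (smooth_scale (- 1) (smooth_affine e^-1 (1 - e^-1) sT)).
  have -> // : chi = (fun x => T (e^-1 * x + 0) + -1 * T (e^-1 * x + (1 - e^-1))).
  by apply/funext => x; rewrite /chi mulN1r.
have [F0 dF0] := primitive_exists (smooth_continuous schi).
pose F x := F0 x - F0 0.
have dF x : is_derive x 1 F (chi x).
  by have := is_derive_sub (dF0 x) (is_derive_const (F0 0) x); rewrite subr0.
have F00 : F 0 = 0 by rewrite /F subrr.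
have mF x y : x <= y -> F x <= F y by move=> xy; apply: (@is_derive_ndecr _ F chi).
have ch x : e <= x <= 1 - e -> chi x = T 1.
  move=> /andP[x1 x2]; rewrite /chi Tr; last by rewrite addr0 mulrC ler_pdivlMr// mul1r.
  rewrite [X in _ - X]Tl ?subr0//.
  have : e^-1 * x <= e^-1 * (1 - e) by rewrite ler_pM2l// invr_gt0.
  by rewrite mulrBr mulVf ?gt_eqF//; lra.
have F1 : T 1 * (1 - 2 * e) <= F 1.
  have -> : T 1 * (1 - 2 * e) = F (1 - e) - F e.
    have e3 : e <= 1 - e by lra.
    have [c ce ->] := @is_derive_MVT _ F chi e (1 - e) e3 (fun x _ => dF x).
    by rewrite ch//; congr (_ * _); ring.
  have := mF 0 e (ltW e0); have := mF (1 - e) 1; rewrite F00.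
  by move=> h h2; have := h _; lra.
have Fp : 0 < F 1 by apply: lt_le_trans F1; rewrite mulr_gt0//; lra.
exists (fun x => (F 1)^-1 * F x), (fun x => (F 1)^-1 * chi x); split.
- by apply: smooth_scale; exact: smooth_primitive dF.
- by move=> x; exact: is_derive_scale.
- move=> x; rewrite mulr_ge0 ?invr_ge0 ?(ltW Fp)//= mulrC ler_pdivrMr//.
  apply: le_trans (chi1 x) _.
  have := ler_wpM2l (_ : 0 <= 1 + eta) F1; rewrite mulrCA [(1 + eta) * _]mulrC ee mulr1.
  by apply; lra.
- have chl x : x <= 0 -> chi x = 0.
    move=> x0; rewrite /chi !Tl ?subr0//; last by rewrite addr0 mulr_ge0_le0// invr_ge0 ltW.
    have : e^-1 * x <= 0 by rewrite mulr_ge0_le0// invr_ge0 ltW.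
    by lra.
  move=> x x0; rewrite chl// mulr0; split => //.
  have -> : F x = F 0; last by rewrite F00 mulr0.
  by apply: (is_derive_cst_eq x0) => y /andP[_ y0]; have := dF y; rewrite chl.
- have chr x : 1 <= x -> chi x = 0.
    move=> x1; have ey : e^-1 <= e^-1 * x by rewrite ler_pMr// invr_gt0.
    by rewrite /chi [T (_ + 0)]Tr ?[T (_ + (_ - _))]Tr ?subrr//; lra.
  move=> x x1; rewrite chr// mulr0; split => //.
  have <- : F 1 = F x; last by rewrite mulVf// gt_eqF.
  by apply: (is_derive_cst_eq x1) => y /andP[y1 _]; have := dF y; rewrite chr.
Qed.

End smooth_functions.

(** * Smooth interpolation with controlled p-energy *)

Section quasi_interpolation.
Context {R : realType}.
Variable p : R.
Hypothesis p1 : 1 < p.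
Implicit Types (f g F G u phi E : R -> R) (x c m t s delta eta : R).
Local Ltac plra := let H := fresh in pose proof p1 as H; lra.

Definition energy_control u G x1 x2 : Prop := forall s t, x1 <= s -> s <= t -> t <= x2 ->
  `|u t - u s| `^ p <= (t - s) `^ (p - 1) * (G t - G s).

(** Jensen's inequality on each subinterval, by integrating the tangent inequality of the p-th power
    at the mean slope [m]. *)
Lemma jensen u (du G : R -> R) x1 x2 :
  (forall x, x1 <= x <= x2 -> is_derive x 1 u (du x)) ->
  (forall x, x1 <= x <= x2 -> is_derive x 1 G (`|du x| `^ p)) -> energy_control u G x1 x2.
Proof.
move=> dU dG s t x1s; rewrite le_eqVlt => /predU1P[<- _|st tx2].
  rewrite !subrr mulr0 normr0 powR0//; plra.
have ts : 0 < t - s by lra.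
pose m := (u t - u s) / (t - s).
pose H x := G x - (`|m| `^ p * x + p * spow (p - 1) m * (u x - m * x)).
pose dH x := `|du x| `^ p - (`|m| `^ p * 1 + p * spow (p - 1) m * (du x - m * 1)).
have : H s <= H t.
  apply: (@is_derive_ndecr _ H dH); first exact: ltW.
    move=> x /andP[xs xt]; have xx : x1 <= x <= x2 by apply/andP; split; lra.
    apply: is_derive_sub; first exact: dG.
    have dm c : is_derive x 1 (fun y : R => c * y) (c * 1).
      by apply: is_derive_scale; exact: is_derive_id.
    exact: is_derive_add (dm _) (is_derive_scale _ (is_derive_sub (dU x xx) (dm _))).
  move=> x _; have := @abspow_tangent _ p m (du x) p1; rewrite /dH !mulr1; lra.
have e1 : m * (t - s) = u t - u s by rewrite divfK// gt_eqF.
have -> : (H s <= H t) = (`|m| `^ p * (t - s) <= G t - G s).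
  rewrite -subr_ge0 -[RHS]subr_ge0; congr (_ <= _); rewrite /H.
  have : u t - u s - m * (t - s) = 0 by rewrite e1 subrr.
  move=> h; apply/eqP; rewrite -subr_eq0; apply/eqP.
  transitivity (- (p * spow (p - 1) m) * (u t - u s - m * (t - s))); first by ring.
  by rewrite h mulr0.
move=> h; rewrite -e1 normrM (gtr0_norm ts) powRM ?(ltW ts)//.
rewrite -(@mulr_powRB1 _ (t - s) p) ?(ltW ts)//; last by plra.
rewrite mulrCA mulrA mulrC mulrCA mulrC -mulrA; apply: ler_wpM2l; first exact: powR_ge0.
by [].
Qed.

Lemma smooth_derive_continuous f (df : R -> R) : smooth f ->
  (forall x, is_derive x 1 f (df x)) -> continuous df.
Proof.
move=> [d [d0 dd]] dF; have -> : df = d 1%N.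
  apply/funext => x; apply: is_derive_unique (dF x) _.
  by have := dd 0%N x; rewrite d0.
by move=> x; exact: is_derive_continuous (dd 1%N x).
Qed.

(** One step per mesh interval: each added step is constant outside its interval, so smoothness is
    preserved and the energies of the intervals add up. *)
Lemma interpolation_ind u G x1 delta eta n : 0 < delta -> 0 < eta ->
  (forall i, (i < n)%N -> `|u (x1 + i.+1%:R * delta) - u (x1 + i%:R * delta)| `^ p <=
     delta `^ (p - 1) * (G (x1 + i.+1%:R * delta) - G (x1 + i%:R * delta))) ->
  exists phi dphi : R -> R,
  [/\ smooth phi, forall x, is_derive x 1 phi (dphi x),
   forall x, x <= x1 -> phi x = 0 /\ dphi x = 0 &
   forall x, x1 + n%:R * delta <= x -> phi x = u (x1 + n%:R * delta) - u x1 /\ dphi x = 0] /\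
  (forall E, (forall x, is_derive x 1 E (`|dphi x| `^ p)) ->
     E (x1 + n%:R * delta) - E x1 <= (1 + eta) `^ p * (G (x1 + n%:R * delta) - G x1)) /\
  (forall i x, (i < n)%N -> x1 + i%:R * delta <= x <= x1 + i.+1%:R * delta ->
     `|phi x - (u (x1 + i%:R * delta) - u x1)| <=
     `|u (x1 + i.+1%:R * delta) - u (x1 + i%:R * delta)|).
Proof.
move=> d0 eta0; have [S [dS [sS dSS dS1 Sl Sr]]] := smooth_step_exists eta0.
pose t (i : nat) := x1 + i%:R * delta.
have tS i : t i.+1 = t i + delta by rewrite /t -natr1; ring.
elim: n => [|n IH] uG.
  exists (fun=> 0), (fun=> 0); split; [split|split] => //.
  - exact: smooth_cst.
  - by move=> x; exact: is_derive_const.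
  - by move=> x _; rewrite mul0r addr0 subrr.
  - by move=> E _; rewrite mul0r addr0 !subrr mulr0.
have [i ilt|phi [dphi [[sphi dphiE phil phir] [phiE phiu]]]] := IH.
  by apply: uG; exact: ltnW.
rewrite -/(t n) in phir phiE.
pose Del := u (t n.+1) - u (t n).
pose z x := delta^-1 * x + - (delta^-1 * t n).
have zE x : z x = (x - t n) / delta by rewrite /z; ring.
have zl x : x <= t n -> z x <= 0.
  by move=> xt; rewrite zE mulr_le0_ge0 ?invr_ge0 ?(ltW d0)// subr_le0.
have zr x : t n.+1 <= x -> 1 <= z x.
  by move=> xt; rewrite zE ler_pdivlMr// mul1r; rewrite tS in xt; lra.
pose phi1 x := phi x + Del * S (z x).
pose dphi1 x := dphi x + Del * (delta^-1 * dS (z x)).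
have tn0 i : x1 <= t i by rewrite /t lerDl mulr_ge0// ltW.
have tmono i : (i <= n)%N -> t i <= t n.
  by move=> il; rewrite /t lerD2l ler_wpM2r ?ler_nat// ltW.
have d1 x : is_derive x 1 phi1 (dphi1 x).
  apply: is_derive_add => //; apply: is_derive_scale.
  exact: is_derive_affine_comp.
have phi1l x : x <= t n -> phi1 x = phi x /\ dphi1 x = dphi x.
  by move=> xt; rewrite /phi1 /dphi1; have [-> ->] := Sl _ (zl _ xt); rewrite !mulr0 !addr0.
exists phi1, dphi1; split; [split|split] => //.
- apply: smooth_add => //; apply: smooth_scale; exact: smooth_affine.
- move=> x xx1; have [|-> ->] := phi1l x; first exact: le_trans (tn0 n).
  exact: phil.
- move=> x; rewrite -/(t n.+1) => xt; have [Se dSe] := Sr _ (zr _ xt).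
  have [|pe dpe] := phir x; first by apply: le_trans xt; rewrite tS lerDl ltW.
  by rewrite /phi1 /dphi1 Se dSe pe dpe /Del !mulr0 addr0; split=> //; ring.
- move=> E dE; rewrite -/(t n.+1).
  have cphi : continuous (fun x => `|dphi x| `^ p).
    move=> x; apply: abspow_comp_continuous; first by plra.
    exact: smooth_derive_continuous sphi dphiE x.
  have [E0 dE0] := primitive_exists cphi.
  have := phiE E0 dE0.
  have -> : E0 (t n) - E0 x1 = E (t n) - E x1.
    have : E0 x1 - E x1 = E0 (t n) - E (t n).
      apply: (@is_derive_cst_eq _ (fun x => E0 x - E x)) => // x /andP[_ xt].
      have := is_derive_sub (dE0 x) (dE x).
      by have [_ ->] := phi1l x xt; rewrite subrr.
    by lra.
  have tt : t n <= t n.+1 by rewrite tS lerDl ltW.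
  have [c /andP[c1 c2]] := is_derive_MVT tt (fun x _ => dE x).
  have dt : t n.+1 - t n = delta by rewrite tS; ring.
  rewrite dt => Ec h.
  have : E (t n.+1) - E (t n) <= (1 + eta) `^ p * (G (t n.+1) - G (t n)).
    rewrite Ec /dphi1; have [_ ->] := phir c c1; rewrite add0r.
    have := uG n (ltnSn n); rewrite -/(t n.+1) -/(t n) -/Del.
    set DG := G (t n.+1) - G (t n) => hG.
    have /andP[dS0 dSc] := dS1 (z c).
    have p0 : 0 < p by plra.
    have e1 : (delta^-1) `^ p * (delta `^ (p - 1) * delta) = 1.
      rewrite [delta `^ _ * _]mulrC mulr_powRB1 ?(ltW d0)//.
      by rewrite -powRM ?invr_ge0 ?(ltW d0)// mulVf ?gt_eqF// powR1.
    rewrite !normrM (ger0_norm dS0) (gtr0_norm (_ : 0 < delta^-1)) ?invr_gt0//.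
    rewrite !powRM ?mulr_ge0 ?invr_ge0 ?(ltW d0)//.
    have h3 : dS (z c) `^ p <= (1 + eta) `^ p.
      by apply: ge0_ler_powR; rewrite ?nnegrE ?(ltW p0)//; lra.
    have h4 := ler_pM (powR_ge0 _ _) (powR_ge0 _ _) hG h3.
    have d0p : 0 <= (delta^-1) `^ p * delta by rewrite mulr_ge0 ?powR_ge0 ?(ltW d0).
    have := ler_wpM2r d0p h4.
    rewrite (_ : delta `^ (p - 1) * DG * _ * _ =
      (1 + eta) `^ p * DG * ((delta^-1) `^ p * (delta `^ (p - 1) * delta))); last by ring.
    rewrite e1 mulr1; apply: le_trans.
    by rewrite le_eqVlt; apply/orP; left; apply/eqP; ring.
  by move=> h2; rewrite -(subrKA (G (t n))) mulrDr -(subrKA (E (t n))); lra.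
- move=> i x; rewrite ltnS leq_eqVlt => /predU1P[->|il] xi; last first.
    have [|-> _] := phi1l x; last exact: phiu.
    by case/andP: xi => _ /le_trans; apply; exact: (tmono i.+1).
  rewrite -/(t n) -/(t n.+1) in xi *; case/andP: xi => tx xt.
  have [pe _] := phir x tx.
  rewrite /phi1 pe addrAC subrr add0r -/Del normrM ler_piMr//.
  have mS y y' : y <= y' -> S y <= S y'.
    by move=> yy; apply: (@is_derive_ndecr _ S dS) => // w _; case/andP: (dS1 w).
  have [z1|/ltW z1] := leP 1 (z x); first by have [-> _] := Sr _ z1; rewrite normr1.
  have z0 : 0 <= z x by rewrite zE divr_ge0 ?(ltW d0)// subr_ge0.
  have := mS _ _ z0; have := mS _ _ z1.
  have [-> _] := Sl 0 (lexx _); have [-> _] := Sr 1 (lexx _) => h1 h0.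
  by rewrite ger0_norm.
Qed.

(* On a fine mesh, [u] is replaced between consecutive nodes by a smooth step whose slope
   exceeds that of the chord by a factor at most [1 + eta]; by convexity the chord does
   not increase the p-energy. *)
Lemma interpolation u G x1 x2 eta : x1 < x2 -> 0 < eta -> energy_control u G x1 x2 ->
  u x1 = 0 -> u x2 = 0 ->
  exists phi dphi : R -> R,
  [/\ smooth phi, forall x, is_derive x 1 phi (dphi x),
   forall x, ~ (x1 < x < x2) -> phi x = 0 /\ dphi x = 0,
   forall E, (forall x, is_derive x 1 E (`|dphi x| `^ p)) ->
     E x2 - E x1 <= (1 + eta) `^ p * (G x2 - G x1) &
   forall x, x1 <= x <= x2 -> `|phi x - u x| <= eta].
Proof.
move=> x12 eta0 uG u1 u2.
have p0 : 0 < p by plra.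
pose K := G x2 - G x1.
have Gm s t : x1 <= s -> s <= t -> t <= x2 -> 0 <= G t - G s.
  move=> xs; rewrite le_eqVlt => /predU1P[<- _|st tx]; first by rewrite subrr.
  have := uG s t xs (ltW st) tx; move/(le_trans (powR_ge0 _ _)).
  by rewrite pmulr_rge0// powR_gt0// subr_gt0.
have K0 : 0 <= K by apply: Gm => //; exact: ltW.
(* For this mesh size the bound on increments, (t - s)^(p-1) K, is at most (eta / 2)^p: the
   oscillation on a mesh interval is at most eta / 2. *)
pose d0 := ((eta / 2) `^ p / (K + 1)) `^ (p - 1)^-1.
have d0p : 0 < d0 by rewrite powR_gt0// divr_gt0 ?powR_gt0//; lra.
pose n := (Num.bound ((x2 - x1) / d0)).+1.
pose delta := (x2 - x1) / n%:R.
have n0 : 0 < (n%:R : R) by rewrite ltr0n.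
have delta0 : 0 < delta by rewrite divr_gt0// subr_gt0.
have deltad : delta <= d0.
  have q0 : 0 <= (x2 - x1) / d0 by rewrite divr_ge0 ?(ltW d0p)//; lra.
  have := archi_boundP q0; rewrite ltr_pdivrMr// => h.
  rewrite ler_pdivrMr// mulrC; apply: le_trans (ltW h) _.
  by rewrite ler_pM2r// /n ler_nat.
have nd : x1 + n%:R * delta = x2 by rewrite /delta mulrC divfK ?gt_eqF//; ring.
pose t (i : nat) := x1 + i%:R * delta.
have tS i : t i.+1 = t i + delta by rewrite /t -natr1; ring.
have t1 i : x1 <= t i by rewrite /t lerDl mulr_ge0// ltW.
have t2 i : (i <= n)%N -> t i <= x2.
  by move=> il; rewrite -nd /t lerD2l ler_wpM2r ?ler_nat// ltW.
have osc s x : x1 <= s -> s <= x -> x <= x2 -> x - s <= delta -> `|u x - u s| <= eta / 2.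
  move=> xs sx xx sd.
  have h := uG s x xs sx xx.
  have h2 : (x - s) `^ (p - 1) * (G x - G s) <= (eta / 2) `^ p.
    have hG : G x - G s <= K + 1.
      by have := Gm _ _ (lexx x1) xs; have := Gm x x2; rewrite /K; lra.
    have hx : (x - s) `^ (p - 1) <= (eta / 2) `^ p / (K + 1).
      have pN : p - 1 != 0 by rewrite gt_eqF//; plra.
      have -> : (eta / 2) `^ p / (K + 1) = d0 `^ (p - 1).
        by rewrite /d0 -powRrM mulVf// powRr1// divr_ge0 ?powR_ge0//; lra.
      by apply: ge0_ler_powR; rewrite ?nnegrE ?(ltW d0p)//; plra.
    have := ler_pM (powR_ge0 _ _) (Gm _ _ xs sx xx) hx hG.
    by rewrite divfK// gt_eqF//; lra.
  rewrite leNgt; apply/negP => lt; have := le_trans h h2; apply/negP; rewrite -ltNge.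
  by apply: gt0_ltr_powR; rewrite ?nnegrE//; lra.
have step i : (i < n)%N -> `|u (x1 + i.+1%:R * delta) - u (x1 + i%:R * delta)| `^ p <=
     delta `^ (p - 1) * (G (x1 + i.+1%:R * delta) - G (x1 + i%:R * delta)).
  move=> il; have ti : t i <= t i.+1 by rewrite tS lerDl ltW.
  have := uG (t i) (t i.+1) (t1 i) ti (t2 i.+1 il).
  by have -> : t i.+1 - t i = delta by rewrite tS; ring.
have [phi [dphi [[sphi dphiE phil phir] [phiE phiu]]]] := interpolation_ind delta0 eta0 step.
rewrite nd u1 u2 subrr in phir phiE.
exists phi, dphi; split => //.
- move=> x xx; have [/phil//|x1x] := leP x x1; apply: phir.
  by rewrite leNgt; apply/negP => xx2; apply: xx; rewrite x1x.
- move=> x /andP[x1x xx2].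
  have [i il /andP[tx xt]] : exists2 i, (i < n)%N & t i <= x <= t i.+1.
    have tn : x <= t n by rewrite /t nd.
    have : (0 < n)%N by [].
    elim: (n) tn => [//|j IH] xj _.
    case: j IH xj => [|j] IH xj.
      by exists 0%N; rewrite // xj andbT /t mul0r addr0.
    have [xtj|/ltW xtj] := leP x (t j.+1); last by exists j.+1; rewrite ?xtj.
    by have [i ij txi] := IH xtj (ltn0Sn j); exists i => //; exact: ltnW.
  have h1 := phiu i x il; rewrite -/(t i) -/(t i.+1) tx xt u1 subr0 in h1.
  have h2 := h1 isT.
  have h3 : `|u (t i.+1) - u (t i)| <= eta / 2.
    by apply: osc => //; [rewrite tS lerDl ltW|exact: t2|rewrite tS; lra].
  have h4 : `|u x - u (t i)| <= eta / 2 by apply: osc => //; rewrite tS in xt; lra.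
  rewrite -(subrKA (u (t i))); apply: le_trans (ler_normD _ _) _.
  by rewrite distrC in h4; lra.
Qed.

End quasi_interpolation.

(** * Truncated eigenfunctions *)

Section ground_state.
Context {R : realType}.
Variable p : R.
Hypothesis p1 : 1 < p.
Implicit Types (V w Psi : R -> R) (a b c x m t k B lam eps : R).
Local Ltac plra := let H := fresh in pose proof p1 as H; lra.
Local Notation q := (conjugate p).
Local Notation r := ((p - 1)^-1).

Let r0 : 0 < r. Proof. by rewrite invr_gt0; plra. Qed.
Let q1 : 1 < q. Proof. exact: conjugate_gt1. Qed.

(** With u'/u = spow r w, both sides equal |u'/u|^p. *)
Lemma spow_conj y : y * spow r y = `|y| `^ q.
Proof.
have rq : r + 1 = q by rewrite -conjugate_subr1//; ring.
have qN0 : q != 0 by rewrite gt_eqF//; have := q1; lra.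
have [y0|y0|->] := ltgtP y 0.
- rewrite spow_lt0E// (ltr0_norm y0) mulrN -mulNr -rq addrC.
  rewrite powRD; last by rewrite oppr_eq0 (lt_eqF y0) implybT.
  by rewrite powRr1 1?mulrC// oppr_ge0 ltW.
- rewrite spow_gt0E// (gtr0_norm y0) -rq addrC.
  rewrite powRD; last by rewrite (gt_eqF y0) implybT.
  by rewrite powRr1 1?mulrC// ltW.
- by rewrite spow0 mulr0 abspow0.
Qed.

Lemma abspow_ge M : 1 <= M -> M <= M `^ q.
Proof.
move=> M1; have := @ler_powR _ M M1 1 q (ltW q1); rewrite powRr1//; lra.
Qed.

Lemma expR_dot_is_derive Psi dPsi x c : is_derive x 1 Psi dPsi ->
  is_derive x 1 (fun y => expR (c * Psi y)) (c * dPsi * expR (c * Psi x)).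
Proof.
move=> d; have := is_derive_comp (is_derive_scale c d) (is_derive_expR (c * Psi x)).
by move/is_derive_eq; apply; rewrite mulrC.
Qed.

(** Shows that the eigenfunction U = exp Psi tends to 0 at [a], hence takes every small value [k].
    Where [w] is large, U^c w is nondecreasing; it therefore stays bounded towards [a], while [w]
    tends to +oo. *)
Lemma ground_start V B lam w Psi a b m : (forall x, a < x < b -> `|V x| <= B) ->
  ground p a b V lam w -> (forall x, a < x < b -> is_derive x 1 Psi (spow r (w x))) ->
  a < m < b -> exists a1, [/\ a < a1, a1 < m, forall x, a < x <= a1 -> 0 < w x &
    forall k, 0 < k -> k < expR (Psi a1) ->
      exists x1, [/\ a < x1, x1 < a1 & expR (Psi x1) = k]].
Proof.
move=> VB [dw wa _] dPsi /andP[am mb].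
have p0 : 0 < p - 1 by plra.
have B0 : 0 <= B by apply: le_trans (VB m _); rewrite ?am.
pose M := Num.max 1 ((B + `|lam|) / (p - 1)).
have M1 : 1 <= M by rewrite le_max lexx.
have MB : B + `|lam| <= (p - 1) * M.
  by rewrite mulrC -ler_pdivrMr// le_max lexx orbT.
have [t /andP[at_ tb] tP] := wa M.
pose a1 := (a + Num.min t m) / 2.
have [aa1 a1t a1m] : [/\ a < a1, a1 < t & a1 < m].
  by rewrite /a1; case: (leP t m) => ?; split; lra.
have wM x : a < x <= a1 -> M < w x.
  by move=> /andP[ax xa]; apply: tP; rewrite ax; apply: le_lt_trans a1t.
exists a1; split => // [x /wM|k k0 kU]; first by apply: lt_trans; apply: lt_le_trans M1.
(* Twice the coefficient of [ric]: the derivative of [z] keeps (p - 1) |w|^q, which dominates V -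
   lam above the threshold [M]. *)
pose c := 2 * (p - 1); have c0 : 0 < c by rewrite mulr_gt0.
pose z x := expR (c * Psi x) * w x.
have zmono s : a < s -> s <= a1 -> z s <= z a1.
  move=> as_ sa; pose dz x := c * spow r (w x) * expR (c * Psi x) * w x +
    expR (c * Psi x) * (V x - lam - ric p (w x)).
  apply: (@is_derive_ndecr _ z dz _ _ sa) => x /andP[sx xa1].
    have xab : a < x < b by apply/andP; split; lra.
    by apply: is_derive_mul; [apply: expR_dot_is_derive; exact: dPsi|exact: dw].
  have xab : a < x < b by apply/andP; split; lra.
  have -> : dz x = expR (c * Psi x) * (c * (w x * spow r (w x)) + (V x - lam - ric p (w x))).
    by rewrite /dz; ring.
  rewrite mulr_ge0 ?expR_ge0// spow_conj /ric.
  have wx : M < w x by apply: wM; apply/andP; split; lra.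
  have wp : 1 <= w x by lra.
  have h1 := abspow_ge wp.
  have h2 : (p - 1) * M <= (p - 1) * w x by rewrite ler_pM2l// ltW.
  have h3 : (p - 1) * w x <= (p - 1) * `|w x| `^ q.
    by rewrite ler_pM2l// ger0_norm//; lra.
  have := VB x xab; rewrite ler_norml => /andP[v1 v2]; have := ler_norm lam.
  have -> : c * `|w x| `^ q = 2 * ((p - 1) * `|w x| `^ q) by rewrite /c; ring.
  by lra.
have za1 : 0 < z a1.
  by rewrite mulr_gt0 ?expR_gt0//; have := wM a1; rewrite aa1 lexx => /(_ isT); lra.
pose kc := expR (c * ln k).
have kc0 : 0 < kc by exact: expR_gt0.
have [t' /andP[at' t'b] t'P] := wa (z a1 / kc).
pose s := (a + Num.min t' a1) / 2.
have [as_ st sa1] : [/\ a < s, s < t' & s < a1].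
  by rewrite /s; case: (leP t' a1) => ?; split; lra.
have Us : expR (Psi s) < k.
  have h1 := zmono s as_ (ltW sa1); have h2 := t'P s; rewrite as_ st in h2.
  have ws : 0 < w s by apply: lt_trans (h2 isT); rewrite divr_gt0.
  have h3 : expR (c * Psi s) < kc.
    rewrite -(ltr_pM2r ws); apply: le_lt_trans h1 _.
    by rewrite mulrC -ltr_pdivrMr//; exact: h2.
  by move: h3; rewrite /kc ltr_expR ltr_pM2l// => h3; rewrite -(lnK k0) ltr_expR.
have [||x1 x1s x1k] := @IVT _ (fun x => expR (Psi x)) s a1 k (ltW sa1).
- apply: (@is_derive_within _ _ (fun x => 1 * spow r (w x) * expR (1 * Psi x))) => x /andP[sx xa].
  have dx : is_derive x 1 Psi (spow r (w x)) by apply: dPsi; apply/andP; split; lra.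
  have := expR_dot_is_derive 1 dx.
  have -> // : (fun y => expR (1 * Psi y)) = (fun y => expR (Psi y)).
  by apply/funext => y; rewrite mul1r.
- by rewrite ge_min le_max (ltW Us) (ltW kU) orbT.
exists x1; split => //; move: x1s; rewrite in_itv/= => /andP[h1 h2]; first by lra.
rewrite lt_neqAle h2 andbT; apply/eqP => e; move: kU; rewrite -e x1k ltxx//.
Qed.

(** Lowering [y] by [k] changes its p-th power by at most p M^(p-1) k, by the tangent inequality at
    [y]. *)
Lemma truncation_cost (v B lam y M k : R) : `|v| <= B -> 0 < k -> k <= y -> y <= M ->
  (v - lam) * (`|y - k| `^ p - y `^ p) <= (B + `|lam|) * (p * M `^ (p - 1)) * k.
Proof.
move=> vB k0 ky yM; have p0 : 0 < p by plra.
have y0 : 0 < y by exact: lt_le_trans ky.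
have h1 := @abspow_tangent _ p y (y - k) p1.
rewrite (gtr0_norm y0) spow_gt0E// in h1.
have yk : 0 <= y - k by rewrite subr_ge0.
have h2 : `|y - k| `^ p <= y `^ p.
  rewrite ger0_norm//; apply: ge0_ler_powR; rewrite ?nnegrE ?(ltW p0) ?(ltW y0)//.
  by rewrite gerBl ltW.
have h3 : y `^ (p - 1) <= M `^ (p - 1).
  apply: ge0_ler_powR; rewrite ?nnegrE ?(ltW y0)//; first plra.
  exact: le_trans (ltW y0) yM.
have h4 : y `^ p - `|y - k| `^ p <= p * M `^ (p - 1) * k.
  have : p * y `^ (p - 1) * k <= p * M `^ (p - 1) * k.
    by rewrite ler_pM2r// ler_pM2l.
  rewrite (_ : y - k - y = - k) ?mulrN in h1; last by ring.
  by clear -h1; lra.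
apply: le_trans (_ : (B + `|lam|) * (y `^ p - `|y - k| `^ p) <= _).
  rewrite (_ : (v - lam) * _ = (lam - v) * (y `^ p - `|y - k| `^ p)); last by ring.
  apply: ler_wpM2r; first by rewrite subr_ge0.
  have := vB; rewrite ler_norml => /andP[v1 v2]; have := ler_norm lam.
  by clear -v1; lra.
by rewrite -mulrA ler_wpM2l// addr_ge0// (le_trans _ vB).
Qed.

(* [U = exp (int spow w)] is the eigenfunction; [U - k], cut off at the level [k], has an
   energy excess of order [k] since [(w U^p)' = |U'|^p + (V - lam) U^p]. *)
Lemma ground_profile V B lam w a b eps : a < b -> continuous V -> (forall x, `|V x| <= B) ->
  ground p a b V lam w -> 0 < eps ->
  exists (x1 x2 : R) (u du P N W : R -> R),
  [/\ a < x1, x1 < x2, x2 < b, u x1 = 0 & u x2 = 0] /\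
  [/\ forall x, x1 <= x <= x2 -> is_derive x 1 u (du x),
      forall x, x1 <= x <= x2 -> is_derive x 1 P (`|du x| `^ p),
      forall x, x1 <= x <= x2 -> is_derive x 1 N (`|u x| `^ p),
      forall x, x1 <= x <= x2 -> is_derive x 1 W (V x * `|u x| `^ p) &
      (P x2 - P x1) + (W x2 - W x1) <= (lam + eps) * (N x2 - N x1) /\ 0 < N x2 - N x1].
Proof.
move=> ab cV VB gw eps0.
have [dw _ _] := gw.
pose m := (a + b) / 2; have mab : a < m < b by apply/andP; split; rewrite /m; lra.
have cw x : a < x < b -> {for x, continuous (fun x => spow r (w x))}.
  move=> xab; apply: (@continuous_comp _ _ _ w (spow r)).
    exact: ground_continuous gw xab.
  exact: spow_continuous.
have [Psi _ dPsi] := primitive_oo mab cw.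
have [a1 [aa1 a1m wa1 a1P]] := ground_start (fun x _ => VB x) gw dPsi mab.
have [b1 [mb1 b1b wb1 b1P]] : exists b1, [/\ m < b1, b1 < b, forall x, b1 <= x < b -> w x < 0 &
    forall k, 0 < k -> k < expR (Psi b1) ->
      exists x2, [/\ b1 < x2, x2 < b & expR (Psi x2) = k]].
  have dPsi' x : - b < x < - a -> is_derive x 1 (fun y => Psi (- y)) (spow r (- w (- x))).
    move=> /andP[bx xa]; have xab : a < - x < b by apply/andP; split; lra.
    have := is_derive_comp (is_derive_opp (is_derive_id x 1)) (dPsi _ xab).
    by move/is_derive_eq; apply; rewrite spowN mulrN1.
  have mba : - b < - m < - a by rewrite !ltrN2; case/andP: mab => -> ->.
  have [c [bc cm wc cP]] := ground_start (fun x _ => VB (- x)) (ground_reflect gw) dPsi' mba.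
  exists (- c); split; [lra|lra| |].
    move=> x /andP[cx xb]; have := wc (- x); rewrite opprK oppr_gt0; apply.
    by apply/andP; split; lra.
  move=> k k0 kU; have [x [bx xc xk]] := cP k k0 kU.
  by exists (- x); split => //; lra.
pose U x := expR (Psi x).
pose dU x := spow r (w x) * U x.
have dUE x : a < x < b -> is_derive x 1 U (dU x).
  move=> xab; have := is_derive_comp (dPsi x xab) (is_derive_expR (Psi x)).
  by move/is_derive_eq; apply; rewrite mulrC.
have cU x : a < x < b -> {for x, continuous U} by move=> /dUE; exact: is_derive_continuous.
have U0 x : 0 < U x by exact: expR_gt0.
have a1b1 : a1 <= b1 by lra.
have cU1 : {within `[a1, b1], continuous U}.
  by apply: (@is_derive_within _ _ dU) => x /andP[? ?]; apply: dUE; apply/andP; split; lra.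
have [cm cm1 cmP] := EVT_min a1b1 cU1.
have [cM cM1 cMP] := EVT_max a1b1 cU1.
have p0 : 0 < p by plra.
pose C := (B + `|lam|) * (p * U cM `^ (p - 1)) * (b - a).
have B0 : 0 <= B by exact: le_trans (VB 0).
have C0 : 0 <= C.
  apply: mulr_ge0; last lra.
  by apply: mulr_ge0; [rewrite addr_ge0|apply: mulr_ge0; [exact: ltW|exact: powR_ge0]].
(* A lower bound for the norm that does not depend on [k]: on [a1, b1] one has U - k >= U cm / 2.
   Then [k] is taken so small that the excess C k is at most eps N0. *)
pose N0 := (b1 - a1) * (U cm / 2) `^ p.
have N00 : 0 < N0 by rewrite mulr_gt0 ?powR_gt0 ?divr_gt0//; lra.
pose k := Num.min (U cm / 2) (eps * N0 / (C + 1)).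
have k0 : 0 < k.
  rewrite lt_min; apply/andP; split; apply: divr_gt0 => //; first exact: mulr_gt0.
  by rewrite ltr_wpDl.
have kU : k <= U cm / 2 by rewrite /k ge_min lexx.
have kC : C * k <= eps * N0.
  have : k <= eps * N0 / (C + 1) by rewrite /k ge_min lexx orbT.
  rewrite ler_pdivlMr; last by rewrite ltr_wpDl.
  by rewrite mulrDr mulr1 mulrC; lra.
have Um : forall x, a1 <= x <= b1 -> U cm <= U x <= U cM.
  by move=> x xab; rewrite cmP ?cMP// in_itv.
have Ucm := U0 cm.
have k2 : k < U cm by lra.
have ka : k < expR (Psi a1).
  by apply: lt_le_trans k2 _; have /andP[] := Um a1 ltac:(by rewrite lexx).
have kb : k < expR (Psi b1).
  by apply: lt_le_trans k2 _; have /andP[] := Um b1 ltac:(by rewrite lexx andbT).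
have [x1 [ax1 x1a U1]] := a1P k k0 ka.
have [x2 [bx2 x2b U2]] := b1P k k0 kb.
have dPsiI s t : a < s -> t < b -> forall x, s <= x <= t -> is_derive x 1 Psi (spow r (w x)).
  by move=> as_ tb x /andP[sx xt]; apply: dPsi; apply/andP; split; lra.
have Ux : forall x, x1 <= x <= x2 -> k <= U x <= U cM.
  move=> x /andP[x1x xx2]; have [xa|/ltW ax] := leP x a1; last have [xb|/ltW bx] := leP x b1.
  - have mono s t : x1 <= s -> s <= t -> t <= a1 -> U s <= U t.
      move=> xs st ta; rewrite ler_expR; apply: (@is_derive_ndecr _ Psi (fun x => spow r (w x))) => //.
        by apply: dPsiI; lra.
      by move=> y /andP[sy yt]; rewrite ltW// spow_gt0// wa1//; apply/andP; split; lra.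
    apply/andP; split; first by rewrite -U1; exact: (mono x1 x).
    apply: le_trans (mono _ _ x1x xa (lexx _)) _.
    by have /andP[] := Um a1 ltac:(by rewrite lexx).
  - have /andP[h1 ->] := Um x ltac:(by rewrite ax); rewrite andbT; lra.
  - have mono s t : b1 <= s -> s <= t -> t <= x2 -> U t <= U s.
      move=> xs st ta; rewrite ler_expR -lerN2.
      apply: (@is_derive_ndecr _ (fun x => - Psi x) (fun x => - spow r (w x))) => //.
        by move=> y yst; apply: is_derive_opp; apply: dPsiI yst; lra.
      by move=> y /andP[sy yt]; rewrite oppr_ge0 ltW// spow_lt0// wb1//; apply/andP; split; lra.
    apply/andP; split; first by rewrite -U2; exact: (mono x x2).
    apply: le_trans (mono _ _ (lexx _) bx xx2) _.
    by have /andP[] := Um b1 ltac:(by rewrite lexx andbT).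
pose u x := U x - k.
have du x : a < x < b -> is_derive x 1 u (dU x).
  by move=> xab; have := is_derive_sub (dUE x xab) (is_derive_const k x); rewrite subr0.
have cdU x : a < x < b -> {for x, continuous dU}.
  by move=> xab; apply: cvgM; [exact: cw|exact: cU].
have cP x : a < x < b -> {for x, continuous (fun x => `|dU x| `^ p)}.
  by move=> xab; apply: abspow_comp_continuous => //; exact: cdU.
have cN x : a < x < b -> {for x, continuous (fun x => `|u x| `^ p)}.
  move=> xab; apply: abspow_comp_continuous => //.
  exact: is_derive_continuous (du x xab).
have cW x : a < x < b -> {for x, continuous (fun x => V x * `|u x| `^ p)}.
  by move=> xab; apply: cvgM; [exact: cV|exact: cN].
have [P _ dP] := primitive_oo mab cP.
have [N _ dN] := primitive_oo mab cN.
have [W _ dW] := primitive_oo mab cW.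
have x12 : x1 < x2 by lra.
have xI x : x1 <= x <= x2 -> a < x < b.
  by move=> /andP[h1 h2]; rewrite (lt_le_trans ax1 h1) (le_lt_trans h2 x2b).
exists x1, x2, u, dU, P, N, W; split; first by split=> //; rewrite /u /U ?U1 ?U2 subrr.
split; [by move=> x /xI /du|by move=> x /xI /dP|by move=> x /xI /dN|by move=> x /xI /dW|].
have Nmono s t : x1 <= s -> s <= t -> t <= x2 -> N s <= N t.
  move=> xs st tx; apply: (@is_derive_ndecr _ N (fun x => `|u x| `^ p)) => //.
  by move=> x /andP[sx xt]; apply/dN/xI; rewrite (le_trans xs sx) (le_trans xt tx).
have NN0 : N0 <= N x2 - N x1.
  have [|c cc Nc] := @is_derive_MVT _ N (fun x => `|u x| `^ p) a1 b1 a1b1.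
    by move=> x /andP[ax xb]; apply: dN; rewrite (lt_le_trans aa1 ax) (le_lt_trans xb b1b).
  have h1 : N0 <= N b1 - N a1.
    rewrite Nc /N0 mulrC; apply: ler_wpM2r; first lra.
    have /andP[h _] := Um c cc.
    apply: ge0_ler_powR; rewrite ?nnegrE ?(ltW p0)//; first by rewrite divr_ge0 ?ltW.
    by rewrite /u ger0_norm; clear -h kU k2; lra.
  have a1x2 : a1 <= x2 := le_trans a1b1 (ltW bx2).
  have h2 := Nmono b1 x2 (le_trans (ltW x1a) a1b1) (ltW bx2) (lexx _).
  have h3 := Nmono x1 a1 (lexx _) (ltW x1a) a1x2.
  by apply: le_trans h1 _; exact: lerB.
split; last by apply: lt_le_trans NN0.
suff : P x2 - P x1 + (W x2 - W x1) - lam * (N x2 - N x1) <= C * k.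
  have : eps * N0 <= eps * (N x2 - N x1) by rewrite ler_pM2l.
  by rewrite mulrDl; lra.
pose A := (B + `|lam|) * (p * U cM `^ (p - 1)) * k.
pose F x := w x * expR (p * Psi x).
(* The derivative of [H] is A minus the cost of truncation, hence nonnegative; the boundary terms
   satisfy F x2 <= 0 <= F x1, by the signs of [w] at the two ends. *)
pose H x := A * x + F x + lam * N x - P x - W x.
pose dH x := A * 1 + ((V x - lam - ric p (w x)) * expR (p * Psi x) +
   w x * (p * spow r (w x) * expR (p * Psi x))) + lam * `|u x| `^ p - `|dU x| `^ p - V x * `|u x| `^ p.
have A0 : 0 <= A.
  apply: mulr_ge0; last exact: ltW.
  by apply: mulr_ge0; [rewrite addr_ge0|apply: mulr_ge0; [exact: ltW|exact: powR_ge0]].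
have : H x1 <= H x2.
  apply: (@is_derive_ndecr _ H dH); first exact: ltW.
    move=> x /xI xab; have di : is_derive x 1 (fun y : R => A * y) (A * 1).
      by apply: is_derive_scale; exact: is_derive_id.
    have dF : is_derive x 1 F ((V x - lam - ric p (w x)) * expR (p * Psi x) +
        w x * (p * spow r (w x) * expR (p * Psi x))).
      by apply: is_derive_mul; [exact: dw|apply: expR_dot_is_derive; exact: dPsi].
    exact: is_derive_sub (is_derive_sub (is_derive_add (is_derive_add di dF)
      (is_derive_scale lam (dN x xab))) (dP x xab)) (dW x xab).
  move=> x xx; have /andP[kUx UxM] := Ux x xx.
  have e1 : expR (p * Psi x) = U x `^ p by rewrite /U -expRM mulrC.
  have e2 : `|dU x| `^ p = `|w x| `^ q * U x `^ p.
    rewrite /dU normrM powRM// (gtr0_norm (U0 x)) normr_spow// -powRrM.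
    by rewrite [r * p]mulrC.
  have -> : dH x = A - (V x - lam) * (`|u x| `^ p - U x `^ p).
    rewrite /dH e1 e2 /ric.
    have -> : w x * (p * spow r (w x) * U x `^ p) = p * (w x * spow r (w x)) * U x `^ p by ring.
    by rewrite spow_conj; ring.
  by rewrite subr_ge0; apply: truncation_cost.
have F1 : F x2 <= 0 by rewrite /F mulr_le0_ge0 ?expR_ge0// ltW// wb1// (ltW bx2).
have F2 : 0 <= F x1 by rewrite /F mulr_ge0 ?expR_ge0// ltW// wa1// ax1 ltW.
have AC : A * (x2 - x1) <= C * k.
  have -> : C * k = A * (b - a) by rewrite /C /A; ring.
  apply: ler_wpM2l => //; apply: lerB; exact: ltW.
rewrite /H mulrBr in AC *; move: AC F1 F2.
move: (A * x1) (A * x2) (F x1) (F x2) (P x1) (P x2) (W x1) (W x2) (C * k) => *.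
by rewrite mulrBr; lra.
Qed.

Lemma abspow_lipschitz M x y : `|x| <= M -> `|y| <= M ->
  `| `|x| `^ p - `|y| `^ p| <= p * M `^ (p - 1) * `|x - y|.
Proof.
have p0 : 0 < p by plra.
have main (u v : R) : `|u| <= M -> `|u| `^ p - `|v| `^ p <= p * M `^ (p - 1) * `|u - v|.
  move=> uM; have h := @abspow_tangent _ p u v p1.
  apply: le_trans (_ : p * spow (p - 1) u * (u - v) <= _).
    rewrite -[u - v]opprB mulrN; lra.
  apply: le_trans (ler_norm _) _; rewrite !normrM (gtr0_norm p0) normr_spow; last by plra.
  apply: ler_wpM2r => //; rewrite ler_pM2l//.
  by apply: ge0_ler_powR; rewrite ?nnegrE//; [plra|exact: le_trans uM].
move=> xM yM; rewrite ler_norml; apply/andP; split; last exact: main.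
by have := main y x yM; rewrite distrC; lra.
Qed.

Lemma is_derive_close (f g df dg : R -> R) s t e : s <= t ->
  (forall x, s <= x <= t -> is_derive x 1 f (df x)) ->
  (forall x, s <= x <= t -> is_derive x 1 g (dg x)) ->
  (forall x, s <= x <= t -> `|df x - dg x| <= e) ->
  `|(f t - f s) - (g t - g s)| <= e * (t - s).
Proof.
move=> st dF dG dfg.
have [|c cst E] := @is_derive_MVT _ (fun x => f x - g x) (fun x => df x - dg x) s t st.
  by move=> x xst; exact: is_derive_sub (dF x xst) (dG x xst).
have -> : f t - f s - (g t - g s) = f t - g t - (f s - g s) by ring.
rewrite E normrM (ger0_norm (_ : 0 <= t - s)) ?subr_ge0//.
by apply: ler_wpM2r; [rewrite subr_ge0|exact: dfg].
Qed.

Theorem ground_test V B lam w a b eps : a < b -> continuous V -> (forall x, `|V x| <= B) ->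
  ground p a b V lam w -> 0 < eps ->
  exists (x1 x2 : R) (phi dphi : R -> R), [/\ a < x1, x1 < x2 & x2 < b] /\
  [/\ smooth phi, forall x, is_derive x 1 phi (dphi x),
    forall x, ~ (x1 < x < x2) -> phi x = 0 /\ dphi x = 0 &
    forall P N W : R -> R, (forall x, is_derive x 1 P (`|dphi x| `^ p)) ->
      (forall x, is_derive x 1 N (`|phi x| `^ p)) ->
      (forall x, is_derive x 1 W (V x * `|phi x| `^ p)) ->
    P x2 - P x1 + (W x2 - W x1) <= (lam + eps) * (N x2 - N x1) /\ 0 < N x2 - N x1].
Proof.
move=> ab cV VB gw eps0; have e20 : 0 < eps / 2 by lra.
have [x1 [x2 [u [du [P [N [W [[ax1 x12 x2b u1 u2] [dU dP dN dW [PWN N0]]]]]]]]]] :=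
  ground_profile ab cV VB gw e20.
have p0 : 0 < p by plra.
have cu : {within `[x1, x2], continuous (fun x => `|u x|)}.
  have cu := is_derive_within dU; move=> x; apply: cvg_norm; exact: cu.
have [cM _ cMP] := EVT_max (ltW x12) cu.
set M := `|u cM| in cMP; have M0 : 0 <= M by exact: normr_ge0.
pose L := p * (M + 1) `^ (p - 1).
have L0 : 0 <= L by rewrite mulr_ge0 ?powR_ge0// ltW.
pose tau (e : R) := L * e * (x2 - x1).
(* Total loss from replacing the truncated eigenfunction by its interpolation: a factor (1 + e)^p on
   the gradient term, and a uniform error [e] in the others. It has to fit into the remaining eps /
   2. *)
pose err (e : R) := (`|1 + e| `^ p - 1) * (P x2 - P x1) + (B + `|lam + eps|) * tau e.
have B0 : 0 <= B by exact: le_trans (VB 0).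
have [eta [eta0 eta1 etaN etaE]] : exists eta : R,
    [/\ 0 < eta, eta < 1, tau eta < N x2 - N x1 & err eta < eps / 2 * (N x2 - N x1)].
  have tauC : tau e @[e --> (0:R)^'+] --> L * 0 * (x2 - x1).
    apply: cvgM; last exact: cvg_cst.
    by apply: cvgM; [exact: cvg_cst|apply: cvg_at_right_filter; exact: cvg_id].
  have errC : err e @[e --> (0:R)^'+] -->
      (`|1 + 0| `^ p - 1) * (P x2 - P x1) + (B + `|lam + eps|) * (L * 0 * (x2 - x1)).
    apply: cvgD; last by apply: cvgM; [exact: cvg_cst|exact: tauC].
    apply: cvgM; last exact: cvg_cst.
    apply: cvgB; last exact: cvg_cst.
    apply: cvg_at_right_filter.
    have C : {for (0 : R), continuous (fun e : R => `|1 + e| `^ p)}.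
      apply: abspow_comp_continuous => //.
      by apply: cvgD; [exact: cvg_cst|exact: cvg_id].
    exact: C.
  rewrite mulr0 mul0r in tauC errC.
  rewrite addr0 normr1 powR1 subrr mul0r mulr0 addr0 in errC.
  apply: (@filter_ex _ ((0 : R)^'+)); near=> e; split.
  - by near: e; exact: nbhs_right_gt.
  - by near: e; exact: nbhs_right_lt.
  - by near: e; apply: cvgr_lt tauC _ N0.
  - by near: e; apply: cvgr_lt errC _ _; rewrite mulr_gt0.
have [phi [dphi [sphi dphiE phi0 phiE phiu]]] :=
  interpolation p1 x12 eta0 (jensen p1 dU dP) u1 u2.
exists x1, x2, phi, dphi; split => //; split => // P' N' W' dP' dN' dW'.
have hP := phiE P' dP'.
have uM x : x1 <= x <= x2 -> `|u x| <= M by move=> xx; apply: cMP; rewrite in_itv.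
have close x : x1 <= x <= x2 -> `| `|phi x| `^ p - `|u x| `^ p| <= L * eta.
  move=> xx; have h := phiu x xx; have h2 := uM x xx.
  apply: le_trans (abspow_lipschitz (_ : _ <= M + 1) (_ : _ <= M + 1)) _; last 2 first.
  - by lra.
  - by apply: ler_wpM2l => //.
  rewrite -[phi x](subrK (u x)); apply: le_trans (ler_normD _ _) _; lra.
have hN : `|(N' x2 - N' x1) - (N x2 - N x1)| <= tau eta.
  exact: (is_derive_close (ltW x12) (fun x _ => dN' x) dN close).
have hW : `|(W' x2 - W' x1) - (W x2 - W x1)| <= B * tau eta.
  rewrite /tau mulrA; apply: (is_derive_close (ltW x12) (fun x _ => dW' x) dW) => x xx.
  by rewrite -mulrBr normrM ler_pM// close.
rewrite /err (ger0_norm (_ : 0 <= 1 + eta)) in etaE; last by lra.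
move: hP hN hW PWN N0 etaN etaE.
move: (N x2 - N x1) (N' x2 - N' x1) (W x2 - W x1) (W' x2 - W' x1) => DN DN' DW DW'.
move: (P x2 - P x1) (P' x2 - P' x1) ((1 + eta) `^ p) (tau eta) => DP DP' Q T.
clear => hP; rewrite !ler_norml => /andP[n1 n2] /andP[w1 w2] PWN N0 TN TE.
split; last by lra.
have h : - (`|lam + eps| * T) <= (lam + eps) * (DN' - DN).
  rewrite lerNl -mulrN; apply: le_trans (ler_norm _) _.
  by rewrite normrM normrN; apply: ler_wpM2l => //; rewrite ler_norml n1 n2.
rewrite mulrBr in h; rewrite mulrBl mul1r in TE; rewrite [(B + _) * T]mulrDl in TE.
have e1 : (lam + eps) * DN = (lam + eps / 2) * DN + eps / 2 * DN by field.
by move: h PWN TE; rewrite e1; lra.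
Unshelve. all: by end_near. Qed.

End ground_state.

(** * Upper bounds for the variational eigenvalues *)

Section upper_bounds.
Context {R : realType}.
Variables (p : R) (p1 : 1 < p) (D : R) (D0 : 0 < D).
Local Ltac plra := let H := fresh in let H2 := fresh in pose proof p1 as H; pose proof D0 as H2; lra.
Local Notation leb := (@lebesgue_measure R).
Local Notation mu := (lebesgue_itvD D).
Local Notation Lp := (LspaceType mu (EFin_le1 p1)).
Local Notation a := (- (D / 2)).
Local Notation b := (D / 2).
Implicit Types (phi dphi V P N W : R -> R) (s t x lam eps : R) (u : Lp * Lp).

Definition profile s t phi dphi : Prop :=
  [/\ smooth phi, forall x, is_derive x 1 phi (dphi x) &
      forall x, ~ (s < x < t) -> phi x = 0 /\ dphi x = 0].

Lemma profile_derive s t phi dphi : profile s t phi dphi -> dphi = (phi^`())%classic.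
Proof.
by move=> [sphi dE _]; apply/funext => x; exact: is_derive_unique (dE x) (smooth_derive sphi x).
Qed.

Lemma profile_widen s t s' t' phi dphi : s' <= s -> t <= t' ->
  profile s t phi dphi -> profile s' t' phi dphi.
Proof.
move=> ss tt [? ? z]; split => // x xst; apply: z => /andP[sx xt].
by apply: xst; rewrite (le_lt_trans ss sx) (lt_le_trans xt tt).
Qed.

Lemma profile_test s t phi dphi : a < s -> t < b -> profile s t phi dphi ->
  test_function D phi.
Proof.
move=> as_ tb [sphi _ z]; split; first by move=> n x; exact: smooth_derivable.
exists `[s, t]%classic; split; first exact: segment_compact.
- exact: segment_sub_itvD.
- move=> x /= /negP; rewrite in_itv/= => xst; apply: (z x _).1 => /andP[sx xt].
  by move/negP: xst; apply; rewrite !ltW.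
Qed.

Definition represents u phi dphi : Prop :=
  (u.1 : R -> R) = phi %[ae mu] /\ (u.2 : R -> R) = dphi %[ae mu].

Lemma supp_Lfun s t (f : R -> R) : a < s -> s < t -> t < b -> continuous f ->
  (forall x, ~ (s < x < t) -> f x = 0) -> f \in Lfun mu p%:E.
Proof.
move=> as_ st tb cf f0; have p0 : 0 < p by plra.
have cfp : continuous (fun x => `|f x| `^ p).
  by move=> x; apply: abspow_comp_continuous => //; exact: cf.
have [F dF] := primitive_exists cfp.
have mf : measurable_fun setT f by exact: continuous_measurable_fun.
rewrite inE; apply/andP; split; rewrite inE//= /finite_norm.
have pN0 : p != 0 by rewrite gt_eqF.
apply: (lty_poweRy pN0); rewrite powR_Lnorm//=.
rewrite itvD_integralT; last by apply/measurable_EFinP; exact: continuous_measurable_fun.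
rewrite (@supp_integral _ _ _ _ s t)//; first exact: ltry.
- exact: ltW.
- exact: segment_sub_itvD.
- move=> x _ xst; rewrite f0 ?normr0 ?powR0// => /andP[sx xt]; apply: xst.
  by rewrite !ltW.
Qed.

Lemma profile_represented s t phi dphi : a < s -> s < t -> t < b -> profile s t phi dphi ->
  exists u, represents u phi dphi.
Proof.
move=> as_ st tb [sphi dE z].
have l1 := supp_Lfun as_ st tb (smooth_continuous sphi) (fun x xst => (z x xst).1).
have l2 := supp_Lfun as_ st tb (smooth_derive_continuous sphi dE) (fun x xst => (z x xst).2).
exists (Lspace_class (Lfun_Sub (EFin_le1 p1) l1), Lspace_class (Lfun_Sub (EFin_le1 p1) l2)).
by split; exact: Lspace_classE.
Qed.

Lemma represents_lin u1 u2 phi1 dphi1 phi2 dphi2 (c1 c2 : R) :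
  represents u1 phi1 dphi1 -> represents u2 phi2 dphi2 ->
  represents (c1 *: u1 + c2 *: u2) (fun x => c1 * phi1 x + c2 * phi2 x)
    (fun x => c1 * dphi1 x + c2 * dphi2 x).
Proof.
have lin (f1 f2 : Lp) (g1 g2 : R -> R) : (f1 : R -> R) = g1 %[ae mu] ->
    (f2 : R -> R) = g2 %[ae mu] ->
    (c1 *: f1 + c2 *: f2 : R -> R) = (fun x => c1 * g1 x + c2 * g2 x) %[ae mu].
  have sc (c : R) (f : Lp) (g : R -> R) : (f : R -> R) = g %[ae mu] ->
      (c *: f : R -> R) = (fun x => c * g x) %[ae mu].
    have e := LspaceZE c f; move: e.
    by apply: filterS2 => x /(_ I) h1 /(_ I) h2 _; rewrite h1 /= h2.
  move=> /(sc c1) e1 /(sc c2) e2; have e3 := LspaceDE (c1 *: f1) (c2 *: f2); move: e1 e2 e3.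
  by apply: filterS3 => x /(_ I) h1 /(_ I) h2 /(_ I) h3 _; rewrite h3 /= h1 h2.
by move=> [e1 e2] [e3 e4]; split; exact: lin.
Qed.

Lemma profile_test_pair s t phi dphi u : a < s -> t < b -> profile s t phi dphi ->
  represents u phi dphi -> test_pair u.
Proof.
move=> as_ tb pr [e1 e2]; exists phi; first exact: profile_test pr.
by split=> //; rewrite -(profile_derive pr).
Qed.

Lemma Rintegral_ae (f : Lp) (g h : R -> R) : (f : R -> R) = g %[ae mu] ->
  measurable_fun setT g -> measurable_fun setT h ->
  (\int[leb]_(x in itvD D) (f x * h x))%R = (\int[leb]_(x in itvD D) (g x * h x))%R.
Proof.
move=> fg mg mh; have mf := Lspace_measurable f.
have m1 : measurable_fun setT (fun x => (f x * h x)%:E).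
  by apply/measurable_EFinP; exact: measurable_funM.
have m2 : measurable_fun setT (fun x => (g x * h x)%:E).
  by apply/measurable_EFinP; exact: measurable_funM.
congr fine; rewrite -(itvD_integralT D m1) -(itvD_integralT D m2).
by apply: ae_eq_integral => //; apply: filterS fg => x /(_ I) e _; rewrite e.
Qed.

Lemma test_pair_W1p0 u : test_pair u -> W1p0 u.
Proof.
move=> tu; split; last exact: subset_closure.
have [phi tphi [e1 e2]] := tu; move=> psi tpsi /=.
have cphi := test_function_continuous tphi.
have cdphi := test_function_derive_continuous tphi.
have cpsi := test_function_continuous tpsi.
have cdpsi := test_function_derive_continuous tpsi.
rewrite (Rintegral_ae e1 (continuous_measurable_fun cphi) (continuous_measurable_fun cdpsi)).
rewrite (Rintegral_ae e2 (continuous_measurable_fun cdphi) (continuous_measurable_fun cpsi)).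
have zab : a < 0 < b by apply/andP; split; plra.
have [s [t [as_ s0 t0 tb z]]] := test_function_supp tphi zab.
have cA : continuous (fun x => phi x * (psi^`())%classic x).
  by move=> x; apply: cvgM; [exact: cphi|exact: cdpsi].
have cB : continuous (fun x => (phi^`())%classic x * psi x).
  by move=> x; apply: cvgM; [exact: cdphi|exact: cpsi].
have [A dA] := primitive_exists cA; have [B dB] := primitive_exists cB.
have st : s <= t by lra.
have sub := segment_sub_itvD as_ tb.
have zz x : ~ (s <= x <= t) -> phi x = 0 /\ (phi^`())%classic x = 0.
  by move=> xst; apply: z => /andP[sx xt]; apply: xst; rewrite !ltW.
rewrite /Rintegral (supp_integral st dA cA sub); last first.
  by move=> x _ /zz[-> _]; rewrite mul0r.
rewrite (supp_integral st dB cB sub) /=; last first.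
  by move=> x _ /zz[_ ->]; rewrite mul0r.
have [ps _] : phi s = 0 /\ (phi^`())%classic s = 0 by apply: z; rewrite ltxx.
have [pt _] : phi t = 0 /\ (phi^`())%classic t = 0 by apply: z; rewrite ltxx andbF.
have : A s + B s - phi s * psi s = A t + B t - phi t * psi t.
  apply: (@is_derive_cst_eq _ (fun x => A x + B x - phi x * psi x)) => // x _.
  have := is_derive_sub (is_derive_add (dA x) (dB x))
    (is_derive_mul (test_function_is_derive x tphi) (test_function_is_derive x tpsi)).
  by move/is_derive_eq; apply; ring.
by rewrite ps pt !mul0r !subr0; lra.
Qed.

Lemma profile_values V s t phi dphi u P N W : a < s -> s < t -> t < b -> continuous V ->
  profile s t phi dphi -> represents u phi dphi ->
  (forall x, is_derive x 1 P (`|dphi x| `^ p)) ->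
  (forall x, is_derive x 1 N (`|phi x| `^ p)) ->
  (forall x, is_derive x 1 W (V x * `|phi x| `^ p)) ->
  energy V u = (P t - P s + (W t - W s))%:E /\ `|u.1| `^ p = N t - N s.
Proof.
move=> as_ st tb cV pr [e1 e2] dP dN dW.
have p0 : 0 < p by plra.
have pN0 : p != 0 by rewrite gt_eqF.
have tphi := profile_test as_ tb pr.
have [sphi dE z] := pr.
have e2' := e2; rewrite (profile_derive pr) in e2'.
have zz x : ~ (s <= x <= t) -> phi x = 0 /\ dphi x = 0.
  by move=> xst; apply: z => /andP[sx xt]; apply: xst; rewrite !ltW.
have sub := segment_sub_itvD as_ tb.
have cp x : {for x, continuous (fun x => `|phi x| `^ p)}.
  by apply: abspow_comp_continuous => //; exact: smooth_continuous.
have cd x : {for x, continuous (fun x => `|dphi x| `^ p)}.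
  by apply: abspow_comp_continuous => //; exact: smooth_derive_continuous sphi dE x.
have ce : continuous (fun x => `|dphi x| `^ p + V x * `|phi x| `^ p).
  by move=> x; apply: cvgD; [exact: cd|apply: cvgM; [exact: cV|exact: cp]].
split.
- rewrite (test_pair_energy tphi cV e1 e2') -(profile_derive pr).
  have dPW x : is_derive x 1 (fun x => P x + W x) (`|dphi x| `^ p + V x * `|phi x| `^ p).
    exact: is_derive_add.
  rewrite (supp_integral (ltW st) dPW ce sub); first by congr EFin; ring.
  by move=> x _ /zz[-> ->]; rewrite normr0 powR0// mulr0 addr0.
- have := test_pair_norm D0 tphi e1; rewrite (supp_integral (ltW st) dN cp sub); first by case.
  by move=> x _ /zz[-> _]; rewrite normr0 powR0.
Qed.

Lemma profile_primitives V s t phi dphi : continuous V -> profile s t phi dphi ->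
  exists P N W : R -> R, [/\ forall x, is_derive x 1 P (`|dphi x| `^ p),
    forall x, is_derive x 1 N (`|phi x| `^ p) &
    forall x, is_derive x 1 W (V x * `|phi x| `^ p)].
Proof.
move=> cV [sphi dE _]; have p0 : 0 < p by plra.
have cp x : {for x, continuous (fun x => `|phi x| `^ p)}.
  by apply: abspow_comp_continuous => //; exact: smooth_continuous.
have cd x : {for x, continuous (fun x => `|dphi x| `^ p)}.
  by apply: abspow_comp_continuous => //; exact: smooth_derive_continuous sphi dE x.
have cVp : continuous (fun x => V x * `|phi x| `^ p).
  by move=> x; apply: cvgM; [exact: cV|exact: cp].
have [P dP] := primitive_exists cd; have [N dN] := primitive_exists cp.
by have [W dW] := primitive_exists cVp; exists P, N, W.
Qed.

(** Disjoint supports make p-th powers additive, so that on the plane spanned by [u1] and [u2]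
    energy and norm are weighted l^p expressions in the coefficients. *)
Lemma span_values V s t phi1 dphi1 phi2 dphi2 u1 u2 (c1 c2 e1 e2 : R) :
  a < s -> s < t -> t < b -> continuous V ->
  profile s t phi1 dphi1 -> profile s t phi2 dphi2 ->
  (forall x, (phi1 x = 0 /\ dphi1 x = 0) \/ (phi2 x = 0 /\ dphi2 x = 0)) ->
  represents u1 phi1 dphi1 -> represents u2 phi2 dphi2 ->
  energy V u1 = e1%:E -> energy V u2 = e2%:E ->
  let w := c1 *: u1 + c2 *: u2 in
  [/\ test_pair w, energy V w = (`|c1| `^ p * e1 + `|c2| `^ p * e2)%:E &
    `|w.1| `^ p = `|c1| `^ p * `|u1.1| `^ p + `|c2| `^ p * `|u2.1| `^ p].
Proof.
move=> as_ st tb cV pr1 pr2 disj r1 r2 E1 E2 w.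
have [P1 [N1 [W1 [dP1 dN1 dW1]]]] := profile_primitives cV pr1.
have [P2 [N2 [W2 [dP2 dN2 dW2]]]] := profile_primitives cV pr2.
have pN0 : p != 0 by rewrite gt_eqF//; plra.
have rw : represents w _ _ := represents_lin c1 c2 r1 r2.
have pw : profile s t (fun x => c1 * phi1 x + c2 * phi2 x) (fun x => c1 * dphi1 x + c2 * dphi2 x).
  case: pr1 pr2 => [s1 d1 z1] [s2 d2 z2]; split.
  - by apply: smooth_add; exact: smooth_scale.
  - by move=> x; apply: is_derive_add; exact: is_derive_scale.
  - by move=> x xst; have [-> ->] := z1 x xst; have [-> ->] := z2 x xst; rewrite !mulr0 addr0.
have split_pow (y1 y2 : R) : y1 = 0 \/ y2 = 0 ->
    `|c1 * y1 + c2 * y2| `^ p = `|c1| `^ p * `|y1| `^ p + `|c2| `^ p * `|y2| `^ p.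
  by case=> ->; rewrite mulr0 ?addr0 ?add0r normrM powRM// normr0 powR0// mulr0 ?addr0 ?add0r.
have d1 x : phi1 x = 0 \/ phi2 x = 0 by case: (disj x) => -[]; [left|right].
have d2 x : dphi1 x = 0 \/ dphi2 x = 0 by case: (disj x) => -[]; [left|right].
pose C1 := `|c1| `^ p; pose C2 := `|c2| `^ p.
have lin (F1 F2 f1 f2 : R -> R) : (forall x, is_derive x 1 F1 (f1 x)) ->
    (forall x, is_derive x 1 F2 (f2 x)) ->
    forall x, is_derive x 1 (fun x => C1 * F1 x + C2 * F2 x) (C1 * f1 x + C2 * f2 x).
  by move=> h1 h2 x; apply: is_derive_add; exact: is_derive_scale.
have [|||EE NN] := @profile_values V s t _ _ w (fun x => C1 * P1 x + C2 * P2 x)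
  (fun x => C1 * N1 x + C2 * N2 x) (fun x => C1 * W1 x + C2 * W2 x) as_ st tb cV pw rw.
- by move=> x; rewrite split_pow//; exact: lin dP1 dP2 x.
- by move=> x; rewrite split_pow//; exact: lin dN1 dN2 x.
- move=> x; rewrite split_pow// mulrDr mulrCA [V x * (_ `^ p * _)]mulrCA.
  exact: lin dW1 dW2 x.
have [E1' ->] := profile_values as_ st tb cV pr1 r1 dP1 dN1 dW1.
have [E2' ->] := profile_values as_ st tb cV pr2 r2 dP2 dN2 dW2.
move: E1' E2'; rewrite E1 E2 => -[->] [->]; split; first exact: profile_test_pair pw rw.
- by rewrite EE; congr EFin; rewrite -/C1 -/C2; ring.
- by rewrite NN -/C1 -/C2; ring.
Qed.

(** [k] is the reciprocal of the norm of [u.1], so [k^p e] is the Rayleigh quotient of [u]. *)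
Lemma ground_element V B lam (w : R -> R) (c d eps : R) : continuous V ->
  (forall x, `|V x| <= B) -> a <= c -> c < d -> d <= b -> ground p c d V lam w -> 0 < eps ->
  exists (s t : R) (phi dphi : R -> R) (u : Lp * Lp) (e k : R),
  [/\ c < s, s < t, t < d & profile s t phi dphi] /\
  [/\ represents u phi dphi, energy V u = e%:E, 0 < k, k `^ p * `|u.1| `^ p = 1 &
      k `^ p * e <= lam + eps].
Proof.
move=> cV VB ac cd db gw eps0.
have [s [t [phi [dphi [[cs st td] [sphi dE z vals]]]]]] := ground_test p1 cd cV VB gw eps0.
have pr : profile s t phi dphi by split.
have as_ := le_lt_trans ac cs; have tb := lt_le_trans td db.
have [u ru] := profile_represented as_ st tb pr.
have [P [N [W [dP dN dW]]]] := profile_primitives cV pr.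
have [E1 N1] := profile_values as_ st tb cV pr ru dP dN dW.
have [h N0] := vals P N W dP dN dW.
have pN0 : p != 0 by rewrite gt_eqF//; plra.
have kE : ((`|u.1| `^ p) `^ - p^-1) `^ p * `|u.1| `^ p = 1.
  by rewrite N1 -powRrM mulNr mulVf// powRN powRr1 ?(ltW N0)// mulVf// gt_eqF.
exists s, t, phi, dphi, u, (P t - P s + (W t - W s)), ((`|u.1| `^ p) `^ - p^-1).
split=> //; split=> //; first by rewrite powR_gt0// N1.
apply: le_trans (ler_wpM2l (powR_ge0 _ _) h) _.
by rewrite mulrCA -N1 kE mulr1.
Qed.

Lemma powR_eq1 x : 0 <= x -> x `^ p = 1 -> x = 1.
Proof.
move=> x0 xp; have pN0 : p != 0 by rewrite gt_eqF//; plra.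
transitivity (x `^ (p * p^-1)); first by rewrite mulfV// powRr1.
by rewrite powRrM xp powR1.
Qed.

Theorem lambda1_le V B lam (w : R -> R) : continuous V -> (forall x, `|V x| <= B) ->
  ground p a b V lam w -> (lambda p1 D 1 V <= lam%:E)%E.
Proof.
move=> cV VB gw; apply/lee_addgt0Pr => eps eps0.
have ab : a < b by plra.
have [s [t [phi [dphi [u [e [k [[cs st td pr] [ru Eu k0 ku ke]]]]]]]]] :=
  ground_element cV VB (lexx _) ab (lexx _) gw eps0.
(* The zero profile as second generator lets the two-function computation serve for a single one. *)
pose Z : R -> R := fun=> 0.
have prZ : profile s t Z Z by split=> //; [exact: smooth_cst|move=> x; exact: is_derive_const].
have [z rz] := profile_represented cs st td prZ.
have zE : energy V z = 0%:E.
  have c0 : forall x, is_derive x 1 Z 0 by move=> x; exact: is_derive_const.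
  have pN0 : p != 0 by rewrite gt_eqF//; plra.
  have [|||-> _] := @profile_values V s t Z Z z Z Z Z cs st td cV prZ rz.
  - by move=> x; rewrite normr0 powR0.
  - by move=> x; rewrite normr0 powR0.
  - by move=> x; rewrite normr0 powR0// mulr0.
  by rewrite subrr addr0.
have el (c : R) : `|c| = k -> unit_sphere (c *: u) /\ (energy V (c *: u) <= (lam + eps)%:E)%E.
  move=> ck.
  have := span_values c 0 cs st td cV pr prZ (fun x => or_intror (conj erefl erefl)) ru rz Eu zE.
  lazy zeta; rewrite scale0r addr0 !mulr0 !addr0 ck normr0 powR0 ?mul0r ?addr0 ?gt_eqF//; last by plra.
  rewrite ku => -[tp -> n1]; split; last by rewrite lee_fin.
  by split; [exact: test_pair_W1p0|rewrite /=; apply: powR_eq1].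
apply: ge_ereal_inf; exists (ereal_sup (energy V @` [set k *: u; (- k) *: u])); last first.
  apply: ub_ereal_sup => _ [v vA <-]; rewrite -EFinD.
  case: vA => ->; apply: (el _ _).2; rewrite ?normrN gtr0_norm//.
exists [set k *: u; (- k) *: u] => //; split.
- by move=> v [] ->; apply: (el _ _).1; rewrite ?normrN gtr0_norm.
- by apply: compactU; exact: compact_set1.
- rewrite eqEsubset; split => v.
    by move=> [->|->]; [exists ((- k) *: u); [right|rewrite scaleNr opprK]|exists (k *: u); [left|rewrite scaleNr]].
  by move=> [v' [->|->] <-]; [right; rewrite scaleNr|left; rewrite scaleNr opprK].
- apply: le_ereal_inf_tmp => _ [n [h [hc hodd h0]] <-]; rewrite lee_fin ler_nat.
  case: n h hc hodd h0 => // h _ _ h0.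
  have := h0 (k *: u) (or_introl erefl); rewrite [h _]thinmx0 => /negP; rewrite eqxx//.
Qed.

Lemma odd_path_zero (f : R -> R) : {within `[-1, 1], continuous f} -> f (-1) = - f 1 ->
  exists2 x, -1 <= x <= 1 & f x = 0.
Proof.
move=> cf fN; have [||x] := @IVT _ f (-1) 1 0 _ cf; first by lra.
  by rewrite fN; case: (leP (- f 1) (f 1)) => h; apply/andP; split; lra.
by rewrite in_itv/= => xI fx; exists x.
Qed.

Lemma odd_map_path (A : set (Lp * Lp)) (h : Lp * Lp -> 'rV[R]_1) (g : R -> Lp * Lp) :
  {within A, continuous h} -> continuous g -> (forall s, -1 <= s <= 1 -> A (g s)) ->
  {within `[-1, 1], continuous (fun s : R => h (g s) 0 0)}.
Proof.
move=> hc gc gA.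
apply/subspace_continuousP => x /= xI; rewrite in_itv/= in xI.
have hx := (subspace_continuousP _ _).1 hc (g x) (gA x xI).
have c00 : continuous (fun M : 'rV[R]_1 => M 0 0) by exact: coord_continuous.
apply: (cvg_comp (fun s : R => h (g s)) (fun M : 'rV[R]_1 => M 0 0)); last exact: c00.
apply: (cvg_comp g h); last exact: hx.
move=> U hU; have hU' : nbhs (g x) [set y | A y -> U y] by exact: hU.
suff : nbhs x [set y | `[-1, 1]%classic y -> U (g y)] by [].
apply: (@filterS R (nbhs x) (nbhs_filter x) (fun s => A (g s) -> U (g s))).
  by move=> y yU yI; apply: yU; apply: gA; rewrite /= in_itv/= in yI.
exact: (gc x _ hU').
Qed.

(** Along a path joining a point to its opposite, an odd real-valued map changes sign and vanishes;
    so a set containing such a path has genus at least 2. *)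
Lemma odd_path_obstruction (A : set (Lp * Lp)) (g : R -> Lp * Lp) n : continuous g ->
  (forall s, -1 <= s <= 1 -> A (g s)) -> g (-1) = - g 1 -> odd_map_to A n -> (1 < n)%N.
Proof.
move=> gc gA gN [h [hc hodd h0]].
have one1 : -1 <= (1 : R) <= 1 by rewrite lexx andbT; lra.
case: n h hc hodd h0 => [|[|n]] // h hc hodd h0.
  by have := h0 (g 1) (gA 1 one1); rewrite [h _]thinmx0 eqxx.
exfalso; have fc := odd_map_path hc gc gA.
have fN : h (g (-1)) 0 0 = - (h (g 1) 0 0) by rewrite gN hodd ?mxE//; exact: gA.
have [x xI fx] := odd_path_zero fc fN.
have /eqP := h0 (g x) (gA x xI); apply.
by apply/matrixP => i j; rewrite !ord1 fx mxE.
Qed.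

Theorem lambda2_le V B lam (w1 w2 : R -> R) c : continuous V -> (forall x, `|V x| <= B) ->
  a < c < b -> ground p a c V lam w1 -> ground p c b V lam w2 ->
  (lambda p1 D 2 V <= lam%:E)%E.
Proof.
move=> cV VB /andP[ac cb] g1 g2; apply/lee_addgt0Pr => eps eps0.
have [s1 [t1 [f1 [df1 [u1 [e1 [k1 [[cs1 st1 td1 pr1] [r1 E1 k10 ku1 ke1]]]]]]]]] :=
  ground_element cV VB (lexx _) ac (ltW cb) g1 eps0.
have [s2 [t2 [f2 [df2 [u2 [e2 [k2 [[cs2 st2 td2 pr2] [r2 E2 k20 ku2 ke2]]]]]]]]] :=
  ground_element cV VB (ltW ac) cb (lexx _) g2 eps0.
have t12 : t1 < s2 by exact: lt_trans cs2.
have pr1' := profile_widen (lexx _) (ltW (lt_trans t12 st2)) pr1.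
have pr2' := profile_widen (ltW (lt_trans st1 t12)) (lexx _) pr2.
have st : s1 < t2 by apply: lt_trans st1 _; exact: lt_trans st2.
have disj x : (f1 x = 0 /\ df1 x = 0) \/ (f2 x = 0 /\ df2 x = 0).
  have [xt|xt] := ltP x t1; last first.
    by left; case: pr1 => _ _; apply => /andP[_]; rewrite ltNge xt.
  right; case: pr2 => _ _; apply => /andP[sx _].
  by have := lt_trans t12 (lt_trans sx xt); rewrite ltxx.
have p0 : 0 < p by plra.
have el (c1 c2 : R) : `|c1| `^ p + `|c2| `^ p = 1 ->
    let w := (c1 * k1) *: u1 + (c2 * k2) *: u2 in
    unit_sphere w /\ (energy V w <= (lam + eps)%:E)%E.
  move=> c12 w.
  have [tp En n1] := span_values (c1 * k1) (c2 * k2) cs1 st td2 cV pr1' pr2' disj r1 r2 E1 E2.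
  have ck (c0 k : R) : 0 < k -> `|c0 * k| `^ p = `|c0| `^ p * k `^ p.
    by move=> kp; rewrite normrM (gtr0_norm kp) powRM// ltW.
  rewrite !ck// -!mulrA in En n1.
  rewrite ku1 ku2 !mulr1 c12 in n1.
  split; first by split; [exact: test_pair_W1p0|rewrite /=; apply: powR_eq1].
  rewrite En lee_fin -[lam + eps]mul1r -c12 mulrDl.
  by apply: lerD; apply: ler_wpM2l => //; exact: powR_ge0.
(* Half of the l^p unit circle is the graph of [tau] over [-1, 1]; the maximum with 0 makes [tau]
   continuous on the whole line. *)
pose tau (x : R) : R := `|Num.max 0 (1 - `|x| `^ p)| `^ p^-1.
have tau_c : continuous tau.
  move=> x; apply: (@abspow_comp_continuous _ _ (fun x => Num.max 0 (1 - `|x| `^ p))).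
    by rewrite invr_gt0.
  apply: continuous_max; first exact: cvg_cst.
  by apply: cvgB; [exact: cvg_cst|exact: abspow_continuous].
have tauP (x : R) : -1 <= x <= 1 -> `|x| `^ p + `|tau x| `^ p = 1.
  move=> xI; have x1 : `|x| `^ p <= 1.
    by apply: powR_le1 => //; rewrite normr_ge0 ler_norml.
  rewrite (ger0_norm (powR_ge0 _ _)) -powRrM mulVf ?gt_eqF// powRr1//.
  have -> : Num.max 0 (1 - `|x| `^ p) = 1 - `|x| `^ p.
    by apply/max_idPr; rewrite subr_ge0.
  by rewrite [X in _ + X]ger0_norm ?subr_ge0// addrC subrK.
pose g (x : R) : Lp * Lp := (x * k1) *: u1 + (tau x * k2) *: u2.
have gc : continuous g.
  move=> x; apply: cvgD; apply: cvgZr_tmp; apply: cvgM; [exact: cvg_id|exact: cvg_cst|exact: tau_c|exact: cvg_cst].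
have gNc : continuous (fun x => - g x) by move=> x; apply: cvgN; exact: gc.
(* The l^p unit circle of the plane of the two normalized functions: a half circle together with its
   opposite. *)
pose A := (g @` `[-1, 1]) `|` ((fun x => - g x) @` `[-1, 1]).
have elA v : A v -> unit_sphere v /\ (energy V v <= (lam + eps)%:E)%E.
  case=> -[x /=]; rewrite in_itv/= => xI <-; first exact: (el x (tau x) (tauP x xI)).
  have -> : - g x = ((- x) * k1) *: u1 + ((- tau x) * k2) *: u2.
    by rewrite /g !mulNr !scaleNr opprD.
  by apply: el; rewrite !normrN; exact: tauP.
apply: ge_ereal_inf; exists (ereal_sup (energy V @` A)); last first.
  by apply: ub_ereal_sup => _ [v vA <-]; rewrite -EFinD; exact: (elA v vA).2.
exists A => //; split.
- by move=> v /elA[].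
- apply: compactU; apply: continuous_compact; try exact: segment_compact.
    by apply: continuous_subspaceT => x; exact: gc.
  by apply: continuous_subspaceT => x; exact: gNc.
- rewrite eqEsubset; split => v.
    move=> [[x xI <-]|[x xI <-]]; last by exists (g x); [left; exists x|].
    by exists (- g x); [right; exists x|rewrite opprK].
  move=> [_ [[x xI <-]|[x xI <-]] <-]; first by right; exists x.
  by left; exists x => //; rewrite opprK.
- have gA (x : R) : -1 <= x <= 1 -> A (g x) by move=> xI; left; exists x; rewrite //= in_itv.
  have gN : g (-1) = - g 1.
    have ta1 : tau 1 = 0 by rewrite /tau normr1 powR1 subrr maxxx abspow0// gt_eqF// invr_gt0.
    have ta1N : tau (-1) = 0 by rewrite /tau normrN -/(tau 1).
    by rewrite /g ta1 ta1N !mul0r !scale0r !addr0 mulN1r mul1r scaleNr.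
  apply: le_ereal_inf_tmp => _ [n An <-]; rewrite lee_fin ler_nat.
  exact: odd_path_obstruction gc gA gN An.
Qed.

End upper_bounds.

(** * The gap of the variational eigenvalues *)

Section conclusion.
Context {R : realType}.
Variables (p : R) (p1 : 1 < p) (D : R) (D0 : 0 < D).
Local Ltac plra := let H := fresh in let H2 := fresh in pose proof p1 as H; pose proof D0 as H2; lra.
Local Notation a := (- (D / 2)).
Local Notation b := (D / 2).
Implicit Types (V : R -> R) (x y z c : R).

Let ab : a < b. Proof. plra. Qed.

Lemma clamp_citvD x : citvD D (clamp a b x).
Proof. by rewrite /citvD /= in_itv/=; exact: clamp_itv (ltW ab). Qed.

Lemma continuous_clamp V : {within citvD D, continuous V} -> continuous (V \o clamp a b).
Proof.
move=> cV x; have hx := (subspace_continuousP _ _).1 cV _ (clamp_citvD x).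
apply: (cvg_comp (clamp a b) V); last exact: hx.
move=> U hU; apply: (@filterS R (nbhs x) (nbhs_filter x)
  (fun y => citvD D (clamp a b y) -> U (clamp a b y))).
  by move=> y; apply; exact: clamp_citvD.
exact: (@clamp_continuous R a b x _ hU).
Qed.

Lemma clamp_bounded V : {within citvD D, continuous V} ->
  exists B, forall x, `|(V \o clamp a b) x| <= B.
Proof.
move=> cV; have cW := continuous_clamp cV.
have cN : {within `[a, b], continuous (fun x => `|(V \o clamp a b) x|)}.
  apply: continuous_subspaceT => x; apply: (@continuous_comp R R R (V \o clamp a b)).
    exact: cW.
  exact: norm_continuous.
have [c _ cP] := EVT_max (ltW ab) cN.
exists `|(V \o clamp a b) c| => x.
have := cP (clamp a b x); rewrite in_itv/= (clamp_itv _ (ltW ab)) => /(_ isT).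
by rewrite (@clamp_id _ a b (clamp a b x))// clamp_itv// ltW.
Qed.

Lemma lambda_ext k V W : (forall x, citvD D x -> V x = W x) ->
  lambda p1 D k V = lambda p1 D k W.
Proof.
move=> VW; rewrite /lambda; have -> // : @energy _ _ p1 D V = @energy _ _ p1 D W.
apply/funext => w; apply: eq_integral => x; rewrite inE /itvD/= in_itv/= => /andP[ax xb].
by rewrite VW// /citvD/= in_itv/= !ltW.
Qed.

Lemma convex_function_conv3 V : @convex_function R R^o (citvD D) V -> conv3 a b V.
Proof.
move=> cV x y z ax xy yz zb.
have t0 : 0 <= (z - y) / (z - x) by rewrite divr_ge0; lra.
have t1 : (z - y) / (z - x) <= 1 by rewrite ler_pdivrMr; lra.
have xI : x \in citvD D by rewrite inE /citvD/= in_itv/=; apply/andP; split; lra.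
have zI : z \in citvD D by rewrite inE /citvD/= in_itv/=; apply/andP; split; lra.
have zx : z - x != 0 by rewrite gt_eqF; lra.
pose t := (z - y) / (z - x).
have h : V (t * x + (1 - t) * z) <= t * V x + (1 - t) * V z.
  exact: (cV (Itv01 t0 t1) x z xI zI).
have tE : t * x + (1 - t) * z = y by rewrite /t; field.
rewrite tE /t in h.
have zx0 : 0 <= z - x by lra.
have := ler_wpM2l zx0 h; move=> /le_trans; apply.
by rewrite le_eqVlt; apply/orP; left; apply/eqP; field.
Qed.

(** The first eigenvalue is identified with [lam], while for the second the bound from below by the
    level [nu] suffices: if the gap is attained, [nu] is squeezed to lam + gap and the rigidity of
    [ode_gap] applies to the clamped potential. *)
Lemma lambda_gap V : {within citvD D, continuous V} -> conv3 a b V ->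
  ((gap_bound p D)%:E <= lambda p1 D 2 V - lambda p1 D 1 V)%E /\
  ((lambda p1 D 2 V - lambda p1 D 1 V)%E = (gap_bound p D)%:E ->
    exists c, forall x, citvD D x -> V x = c).
Proof.
move=> cV cvx; pose W := V \o clamp a b.
have cW : continuous W := continuous_clamp cV.
have [B WB] := clamp_bounded cV.
have VW x : citvD D x -> V x = W x.
  by rewrite /citvD /= in_itv/= => xI; rewrite /W /= clamp_id.
have cvxW : conv3 a b W.
  by move=> x y z ax xy yz zb; rewrite -!VW; [exact: cvx|..];
    rewrite /citvD/= in_itv/=; apply/andP; split; lra.
have [lam [nu [c [w [w1 [w2 [[gw cab g1 g2] [gap eqc]]]]]]]] := ode_gap p1 D0 cW WB cvxW.
have l1 : lambda p1 D 1 V = lam%:E.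
  rewrite (lambda_ext 1 VW); apply/eqP; rewrite eq_le.
  by rewrite (lambda1_le p1 D0 cW WB gw) (lambda1_ge p1 D0 cW WB gw).
have l2 : (nu%:E <= lambda p1 D 2 V)%E.
  by rewrite (lambda_ext 2 VW); exact: lambda2_ge cW WB cab g1 g2.
rewrite l1; split.
  rewrite leeBrDr// -EFinD; apply: le_trans l2; rewrite lee_fin; lra.
move=> e; have l2E : lambda p1 D 2 V = (lam + gap_bound p D)%:E.
  by rewrite addrC EFinD -e subeK.
rewrite l2E lee_fin in l2.
have [|k Wk] := eqc; first by apply/eqP; rewrite eq_le l2 gap.
exists k => x xI; rewrite (VW x xI).
have ck : continuous (fun _ : R => k) by move=> ?; exact: cvg_cst.
(* Constancy is known on the open interval and extends to the two ends by continuity. *)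
move: xI; rewrite /citvD/= in_itv/= => /andP[].
rewrite le_eqVlt => /predU1P[<- _|ax].
  apply/eqP; rewrite eq_le; apply/andP; split; apply: (@continuous_le_right _ _ _ a b ab);
    try exact: cW; try exact: ck; by move=> y yI; rewrite Wk.
rewrite le_eqVlt => /predU1P[->|xb]; last by apply: Wk; rewrite ax.
by apply/eqP; rewrite eq_le; apply/andP; split; apply: (@continuous_le_left _ _ _ b a ab);
    try exact: cW; try exact: ck; move=> y yI; rewrite Wk.
Qed.

Lemma cst_ground s k c : 0 < k ->
  exists w, ground p s (s + pi_p p / k) (fun=> c) ((p - 1) * k `^ p + c) w.
Proof.
move=> k0; have [dw wa wb] := model_ground p1 s k0.
have e : 2 * half_period p = pi_p p by rewrite /half_period mulrC divfK.
rewrite e in dw wa wb.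
exists (model p k s); split => // x /dw.
by have -> : 0 - (p - 1) * k `^ p = c - ((p - 1) * k `^ p + c) by ring.
Qed.

(** The explicit models: frequency k = pi_p / D on the whole interval, and 2 k on the two halves
    with node 0. *)
Lemma lambda_gap_cst V c : (forall x, citvD D x -> V x = c) ->
  (lambda p1 D 2 V - lambda p1 D 1 V)%E = (gap_bound p D)%:E.
Proof.
move=> Vc; rewrite !(lambda_ext _ Vc).
have cc : continuous (fun _ : R => c) by move=> ?; exact: cvg_cst.
have pi0 : 0 < pi_p p by have := half_period_gt0 p1; rewrite /half_period; lra.
have cB (x : R) : `|c| <= `|c| by [].
pose k := pi_p p / D; have k0 : 0 < k by rewrite divr_gt0.
have [w gw] := cst_ground a c k0.
have [w1 g1] := cst_ground a c (mulr_gt0 (ltr0n _ 2) k0).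
have [w2 g2] := cst_ground 0 c (mulr_gt0 (ltr0n _ 2) k0).
have e0 : a + pi_p p / k = b by rewrite /k; field; rewrite !gt_eqF.
have e1 : a + pi_p p / (2 * k) = 0 by rewrite /k; field; rewrite !gt_eqF.
have e2 : 0 + pi_p p / (2 * k) = b by rewrite /k; field; rewrite !gt_eqF.
rewrite e0 in gw; rewrite e1 in g1; rewrite e2 in g2.
have z0 : a < 0 < b by rewrite oppr_lt0 divr_gt0.
have l1 : lambda p1 D 1 (fun=> c) = ((p - 1) * k `^ p + c)%:E.
  apply/eqP; rewrite eq_le.
  by rewrite (lambda1_le p1 D0 cc cB gw) (lambda1_ge p1 D0 cc cB gw).
have l2 : lambda p1 D 2 (fun=> c) = ((p - 1) * (2 * k) `^ p + c)%:E.
  apply/eqP; rewrite eq_le.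
  by rewrite (lambda2_le p1 D0 cc cB z0 g1 g2) (lambda2_ge p1 D0 cc cB z0 g1 g2).
rewrite l1 l2 -EFinB /gap_bound -/k powRM ?ltW//; congr EFin; ring.
Qed.

End conclusion.

Theorem theorem1p2 (R : realType) (p D : R) (p1 : 1 < p) (D0 : 0 < D) :
  (forall a : R,
    ((gap_bound p D)%:E <=
       lambda p1 D 2 (fun x => a * x)%R - lambda p1 D 1 (fun x => a * x)%R)%E /\
    ((lambda p1 D 2 (fun x => a * x)%R - lambda p1 D 1 (fun x => a * x)%R)%E =
       (gap_bound p D)%:E <-> a = 0)) /\
  (forall V : R -> R,
    {within citvD D, continuous V} ->
    @convex_function R R^o (citvD D) V ->
    ((gap_bound p D)%:E <= lambda p1 D 2 V - lambda p1 D 1 V)%E /\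
    ((lambda p1 D 2 V - lambda p1 D 1 V)%E = (gap_bound p D)%:E <->
       exists c, forall x, citvD D x -> V x = c)).
Proof.
split=> [a|V cV cvx].
  have ca : {within citvD D, continuous (fun x : R => a * x)}.
    by apply: continuous_subspaceT => x; apply: cvgM; [exact: cvg_cst|exact: cvg_id].
  have ac : conv3 (- (D / 2)) (D / 2) (fun x : R => a * x).
    move=> x y z _ _ _ _; rewrite le_eqVlt; apply/orP; left; apply/eqP; ring.
  have [gap gapE] := lambda_gap p1 D0 ca ac; split=> //; split.
    (* A constant linear function has the same value at 0 and at D / 2, hence slope 0. *)
    move=> /gapE[c cP]; have I0 : citvD D 0 by rewrite /citvD/= in_itv/=; apply/andP; split; lra.
    have I1 : citvD D (D / 2) by rewrite /citvD/= in_itv/=; apply/andP; split; lra.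
    have := cP _ I1; have := cP _ I0; rewrite mulr0 => <- /eqP.
    by rewrite mulf_eq0 => /orP[/eqP//|/eqP]; lra.
  by move=> ->; apply: (@lambda_gap_cst _ _ _ _ D0 _ 0) => x _; rewrite mul0r.
have [gap gapE] := lambda_gap p1 D0 cV (convex_function_conv3 cvx); split=> //; split=> //.
by move=> [c cP]; apply: lambda_gap_cst cP.
Qed.
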